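(* Let $C$ be an irreducible and reduced projective Gorenstein rational curve over $\mathbb{C}$ of arithmetic genus $g\ge1$ with only unibranch singularities. Choose an affine coordinate $v$ on the normalization $\mathbb{P}^1$ such that the points corresponding to the singularities are at $v=0$ and at $v=t_1,\dots,t_s$ (with $0,t_1,\dots,t_s$ distinct complex numbers, $s\ge 0$); let $P_0$ be the (smooth) point at $v=\infty$, with coordinate $u=1/v$. Fix a basis $\omega_1,\dots,\omega_g$ of $H^0(C,\omega_C)$ with expansions $\omega_j=\big(\sum_{i\ge0}a_{ij}u^i\big)du$ at $P_0$, and let $A$ be the $g\times\infty$ matrix such that $(A\mathbf x)_j=\sum_{i\ge0}a_{ij}x_{i+1}$ for $\mathbf x=(x_1,x_2,\dots)^t$. Let $\tau(\mathbf x)$ be the tau function of the frame $\iota(\omega_1),\dots,\iota(\omega_g),\iota(\omega_{g+1}),\dots$ with $\omega_{g+i}=u^{-i-1}du$ for $i\ge1$, and let $\theta(z_1,\dots,z_g)$ be a (polynomial) theta function coming from the Abel map with base point $P_0$ and the basis $\omega_1,\dots,\omega_g$. Then there are a constant $c_0\in\mathbb{C}$ and integers $c_1,\dots,c_s\in\mathbb{Z}$ such that $$\tau(\mathbf x)=\exp\left(c_0+\sum_{i=1}^\infty(c_1t_1^i+\dots+c_st_s^i)x_i\right)\cdot\theta(A\mathbf x)$$ in the infinitely many variables $\mathbf x=(x_1,x_2,x_3,\dots)$ (as formal power series).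
   Context: Theta function. $\nu:\mathbb P^1\to C$ is the normalization; a singular point is unibranch if it has a single preimage. Sections of the dualizing sheaf $\omega_C$ are the meromorphic differentials $\omega$ on $\mathbb P^1$ with $\sum_{Q\in\nu^{-1}(P)}\operatorname{Res}_Q(\nu^*(f)\omega)=0$ for all $P\in C$, $f\in\mathcal O_{C,P}$. Let $C_0$ be the smooth locus. For these curves the period group (image of $H_1(C_0,\mathbb Z)$ in $H^0(C,\omega_C)^*$) is zero and $\operatorname{Jac}(C)=H^0(C,\omega_C)^*\cong\mathbb C^g$ via the basis. The theta divisor is the Zariski closure in $\mathbb C^g$ of the image of $C_0^{g-1}$ under $(P_1,\dots,P_{g-1})\mapsto\big(\sum_{k}\int_{P_0}^{P_k}\omega_j\big)_{j=1,\dots,g}$, and a theta function $\theta$ is a reduced polynomial whose zero divisor is the theta divisor (unique up to a nonzero scalar). Tau functions. A frame is a sequence $f_j=\sum_i\xi_{i,j}u^{i+1}\in\mathbb C(\!(u)\!)$ ($j\ge1$), linearly independent, for which there is $\ell$ with $\xi_{-j,j}=1$, $\xi_{i,j}=0$ for $i<-j$ whenever $j>\ell$, and $\xi_{i,j}=0$ for $i<-\ell$ whenever $j\le\ell$. For a partition $\lambda$ put $m_i=\lambda_i-i$ and $\xi_\lambda=\det(\xi_{m_i,j})_{i,j\ge1}$ (the stable value of the $N\times N$ truncations, $N\gg0$). Define $\sigma_i(\mathbf x)$ by $\exp(\sum_{i\ge1}x_iy^i)=\sum_{i\ge0}\sigma_i(\mathbf x)y^i$ (and $\sigma_i=0$ for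 $i<0$), and the Schur–Weierstrass polynomial $\sigma_\lambda(\mathbf x)=\det(\sigma_{\lambda_i+j-i}(\mathbf x))_{1\le i,j\le m}$ for $\lambda=(\lambda_1,\dots,\lambda_m)$. The tau function of the frame is $\tau(\mathbf x)=\sum_\lambda\xi_\lambda\sigma_\lambda(\mathbf x)$ (sum over all partitions). Power series in $\mathbf x$ are graded by $\deg x_i=i$. The map $\iota$ is $\iota(f(u)du)=u^{2-g}f(u)$, with $f$ expanded as a Laurent series at $u=0$; the frame above spans $\iota(H^0(C,L(\infty P_0)))$, where $L=\omega_C(-(g-1)P_0)$ and $H^0(C,L(\infty P_0))=\bigcup_{n\ge0}H^0(C,L(nP_0))$. *)

(* Defs.v *)
(* The complex numbers are R[i] for R : realType; the algebraic part is over an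
   arbitrary field K.  mpoly must be imported before the analysis files. *)
From HB Require Import structures.
From mathcomp Require Import all_boot all_order all_algebra fraction.
From mathcomp Require Import mpoly.
From mathcomp Require Import boolp classical_sets cardinality fsbigop reals.
From mathcomp Require Import complex.
From mathcomp Require Import topology normedtype sequences derive trigo.
From mathcomp Require Import measure lebesgue_measure lebesgue_integral.

Set Implicit Arguments.
Unset Strict Implicit.
Unset Printing Implicit Defensive.

Import Order.TTheory GRing.Theory Num.Theory.
Import numFieldNormedType.Exports.
Local Open Scope classical_set_scope.
Local Open Scope ring_scope.
Local Open Scope complex_scope.

Section ProjectiveLine.
Variable K : fieldType.

(* [Some a] is the point v = a and [None] the point v = oo. *)
Definition proj_line := option K.

(* The function field K(v). *)
Definition ratfun := {fraction {poly K}}.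

Definition cst (c : K) : ratfun := tofrac c%:P.
Definition coord_v : ratfun := tofrac 'X.
Definition coord_u : ratfun := coord_v^-1.

Definition uniformizer (Q : proj_line) : ratfun :=
  if Q is Some a then coord_v - cst a else coord_u.

Definition regular_at (Q : proj_line) : set ratfun :=
  [set f | exists p q : {poly K},
     [/\ q != 0, f = tofrac p / tofrac q &
         if Q is Some a then q.[a] != 0 else (size p <= size q)%N]].

Definition ord_ge (Q : proj_line) (n : int) (f : ratfun) : Prop :=
  regular_at Q (f * uniformizer Q ^ (- n)).

(* A Laurent series sum_i s_i x^i is given by its coefficients s : int -> K. *)
Definition is_laurent (Q : proj_line) (f : ratfun) (s : int -> K) : Prop :=
  exists N : int, (forall i : int, i < N -> s i = 0) /\
    forall n : nat,
      ord_ge Q (N + n%:Z)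
        (f - \sum_(i < n) cst (s (N + i%:Z)) * uniformizer Q ^ (N + i%:Z)).

(* [is_laurent Q f] holds of exactly one s. *)
Definition laurent (Q : proj_line) (f : ratfun) : int -> K :=
  xget (fun=> 0) [set s | is_laurent Q f s].

(* The value of f at Q when f is regular there. *)
Definition value_at (Q : proj_line) (f : ratfun) : K := laurent Q f 0.

(* The meromorphic differential h dv is represented by h.  As u = 1/v, one has
   dv = - v^2 du. *)
Definition du_part (h : ratfun) : ratfun := - coord_v ^+ 2 * h.

Definition residue (Q : proj_line) (h : ratfun) : K :=
  laurent Q (if Q is Some _ then h else du_part h) (-1).

Definition is_basis (V : set ratfun) (n : nat) (e : 'I_n -> ratfun) : Prop :=
  (forall j, V (e j)) /\
  (forall h, V h ->
     exists! c : 'rV[K]_n, h = \sum_(j < n) cst (c 0 j) * e j).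

End ProjectiveLine.

Arguments coord_v {K}.
Arguments coord_u {K}.

(* An integral projective curve C over K (algebraically closed) together with a
   normalization nu : P^1 -> C amounts to the fibres of nu and to the local
   rings of C inside the function field (Serre, Groupes algebriques et corps de
   classes, IV.1).  A point of C is given by any of its preimages Q, and
   [local_ring Q] is the local ring of C at nu Q.  The last two conditions say
   that it is local with residue field K, and that it contains a power of the
   radical of its normalization. *)
Record rational_curve (K : fieldType) := RationalCurve {
  same_image : proj_line K -> proj_line K -> Prop;
  local_ring : proj_line K -> set (ratfun K);
  same_image_refl : forall Q, same_image Q Q;
  same_image_sym : forall Q Q', same_image Q Q' -> same_image Q' Q;
  same_image_trans : forall Q1 Q2 Q3,
    same_image Q1 Q2 -> same_image Q2 Q3 -> same_image Q1 Q3;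
  nu_almost_injective :
    finite_set [set Q | exists2 Q', same_image Q Q' & Q' <> Q];
  nu_birational : finite_set [set Q | local_ring Q <> regular_at Q];
  local_ring_same : forall Q Q',
    same_image Q Q' -> local_ring Q = local_ring Q';
  local_ring_cst : forall Q c, local_ring Q (cst c);
  local_ringB : forall Q f g,
    local_ring Q f -> local_ring Q g -> local_ring Q (f - g);
  local_ringM : forall Q f g,
    local_ring Q f -> local_ring Q g -> local_ring Q (f * g);
  local_ring_value : forall Q f, local_ring Q f ->
    exists c : K, forall Q', same_image Q Q' -> ord_ge Q' 1 (f - cst c);
  local_ring_conductor : forall Q, exists n : nat, forall f,
    (forall Q', same_image Q Q' -> ord_ge Q' n%:Z f) -> local_ring Q f
}.

Section Curve.
Variables (K : fieldType) (C : rational_curve K).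

(* nu Q is a smooth point of C; then Q is the only point above it. *)
Definition smooth (Q : proj_line K) : Prop := local_ring C Q = regular_at Q.

Definition singular (Q : proj_line K) : Prop := ~ smooth Q.

Definition unibranch : Prop :=
  forall Q, singular Q -> forall Q', same_image C Q Q' -> Q' = Q.

(* The stalk of the dualizing sheaf at nu Q. *)
Definition dualizing_stalk (Q : proj_line K) : set (ratfun K) :=
  [set h | forall f, local_ring C Q f ->
     \sum_(Q' \in [set Q' | same_image C Q Q']) residue Q' (f * h) = 0].

(* H^0(C, omega_C) *)
Definition dualizing_sections : set (ratfun K) :=
  [set h | forall Q, dualizing_stalk Q h].

(* The dualizing sheaf is invertible. *)
Definition gorenstein : Prop :=
  forall Q, exists2 h0, h0 != 0 &
    forall h, dualizing_stalk Q h <->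
      exists2 f, local_ring C Q f & h = f * h0.

(* Families (r_P) of rational functions indexed by the points P of C, with r_P
   in the local ring at P for almost all P. *)
Definition repartition (r : proj_line K -> ratfun K) : Prop :=
  (forall Q Q', same_image C Q Q' -> r Q = r Q') /\
  finite_set [set Q | ~ local_ring C Q (r Q)].

(* g = dim H^1(C, O_C), where H^1(C, O_C) is the space of repartitions modulo
   the constant ones and those lying in the local ring at every point. *)
Definition arithmetic_genus (g : nat) : Prop :=
  exists2 e : 'I_g -> proj_line K -> ratfun K, (forall j, repartition (e j)) &
    forall r, repartition r ->
      exists! c : 'rV[K]_g, exists f : ratfun K, forall Q,
        local_ring C Q (r Q - f - \sum_(j < g) cst (c 0 j) * e j Q).

End Curve.

Section PowerSeries.

(* A formal power series in x_1, x_2, ... is given by the coefficients of its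
   monomials; [a N m] is the coefficient of the monomial
   x_1^(m 0) ... x_N^(m (N - 1)).  A monomial occurs for every large enough N,
   always with the same coefficient in the series constructed below. *)
Definition fps (K : Type) := forall N : nat, 'X_{1..N} -> K.

Variable K : fieldType.

Definition fps_mul (a b : fps K) : fps K := fun N m =>
  \sum_(k : 'X_{1..N < (mdeg m).+1, (mdeg m).+1} | m == (k.1 + k.2)%MM)
    a N k.1 * b N k.2.

Definition fps_one : fps K := fun N m => (m == 0%MM)%:R.

Definition fps_exprn (a : fps K) (n : nat) : fps K := iter n (fps_mul a) fps_one.

(* c + sum_(i >= 1) b_i x_i *)
Definition fps_affine (c : K) (b : nat -> K) : fps K := fun N m =>
  (c%:MP_[N] + \sum_(i < N) b i.+1 *: 'X_i)@_m.

(* p(A x), where (A x)_j = sum_(i >= 0) A_(j, i) x_(i + 1) *)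
Definition fps_subst_linear (g : nat) (p : {mpoly K[g]})
    (A : 'I_g -> nat -> K) : fps K := fun N m =>
  (p \mPo [tuple \sum_(i < N) A j i *: 'X_i | j < g])@_m.

End PowerSeries.

Arguments fps_mul {K} a b N m.
Arguments fps_one {K} N m.
Arguments fps_exprn {K} a n N m.
Arguments fps_affine {K} c b N m.
Arguments fps_subst_linear {K g} p A N m.

Section Tau.
Variable K : fieldType.

(* A sequence f_1, f_2, ... of Laurent series in u is given by
   [f c] = f_(c + 1). *)
Variable f : nat -> int -> K.

(* xi_(i, c + 1), the coefficient of u^(i + 1) in f_(c + 1) *)
Definition frame_coef (i : int) (c : nat) : K := f c (i + 1).

Definition is_partition (lam : seq nat) : bool :=
  sorted geq lam && (0%N \notin lam).

Definition truncated_minor (lam : seq nat) (N : nat) : K :=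
  \det (\matrix_(r < N, c < N) frame_coef ((nth 0%N lam r)%:Z - r.+1%:Z) c).

Definition stable_value (s : nat -> K) : K :=
  xget 0 [set d | exists N0 : nat, forall N : nat, (N0 <= N)%N -> s N = d].

(* xi_lambda; the truncated minors are eventually constant if f is a frame, i.e.
   if the f_j are linearly independent and, for all large j, f_j = u^(1 - j)
   plus terms of higher degree. *)
Definition frame_minor (lam : seq nat) : K := stable_value (truncated_minor lam).

(* sigma_n in the variables x_1, ..., x_N, the others being set to 0: the
   coefficient of y^n in exp(sum_i x_i y^i).  The terms of the exponential
   series of exponent k > n do not contribute. *)
Definition sigma_poly (N n : nat) : {mpoly K[N]} :=
  (\sum_(k < n.+1) (k`!%:R^-1 : K)%:MP_[N]
     *: (\sum_(i < N) ('X_i : {mpoly K[N]}) *: 'X^(i.+1)) ^+ k)`_n.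

Definition sigma_int (N : nat) (n : int) : {mpoly K[N]} :=
  if n is Posz k then sigma_poly N k else 0.

Definition schur_weierstrass (N : nat) (lam : seq nat) : {mpoly K[N]} :=
  \det (\matrix_(i < size lam, j < size lam)
          sigma_int N ((nth 0%N lam i)%:Z + j%:Z - i%:Z)).

(* Each monomial occurs in finitely many Schur-Weierstrass polynomials. *)
Definition tau : fps K := fun N m =>
  \sum_(lam \in [set lam : seq nat | is_partition lam])
    frame_minor lam * (schur_weierstrass N lam)@_m.

End Tau.

Arguments tau {K} f N m.

Section DifferentialFrame.
Variables (K : fieldType) (g : nat) (omega : 'I_g -> ratfun K).

(* iota(f(u) du) = u^(2 - g) f(u) *)
Definition iota_diff (h : ratfun K) : int -> K :=
  laurent None (coord_u ^ (2 - g%:Z) * du_part h).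

(* omega_1, ..., omega_g followed by omega_(g + i) = u^(- i - 1) du
   = - v^(i - 1) dv for i >= 1; the term of index c is omega_(c + 1). *)
Definition extended_basis (c : nat) : ratfun K :=
  if insub c is Some j then omega j else - coord_v ^+ (c - g).

Definition differential_frame (c : nat) : int -> K :=
  iota_diff (extended_basis c).

(* omega_j = (sum_(i >= 0) a_(i, j) u^i) du *)
Definition expansion_matrix (j : 'I_g) (i : nat) : K :=
  laurent None (du_part (omega j)) i%:Z.

End DifferentialFrame.

Section ThetaFunction.
Variables (R : realType) (C : rational_curve R[i]) (g : nat).
Variable omega : 'I_g -> ratfun R[i].

Definition point_of_u (w : R[i]) : proj_line R[i] :=
  if w == 0 then None else Some w^-1.

Definition C1_path (gam : R -> R[i]) : Prop :=
  let x t := complex.Re (gam t) in let y t := complex.Im (gam t) in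
  [/\ forall t, derivable x t 1, forall t, derivable y t 1,
      continuous (derive1 x) & continuous (derive1 y)].

Definition velocity (gam : R -> R[i]) (t : R) : R[i] :=
  derive1 (fun t => complex.Re (gam t)) t
  +i* derive1 (fun t => complex.Im (gam t)) t.

(* gam is the u-coordinate of a path in the smooth locus from the point u = 0
   to Q.  Every such path is seen in this chart if v = 0 is singular. *)
Definition smooth_path (gam : R -> R[i]) (Q : proj_line R[i]) : Prop :=
  [/\ C1_path gam, gam 0 = 0, point_of_u (gam 1) = Q &
      forall t, 0 <= t <= 1 -> smooth C (point_of_u (gam t))].

Definition path_integral (gam : R -> R[i]) (h : ratfun R[i]) : R[i] :=
  let F t := value_at (point_of_u (gam t)) (du_part h) * velocity gam t in
  (\int[@lebesgue_measure R]_(t in `[0%R, 1%R]) complex.Re (F t))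
  +i* (\int[@lebesgue_measure R]_(t in `[0%R, 1%R]) complex.Im (F t)).

(* The image of the Abel map on (g - 1)-tuples of smooth points, with base
   point u = 0. *)
Definition abel_image : set ('I_g -> R[i]) :=
  [set z | exists (P : 'I_g.-1 -> proj_line R[i]) (gam : 'I_g.-1 -> R -> R[i]),
     (forall k, smooth_path (gam k) (P k)) /\
     forall j, z j = \sum_(k < g.-1) path_integral (gam k) (omega j)].

Definition zariski_closure (S : set ('I_g -> R[i])) : set ('I_g -> R[i]) :=
  [set z | forall p : {mpoly R[i][g]},
     (forall w, S w -> p.@[w] = 0) -> p.@[z] = 0].

Definition theta_divisor : set ('I_g -> R[i]) := zariski_closure abel_image.

Definition reduced_poly (p : {mpoly R[i][g]}) : Prop :=
  p != 0 /\ forall q r : {mpoly R[i][g]}, p = q ^+ 2 * r -> (msize q <= 1)%N.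

Definition theta_function (theta : {mpoly R[i][g]}) : Prop :=
  reduced_poly theta /\ [set z | theta.@[z] = 0] = theta_divisor.

End ThetaFunction.

Section Exponential.
Variable R : realType.

Definition cexp (z : R[i]) : R[i] :=
  (expR (complex.Re z) * cos (complex.Im z))
  +i* (expR (complex.Re z) * sin (complex.Im z)).

(* With c the constant term of a, the exponential of a is
   e^c * sum_k (a - c)^k / k!; the terms with k > mdeg m do not contribute to
   the coefficient of m. *)
Definition fps_exp (a : fps R[i]) : fps R[i] := fun N m =>
  let a' : fps R[i] := fun N m => if m == 0%MM then 0 else a N m in
  cexp (a N 0%MM) *
    \sum_(k < (mdeg m).+1) (k`!%:R)^-1 * fps_exprn a' k N m.

End Exponential.

Arguments fps_exp {R} a N m.

(* Main.v *)
(* The regular differentials are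
     [omega_c = - sum_x L_(c, x) (v - a_x)^(- k_x - 1) dv],
   where [x] runs over the pairs of a singular point [a_x] and an order [k_x];
   put [ell_c(p) = sum_x L_(c, x) p^(k_x)(a_x) / k_x!], which is minus the sum of
   the residues of [p omega_c] at the singular points.  By duality the kernel of
   [ell] is a ring, namely the polynomials lying in all the local rings, and
   [a_(i, c) = ell_c(v^(i + 1))].

   The Cauchy-Binet formula turns the Schur expansion of tau into
   [det ell_c(v^j E)] (for [c, j < g]) with [E = exp(sum_i x_i v^i)].  Let [h_c]
   be polynomials dual to [ell_c] and vanishing at the [a_x]; then
   [sum_i x_i v^i = y + sum_c (A x)_c h_c] with [ell(y) = 0].  An element [w] of
   [ker ell] acts on the span of the [ell_c], triangularly in the orders, so its
   determinant there is a product of values of [w] at some of the [a_x].  Hence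
   tau is [prod E(a_x)], over these points, times [Theta(A x)], where
   [Theta(z) = det ell_c(v^j exp(sum_c z_c h_c))]; the integers [c_k] count
   the points.

   It remains to see that [Theta] is the theta function up to a scalar.  The Abel
   map is [A_c(u) = - ell_c(log(1 - u v))], so translating [z] by [A(u)]
   multiplies [exp(sum_c z_c h_c)] by [1 - u v] up to an invertible element of
   [ker ell].  This makes [Theta] vanish at sums of [g - 1] points, and expresses a
   generic [z] as the sum of the points [q_i] given by the roots of a polynomial
   of degree [g] (Jacobi inversion).  If the zeros of [theta] are the closure of
   the sums of [g - 1] points, then [theta(z - A(u))] vanishes, as a function of
   [u], only at the [q_i], and with the same multiplicity [m] at each.  So
   [theta / Theta ^ m] is multiplied by a constant by every translation by
   [A(u)]; it is thus constant, and [m = 1] as [theta] is reduced. *)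

Require Import Defs.
From mathcomp Require Import all_boot all_order all_algebra all_fingroup fraction.
From mathcomp Require Import generic_quotient mpoly.
From mathcomp Require Import boolp.
From mathcomp Require Import ring lra zify.

Set Implicit Arguments.
Unset Strict Implicit.
Unset Printing Implicit Defensive.

Import Order.TTheory GRing.Theory Num.Theory.
Local Open Scope ring_scope.

(** * Triangular actions *)

Section TriangularAction.
Variable K : fieldType.

(** Each local ring contains all functions vanishing at its point to a fixed order [n], so
    everything is done on [n]-jets at the singular points. Logarithms and exponentials are
    truncated, and the constant terms log(1 - a u) of the logarithms are replaced by 0: the
    functionals do not see constants, and the locally constant factor 1 / (1 - a u) makes up for
    them.

    The ring of coefficients varies: the same determinant is taken at numbers, at indeterminates (to
    speak of generic points) and at linear forms in the x_i (for tau). Hence the set of sites in the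
    norm character is found over [K], before the ring is chosen. Identities of power series are
    proved modulo weight [D], one coefficient at a time.

    In the uniqueness of theta, the orders of u -> theta(z - A(u)) at the singular points may depend
    on z. They range over a finite set, so the product of the candidate identities vanishes
    identically, and one of its factors must.

    Only points so close to P_0 that the segment from P_0 is smooth are joined to it by a path; the
    other points follow by density. *)

Lemma col_to_scalar g (c : 'M[K]_(1 + g, 1)) : c != 0 ->
  exists P : 'M[K]_(1 + g), exists2 r : K, P \in unitmx /\ r != 0 &
    P *m c = col_mx r%:M 0.
Proof.
move=> c0; have rk : \rank c = 1%N.
  apply/eqP; rewrite eqn_leq rank_leq_col lt0n mxrank_eq0; exact: c0.
exists (invmx (col_ebase c)), (row_ebase c 0 0); first split.
- by rewrite unitmx_inv col_ebase_unit.
- by have := row_ebase_unit c; rewrite unitmxE det_mx11 unitfE.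
rewrite -{2}(mulmx_ebase c) -mulmxA mulKmx ?col_ebase_unit // rk.
apply/matrixP=> i j; rewrite !ord1 !mxE big_ord1 !mxE.
case: splitP => k /= ->; rewrite !mxE ?ord1 /=; first by rewrite mul1r mulr1n.
by rewrite mul0r.
Qed.

(** Induction on the number of columns: either the last column of [L] is zero and is dropped, or row
    operations reduce it to one pivot, and the matching diagonal entry of [T] splits off [\det B].
    The pivots are found over [K], so [I] depends on [L] alone and serves every ring, every [T] and
    every [B]. *)
Lemma det_triangular_action g d (L : 'M[K]_(g, d)) : row_free L ->
  exists I : {set 'I_d},
    forall (A : comNzRingType) (f : {rmorphism K -> A}) (T : 'M[A]_d) (B : 'M[A]_g),
      is_trig_mx T -> map_mx f L *m T = B *m map_mx f L ->
      \det B = \prod_(i in I) T i i.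
Proof.
elim: d g L => [|d IH] g L.
  rewrite /row_free => /eqP rk; have g0 : g = 0%N.
    by apply/eqP; rewrite -leqn0 -rk rank_leq_col.
  subst g; exists set0 => A f T B _ _.
  by rewrite big_set0 det_mx00.
rewrite -[d.+1]addn1 in L *; set c := rsubmx L.
have [c0|cn0] := eqVneq c 0.
  have LE : L = row_mx (lsubmx L) 0 by rewrite -c0 hsubmxK.
  rewrite LE => /row_freeP[R LR].
  have rf' : row_free (lsubmx L).
    apply/row_freeP; exists (usubmx R).
    by move: LR; rewrite -[R]vsubmxK mul_row_col mul0mx addr0 col_mxKu.
  have [I HI] := IH _ _ rf'.
  exists [set lshift 1 i | i in I] => A f T B Ttrig.
  rewrite -[T]submxK map_row_mx map_mx0 mul_row_block mul_mx_row !mul0mx mulmx0.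
  move=> /eq_row_mx[]; rewrite addr0 => E _.
  rewrite submxK big_imset /=; last by move=> x y _ _; apply: lshift_inj.
  rewrite (HI _ f (ulsubmx T) _ _ E); first by apply: eq_bigr => i _; rewrite !mxE.
  apply/is_trig_mxP => i j ij; rewrite !mxE.
  by move/is_trig_mxP: Ttrig => ->.
case: g L @c cn0 => [|g] L c cn0 /row_freeP[R LR].
  by case/eqP: cn0; apply/matrixP => -[].
have [P [r [Pu r0] Pc]] := @col_to_scalar g c cn0.
set L1 : 'M_(1 + g, d + 1) := P *m L.
set l := usubmx (lsubmx L1); set L' := dsubmx (lsubmx L1).
have L1E : L1 = block_mx l r%:M L' 0.
  rewrite -[L1]hsubmxK -[lsubmx L1]vsubmxK.
  have -> : rsubmx L1 = P *m c by rewrite /L1 -[L]hsubmxK mul_mx_row !row_mxKr.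
  by rewrite Pc block_mxEh.
have rf' : row_free L'.
  apply/row_freeP; pose R1 : 'M_(d + 1, 1 + g) := R *m invmx P.
  exists (ursubmx R1).
  have : L1 *m R1 = 1%:M by rewrite /L1 /R1 mulmxA -(mulmxA P) LR mulmx1 mulmxV.
  rewrite L1E -[R1]submxK mulmx_block -[1%:M]submxK => /eq_block_mx[_ _ _].
  rewrite mul0mx addr0 block_mxKur => ->.
  by apply/matrixP=> i j; rewrite !mxE (inj_eq (@rshift_inj 1 g)).
have [I HI] := IH _ _ rf'.
exists (rshift d ord0 |: [set lshift 1 i | i in I]) => A f T B Ttrig E.
pose Pf := map_mx f P; pose Qf := map_mx f (invmx P).
have QP : Qf *m Pf = 1%:M by rewrite -map_mxM mulVmx // map_mx1.
pose B' : 'M_(1 + g) := Pf *m B *m Qf.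
have E' : map_mx f L1 *m T = B' *m map_mx f L1.
  rewrite /B' /L1 map_mxM -!mulmxA (mulmxA Qf) QP mul1mx E.
  by [].
have -> : \det B = \det B'.
  by rewrite /B' !det_mulmx mulrC mulrA -det_mulmx QP det1 mul1r.
have Tur : ursubmx T = 0.
  apply/matrixP => i j; rewrite !mxE; move/is_trig_mxP: Ttrig => -> //=.
  by rewrite ltn_addr.
have rI : (f r^-1 * f r = 1) by rewrite -rmorphM mulVf // rmorph1.
set D := \det B'; set Pi := \prod_(i in _) _.
move: E'; rewrite L1E map_block_mx map_scalar_mx map_mx0 -[T]submxK -[B' in RHS]submxK.
rewrite Tur !mulmx_block !mulmx0 !mul0mx !addr0 ?add0r => /eq_block_mx[_ E2 E3 E4].
have B21 : dlsubmx B' = 0.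
  move: E4; rewrite mul_mx_scalar => /(congr1 (fun M => f r^-1 *: M)).
  by rewrite scaler0 scalerA rI scale1r => ->.
have B11 : ulsubmx B' = drsubmx T.
  move: E2; rewrite mul_scalar_mx mul_mx_scalar => /(congr1 (fun M => f r^-1 *: M)).
  by rewrite !scalerA rI !scale1r => ->.
rewrite /D /Pi -[B']submxK B21 det_ublock B11 det_mx11.
rewrite big_setU1 /=; last first.
  by apply/imsetP => -[i _ /eqP]; rewrite eq_sym eq_lrshift.
rewrite !mxE; congr (_ * _).
rewrite big_imset /=; last by move=> x y _ _; apply: lshift_inj.
rewrite (HI _ f (ulsubmx T) (drsubmx B')).
- by apply: eq_bigr => i _; rewrite !mxE.
- apply/is_trig_mxP => i j ij; rewrite !mxE.
  by move/is_trig_mxP: Ttrig => ->.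
by rewrite E3 B21 mul0mx add0r.
Qed.
End TriangularAction.

(** * Truncated exponentials *)

Section TruncatedExponential.
Variables (K : numFieldType) (A : comNzRingType) (f : {rmorphism K -> A}).

(** The factor [1/k!] is formed in [K] and sent to [A] by [f], so [A] needs no division of its
    own. *)
Definition texp_term (k : nat) (x : A) : A := f (k`!%:R^-1) * x ^+ k.
Definition texp (n : nat) (x : A) : A := \sum_(0 <= k < n) texp_term k x.

Lemma texp_term0 x : texp_term 0 x = 1.
Proof. by rewrite /texp_term invr1 rmorph1 mul1r. Qed.

Lemma texpS n x : texp n.+1 x = texp n x + texp_term n x.
Proof. by rewrite /texp big_nat_recr. Qed.

Lemma texp_at0 n : (0 < n)%N -> texp n 0 = 1.
Proof.
move=> n0; rewrite /texp big_ltn // texp_term0 big_nat big1 ?addr0 // => i /andP[i0 _].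
by rewrite /texp_term expr0n gtn_eqF // mulr0.
Qed.

Lemma texp_termD k x y :
  texp_term k (x + y) = \sum_(0 <= i < k.+1) texp_term i x * texp_term (k - i) y.
Proof.
rewrite /texp_term addrC exprDn mulr_sumr big_mkord; apply: eq_bigr => -[i /= ik] _.
have fact0 m : m`!%:R != 0 :> K by rewrite pnatr_eq0 -lt0n fact_gt0.
have E : k`!%:R^-1 * 'C(k, i)%:R = i`!%:R^-1 * (k - i)`!%:R^-1 :> K.
  have := bin_fact (ik : (i <= k)%N) => /(congr1 (fun m => m%:R : K)).
  rewrite !natrM => E; apply: (mulfI (fact0 k)); rewrite mulVKf // -E -invfM -mulrA.
  by rewrite mulfV ?mulr1 // mulf_neq0.
transitivity (f (k`!%:R^-1 * 'C(k, i)%:R) * (x ^+ i * y ^+ (k - i))).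
  by rewrite rmorphM rmorph_nat; ring.
by rewrite E rmorphM; ring.
Qed.

Lemma texpD_triangle n x y :
  texp n (x + y) = \sum_(0 <= i < n) texp_term i x * texp (n - i) y.
Proof.
elim: n => [|n IH]; first by rewrite /texp !big_geq.
rewrite texpS IH texp_termD big_nat_recr //= subnn.
rewrite [in RHS]big_nat_recr //= subSnn [texp 1 y]/texp big_nat1 addrA; congr (_ + _).
rewrite -big_split /=; apply: eq_big_nat => i /andP[_ i_n].
by rewrite -mulrDr subSn ?texpS // ltnW.
Qed.

(** In the product of the truncated series the terms with [i + j < n] make up [texp n (x + y)], and
    the others lie in [I]. As [I] serve the polynomials with zero jets at the sites and those of
    large weight. *)
Lemma texpD (I : A -> Prop) n x y :
    I 0 -> (forall a b, I a -> I b -> I (a + b)) -> (forall a b, I b -> I (a * b)) ->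
    (forall i j, (n <= i + j)%N -> I (x ^+ i * y ^+ j)) ->
  I (texp n x * texp n y - texp n (x + y)).
Proof.
move=> I0 ID IM Ixy; rewrite texpD_triangle [X in X * _]/texp mulr_suml -sumrB.
rewrite big_nat; elim/big_ind: _ => // i /andP[_ i_n].
have -> : texp n y = texp (n - i) y + \sum_(n - i <= j < n) texp_term j y.
  by rewrite /texp -big_cat_nat ?leq_subr.
rewrite -mulrBr addrC addKr mulr_sumr.
rewrite big_nat; elim/big_ind: _ => // j /andP[nij _].
rewrite /texp_term mulrACA; apply: IM; apply: Ixy.
by rewrite -leq_subLR.
Qed.

End TruncatedExponential.

Lemma rmorph_texp (K : numFieldType) (A B : comNzRingType) (f : {rmorphism K -> A})
    (f' : {rmorphism K -> B}) (h : {rmorphism A -> B}) n x :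
  (forall c, h (f c) = f' c) -> h (texp f n x) = texp f' n (h x).
Proof.
by move=> hf; rewrite rmorph_sum /=; apply: eq_bigr => i _; rewrite rmorphM hf rmorphXn.
Qed.

Section TruncatedLogarithm.
Variable K : numFieldType.
Implicit Type c : K.

(** The truncation of log(1 - cX); its term [k = 0] is a division by zero, hence 0. *)
Definition tlog c n : {poly K} := - \poly_(k < n) (c ^+ k / k%:R).

Lemma coef_tlog c n k : (tlog c n)`_k = if (k < n)%N then - (c ^+ k / k%:R) else 0.
Proof. by rewrite coefN coef_poly; case: ifP; rewrite ?oppr0. Qed.

Lemma deriv_texp n (l : {poly K}) :
  (texp (@polyC K) n.+1 l)^`() = l^`() * texp (@polyC K) n l.
Proof.
rewrite /texp raddf_sum /= mulr_sumr big_nat_recl //= texp_term0 derivC add0r.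
apply: eq_bigr => k _; rewrite /texp_term !mul_polyC derivZ deriv_exp /=.
rewrite -scalerMnr -[_ *+ k.+1]scaler_nat scalerA -scalerAr; congr (_ *: _).
by rewrite factS natrM invfM mulVKf // pnatr_eq0.
Qed.

(* [F = exp(log(1 - cX))] solves [(1 - cX) F' = - c F]. *)
Lemma texp_tlog c n k : (k < n)%N ->
  (texp (@polyC K) n (tlog c n))`_k = (1 - c *: 'X)`_k.
Proof.
case: n => // n; set l := tlog c n.+1; set F := texp _ _ _ => kn.
have l'c i : l^`()`_i = if (i < n)%N then - c ^+ i.+1 else 0.
  rewrite coef_deriv coef_tlog ltnS; case: ifP => _; last by rewrite mul0rn.
  by rewrite mulNrn -[_ *+ i.+1]mulr_natr divfK // pnatr_eq0.
have l'E : (1 - c *: 'X) * l^`() = - c%:P + (c ^+ n.+1) *: 'X^n.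
  apply/polyP => i; rewrite mulrBl mul1r -scalerAl coefB coefZ coefXM l'c coefD coefN coefC coefZ coefXn.
  case: i => [|i] /=.
    rewrite mulr0 subr0 eq_sym; case: (n) => [|m] /=.
      by rewrite expr1 mulr1 addNr.
    by rewrite mulr0 addr0 expr1.
  rewrite l'c oppr0 add0r; case: (ltngtP i.+1 n) => ni.
  - by rewrite mulrN opprK -exprS addNr mulr0.
  - by rewrite !mulr0 oppr0 addr0.
  - by rewrite mulrN opprK -exprS add0r mulr1 ni.
have lX : l = 'X * drop_poly 1 l.
  apply/polyP => -[|i]; rewrite coefXM /= ?coef_drop_poly ?addn1 //.
  by rewrite coef_tlog /= invr0 mulr0 oppr0.
have {lX} lX : exists r, l ^+ n = 'X^n * r.
  by exists (drop_poly 1 l ^+ n); rewrite -exprMn -lX.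
have [r lr] := lX.
have FE : exists r, (1 - c *: 'X) * F^`() = - c *: F + 'X^n * r.
  exists (c *: ((n`!%:R^-1) *: r) + c ^+ n.+1 *: texp (@polyC K) n l).
  rewrite deriv_texp mulrA l'E /F texpS /texp_term lr -!mul_polyC.
  rewrite !polyCN; ring.
have [q Fq] := FE.
(* The equation gives a recursion whose factor [i - 1] is -1 at [i = 0] and 0 at [i = 1]; so the
   coefficient of X is [- c] and the later ones vanish. *)
have Frec i : (i < n)%N -> F`_i.+1 = c * (i%:R - 1) / i.+1%:R * F`_i.
  move=> i_n; have := congr1 (fun p : {poly K} => p`_i) Fq.
  rewrite mulrBl mul1r -scalerAl coefB coefZ coefXM coef_deriv coefD coefZ coefXnM i_n addr0.
  have nz m : m.+1%:R != 0 :> K by rewrite pnatr_eq0.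
  move=> E; apply: (mulIf (nz i)); rewrite mulrAC divfK // mulr_natr.
  have {E} -> : F`_i.+1 *+ i.+1 = - c * F`_i + c * (if i == 0 then 0 else F^`()`_i.-1).
    by rewrite -E subrK.
  case: i i_n => [|i] _ /=; first by ring.
  by rewrite coef_deriv -mulr_natr -natr1; ring.
have F0 : F`_0 = 1.
  rewrite /F /texp coef_sum big_nat_recl // texp_term0 coef1 big1 ?addr0 // => i _.
  by rewrite /texp_term mul_polyC coefZ exprS coef0M coef_tlog /= invr0 mulr0 oppr0 mul0r mulr0.
rewrite coefB coef1 coefZ coefX.
case: k kn => [|k] kn; first by rewrite F0 /= mulr0 subr0.
elim: k kn => [|k IH] kn; rewrite Frec //.
  by rewrite F0 /= sub0r divr1 mulrN1 !mulr1 sub0r.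
rewrite IH ?(ltnW kn) // !eqSS; case: k {IH kn} => [|k] /=.
  by ring.
by ring.
Qed.
End TruncatedLogarithm.

(** * Polynomials in several variables *)

Section MpolyNonvanishing.
Variables (K : fieldType) (e : nat -> K).
Hypothesis e_inj : injective e.

Lemma poly_nonvanishing (p : {poly K}) : p != 0 -> exists j, p.[e j] != 0.
Proof.
move=> p0; have [/hasP[j _ pj]|/hasPn h] := boolP (has (fun j => p.[e j] != 0) (iota 0 (size p))).
  by exists j.
have : (size [seq e j | j <- iota 0 (size p)] < size p)%N.
  apply: max_poly_roots => //; last by rewrite map_inj_uniq ?iota_uniq.
  by apply/allP => x /mapP[j /h pj ->]; rewrite rootE; move: pj; rewrite negbK.
by rewrite size_map size_iota ltnn.
Qed.

Lemma meval_muni n (p : {mpoly K[n.+1]}) (v : 'I_n.+1 -> K) :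
  p.@[v] = (map_poly (meval (fun i => v (widen_ord (leqnSn n) i))) (muni p)).[v ord_max].
Proof.
rewrite muniE rmorph_sum /= horner_sum mevalE; apply: eq_bigr => m _.
rewrite map_polyZ /= mevalZ mevalX map_polyXn hornerZ hornerXn big_ord_recr /= mulrA.
congr (_ * _ * _); apply: eq_bigr => i _; rewrite mnmE; congr (v _ ^+ m _); exact/val_inj.
Qed.

Lemma muni_neq0 n (p : {mpoly K[n.+1]}) : p != 0 -> muni p != 0.
Proof.
move=> p0; have m0s : mlead p \in msupp p by rewrite mlead_supp.
move: (mlead p) m0s => m0 m0s.
pose r (m : 'X_{1..n.+1}) := [multinom m (widen_ord (leqnSn n) i) | i < n].
apply: contraTneq m0s => mp0; rewrite mcoeff_msupp negbK.
have := congr1 (fun q : {poly {mpoly K[n]}} => (q`_(m0 ord_max))@_(r m0)) mp0.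
rewrite coef0 mcoeff0 muniE coef_sum raddf_sum /=.
have [m0s|m0s] := boolP (m0 \in msupp p); last by rewrite mcoeff_eq0 m0s.
rewrite (bigD1_seq m0) ?msupp_uniq //= coefZ coefXn eqxx mulr1 mcoeffZ mcoeffX eqxx mulr1.
rewrite big1 ?addr0 => [/eqP //|m mm0].
rewrite coefZ coefXn; case: eqP => [E|_]; last by rewrite mulr0 mcoeff0.
rewrite mulr1 mcoeffZ mcoeffX; case: eqP => [E'|_]; last by rewrite mulr0.
case/eqP: mm0; apply/mnmP => i; have [lt_i|ge_i] := ltnP i n.
  have := congr1 (fun q : 'X_{1..n} => q (Ordinal lt_i)) E'; rewrite !mnmE.
  by have -> : widen_ord (leqnSn n) (Ordinal lt_i) = i by apply/val_inj.
have -> // : i = ord_max; apply/val_inj/eqP => /=.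
by rewrite eqn_leq ge_i -ltnS ltn_ord.
Qed.

(** All variables but the last are chosen so that the leading coefficient in the last one survives;
    then the last is chosen. *)
Lemma mpoly_nonvanishing n (p : {mpoly K[n]}) : p != 0 ->
  exists2 v : 'I_n -> K, (forall i, exists j, v i = e j) & p.@[v] != 0.
Proof.
elim: n p => [|n IH] p p0.
  exists (fun=> 0); first by case.
  by move: p0; rewrite [p]nvar0_mpolyC mevalC mpolyC_eq0.
have := muni_neq0 p0; set q := muni p => q0.
have [v ve vq] : exists2 v : 'I_n -> K, (forall i, exists j, v i = e j) & (lead_coef q).@[v] != 0.
  by apply: IH; rewrite lead_coef_eq0.
have : map_poly (meval v) q != 0.
  by apply: contraNneq vq => /(congr1 (fun r : {poly K} => r`_(size q).-1)); rewrite coef_map coef0 => ->.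
case/poly_nonvanishing => j qj.
exists (fun i => if unlift ord_max i is Some i' then v i' else e j) => [i|].
  by case: unliftP => [i' _|_]; [exact: ve|exists j].
rewrite meval_muni unlift_none -/q.
have -> // : map_poly (meval (fun i => if unlift ord_max (widen_ord (leqnSn n) i) is Some i' then v i' else e j)) q = map_poly (meval v) q.
apply: eq_map_poly => r; apply: meval_eq => i.
have -> : widen_ord (leqnSn n) i = lift ord_max i by apply/val_inj; rewrite /= /bump leqNgt ltn_ord.
by rewrite liftK.
Qed.

Lemma mpoly_eq0_on n (p : {mpoly K[n]}) :
  (forall v : 'I_n -> K, (forall i, exists j, v i = e j) -> p.@[v] = 0) -> p = 0.
Proof. by move=> h; apply/eqP/negPn/negP => /mpoly_nonvanishing[v /h -> ]; rewrite eqxx. Qed.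

End MpolyNonvanishing.

Lemma mpoly_eq0 (K : numFieldType) n (p : {mpoly K[n]}) :
  (forall v : 'I_n -> K, p.@[v] = 0) -> p = 0.
Proof.
move=> h; apply: (@mpoly_eq0_on K (fun j => j%:R)) => [i j /eqP|v _]; last exact: h.
by rewrite eqr_nat => /eqP.
Qed.

Section HomogenizedEvaluation.

(* [w ^ M * p(y / w)] *)
Definition mhom (K A : comNzRingType) (f : K -> A) n M (p : {mpoly K[n]}) (y : 'I_n -> A) (w : A) :=
  \sum_(m <- msupp p) f p@_m * \prod_i y i ^+ m i * w ^+ (M - mdeg m).

Lemma rmorph_mhom (K A B : comNzRingType) (f : K -> A) (f' : K -> B) (h : {rmorphism A -> B})
    n M (p : {mpoly K[n]}) (y : 'I_n -> A) (w : A) :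
  (forall c, h (f c) = f' c) -> h (mhom f M p y w) = mhom f' M p (h \o y) (h w).
Proof.
move=> hf; rewrite rmorph_sum; apply: eq_bigr => m _; rewrite !rmorphM hf rmorphXn.
by rewrite rmorph_prod; congr (_ * _ * _); apply: eq_bigr => i _; rewrite rmorphXn.
Qed.

Lemma eq_mhom (K A : comNzRingType) (f : K -> A) n M (p : {mpoly K[n]}) (y y' : 'I_n -> A) (w : A) :
  y =1 y' -> mhom f M p y w = mhom f M p y' w.
Proof.
by move=> yy; apply: eq_bigr => m _; congr (_ * _ * _); apply: eq_bigr => i _; rewrite yy.
Qed.

(** [msize p <= M.+1] says that the degree of [p] is at most [M], so the natural subtraction
    [M - mdeg m] loses nothing. *)
Lemma mhom_meval (K : fieldType) n M (p : {mpoly K[n]}) (z : 'I_n -> K) (w : K) :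
  (msize p <= M.+1)%N -> w != 0 ->
  mhom id M p (fun i => w * z i) w = w ^+ M * p.@[z].
Proof.
move=> pM w0; rewrite mevalE mulr_sumr; apply: eq_big_seq => m mp.
have mM : (mdeg m <= M)%N by rewrite -ltnS (leq_trans (msize_mdeg_lt mp)).
under [\prod_i (w * _) ^+ _]eq_bigr => i _ do rewrite exprMn.
rewrite big_split /= prodrXr -mdegE.
by rewrite -[in RHS](subnK mM) exprD; ring.
Qed.

End HomogenizedEvaluation.

(** * The Cauchy-Binet formula *)

Section CauchyBinet.
Variables (A : comNzRingType) (g n : nat).

Definition increasing (f : {ffun 'I_g -> 'I_n}) :=
  [forall i : 'I_g, forall j : 'I_g, (i < j)%N ==> (f i < f j)%N].

Lemma increasingP (f : {ffun 'I_g -> 'I_n}) : reflect (forall i j : 'I_g, (i < j)%N -> (f i < f j)%N) (increasing f).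
Proof.
by apply: (iffP forallP) => h i => [j|]; [move/forallP: (h i) => /(_ j)/implyP|
  apply/forallP => j; apply/implyP/h].
Qed.

Lemma increasing_inj f : increasing f -> injective f.
Proof.
move/increasingP => h i j E; case: (ltngtP i j) => [/h|/h|/val_inj //]; by rewrite E ltnn.
Qed.

Lemma increasing_leq (f : {ffun 'I_g -> 'I_n}) (i j : 'I_g) : increasing f -> (f i < f j)%N = (i < j)%N.
Proof.
move/increasingP => h; case: (ltngtP i j) => [/h //|/h/ltnW|/val_inj ->]; last by rewrite ltnn.
by rewrite leqNgt => /negbTE.
Qed.

(** An increasing self-map lies above the identity; this applies to [s] and to its inverse. *)
Lemma increasing_perm_id (s : 'S_g) : (forall i j : 'I_g, (s i < s j)%N = (i < j)%N) -> s = 1%g.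
Proof.
have ge (s' : 'S_g) : (forall i j : 'I_g, (s' i < s' j)%N = (i < j)%N) -> forall i : 'I_g, (i <= s' i)%N.
  move=> h [i]; elim: i => // i IH ig.
  by apply: leq_ltn_trans (IH (ltnW ig)) _; rewrite h.
move=> h; have h' i j : (s^-1%g i < s^-1%g j)%N = (i < j)%N by rewrite -h !permKV.
apply/permP => i; rewrite perm1; apply/val_inj/eqP; rewrite eqn_leq ge // andbT.
by have := ge _ h' (s i); rewrite permK.
Qed.

Definition precomp (p : {ffun 'I_g -> 'I_n} * 'S_g) : {ffun 'I_g -> 'I_n} :=
  [ffun i => p.1 (p.2 i)].

(** With the next lemma: an injective map is in exactly one way a permutation followed by an
    increasing map, which groups the sum over injective maps by their images. *)
Lemma precomp_inj : {in [pred p | increasing p.1] &, injective precomp}.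
Proof.
move=> [f s] [f' s'] /= i1 i2; rewrite !inE /= in i1 i2 => /ffunP E.
have E' i : f i = f' (s' (s^-1%g i)) by have := E (s^-1%g i); rewrite !ffunE /= permKV.
have s1 : (s^-1 * s' = 1)%g.
  by apply: increasing_perm_id => i j; rewrite !permM -(increasing_leq _ _ i2) -!E' increasing_leq.
have ss : s' = s by apply/esym/eqP; rewrite eq_mulVg1 s1.
by rewrite ss; congr (_, _); apply/ffunP => i; rewrite E' ss permKV.
Qed.

Lemma precomp_surj (f : {ffun 'I_g -> 'I_n}) : injective f ->
  exists2 p, increasing p.1 & precomp p = f.
Proof.
move=> fi; pose X := [set f i | i : 'I_g].
have cX : #|X| = g by rewrite card_imset // card_ord.
have fX i : f i \in X by apply: imset_f.
pose s0 i : 'I_g := cast_ord cX (enum_rank_in (fX i) (f i)).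
pose f0 : {ffun 'I_g -> 'I_n} := [ffun i => enum_val (cast_ord (esym cX) i)].
have f0s i : f0 (s0 i) = f i by rewrite ffunE /s0 cast_ordK enum_rankK_in.
have s0i : injective s0 by move=> i j E; apply: fi; rewrite -!f0s E.
exists (f0, perm s0i); last by apply/ffunP => i; rewrite ffunE /= permE f0s.
apply/increasingP => i j ij; rewrite !ffunE.
have x0 : 'I_n by exact: f i.
rewrite !(enum_val_nth x0) /=.
have srt : sorted ltn (map val (enum X)).
  rewrite -[enum _](eq_filter (mem_enum _)) -(eq_filter (mem_map val_inj _)) -filter_map.
  by rewrite (sorted_filter ltn_trans) // unlock val_ord_enum iota_ltn_sorted.
have := sorted_ltn_nth ltn_trans 0%N srt.
move=> h; have := h i j; rewrite !inE !size_map -cardE cX !ltn_ord => /(_ isT isT ij).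
by rewrite !(nth_map x0) // -cardE cX.
Qed.

Lemma det_mul_rowsub (L : 'M[A]_(g, n)) (R : 'M[A]_(n, g)) :
  \det (L *m R) = \sum_(f : {ffun 'I_g -> 'I_n}) (\prod_i L i (f i)) * \det (rowsub f R).
Proof.
rewrite /determinant.
under eq_bigr => s _.
  under [X in _ * X]eq_bigr => i _ do rewrite mxE.
  rewrite bigA_distr_bigA /= mulr_sumr.
  over.
rewrite exchange_big /=; apply: eq_bigr => f _; rewrite mulr_sumr; apply: eq_bigr => s _.
rewrite big_split /= mulrCA; congr (_ * (_ * _)); apply: eq_bigr => i _; rewrite mxE //.
Qed.

Theorem Cauchy_Binet (L : 'M[A]_(g, n)) (R : 'M[A]_(n, g)) :
  \det (L *m R) =
  \sum_(f : {ffun 'I_g -> 'I_n} | increasing f) \det (colsub f L) * \det (rowsub f R).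
Proof.
rewrite det_mul_rowsub (bigID (fun f : {ffun _} => injectiveb f)) /= [X in _ + X]big1 ?addr0; last first.
  move=> f; rewrite /injectiveb => /dinjectivePn[i _ [j /andP[ji _] fij]].
  rewrite (@determinant_alternate _ _ _ i j) ?mulr0 // 1?eq_sym // => k.
  by rewrite !mxE fij.
have -> : \sum_(f : {ffun 'I_g -> 'I_n} | injectiveb f) (\prod_i L i (f i)) * \det (rowsub f R)
        = \sum_(p : {ffun 'I_g -> 'I_n} * 'S_g | increasing p.1)
             (\prod_i L i (precomp p i)) * \det (rowsub (precomp p) R).
  rewrite -[RHS](big_imset (fun f : {ffun 'I_g -> 'I_n} => (\prod_i L i (f i)) * \det (rowsub f R)) precomp_inj).
  apply: eq_bigl => f; apply/injectiveP/imsetP => [/precomp_surj[p ip <-]|[p]].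
    by exists p.
  by rewrite inE => /increasing_inj fi -> i j; rewrite !ffunE => /fi/perm_inj.
transitivity (\sum_(f : {ffun 'I_g -> 'I_n} | increasing f) \sum_(s : 'S_g)
   (\prod_i L i (precomp (f, s) i)) * \det (rowsub (precomp (f, s)) R)).
  by rewrite pair_big_dep /=; apply: eq_big => [[f s]|[f s] _] //=; rewrite andbT.
apply: eq_bigr => f _; rewrite [\det (colsub f L)]/determinant mulr_suml.
apply: eq_bigr => s _.
have -> : rowsub (precomp (f, s)) R = row_perm s (rowsub f R).
  by apply/matrixP => i j; rewrite !mxE ffunE.
rewrite row_permE det_mulmx det_perm mulrA; congr (_ * _).
by rewrite mulrC; congr (_ * _); apply: eq_bigr => i _; rewrite mxE ffunE.
Qed.

End CauchyBinet.

(** * Taylor coefficients at the sites *)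

Section TaylorCoefficients.
Variable A : comNzRingType.
Implicit Types (a : A) (p q : {poly A}) (k : nat).

(** The coefficient of [(X - a)^k], that is [p^(k)(a) / k!], in a form that makes sense over any
    ring. *)
Definition tay a k p : A := (p \Po ('X + a%:P))`_k.

Lemma tayD a k p q : tay a k (p + q) = tay a k p + tay a k q.
Proof. by rewrite /tay comp_polyD coefD. Qed.

Lemma tayB a k p q : tay a k (p - q) = tay a k p - tay a k q.
Proof. by rewrite /tay comp_polyB coefB. Qed.

Lemma tayZ a k c p : tay a k (c *: p) = c * tay a k p.
Proof. by rewrite /tay comp_polyZ coefZ. Qed.

Lemma tay0 a k : tay a k 0 = 0.
Proof. by rewrite /tay comp_poly0 coef0. Qed.

Lemma tay_sum (J : Type) (r : seq J) (P : pred J) (F : J -> {poly A}) a k :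
  tay a k (\sum_(i <- r | P i) F i) = \sum_(i <- r | P i) tay a k (F i).
Proof. by apply: (big_morph (tay a k)) => [p q|]; rewrite ?tayD ?tay0. Qed.

Lemma tayM a k p q : tay a k (p * q) = \sum_(j < k.+1) tay a (k - j) p * tay a j q.
Proof. by rewrite /tay comp_polyM coefMr. Qed.

Lemma tay_at0 a p : tay a 0 p = p.[a].
Proof. by rewrite /tay -horner_coef0 horner_comp !hornerE. Qed.

Lemma tayC a k c : tay a k c%:P = if k == 0%N then c else 0.
Proof. by rewrite /tay comp_polyC coefC. Qed.

Lemma tayXn a k j : tay a k 'X^j = (a ^+ (j - k)) *+ 'C(j, k).
Proof.
rewrite /tay comp_Xn_poly addrC exprDn coef_sum.
have E i : (a%:P ^+ (j - i) * 'X^i *+ 'C(j, i))`_k = (a ^+ (j - i) *+ 'C(j, i)) *+ (k == i).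
  by rewrite coefMn -rmorphXn coefCM coefXn mulr_natr mulrnAC.
under eq_bigr => i _ do rewrite E.
have [kj|jk] := leqP k j.
  by rewrite (bigD1 (inord k)) //= inordK ?ltnS // eqxx big1 ?addr0 // => i;
     rewrite -val_eqE /= inordK ?ltnS // eq_sym => /negbTE ->.
rewrite bin_small // mulr0n big1 // => i _.
by rewrite gtn_eqF // (leq_ltn_trans _ jk) // -ltnS.
Qed.

Lemma vanish_factor a p : p.[a] = 0 -> exists r, p \Po ('X + a%:P) = 'X * r.
Proof.
move=> pa; exists (drop_poly 1 (p \Po ('X + a%:P))); apply/polyP => -[|i].
  by rewrite coefXM -[LHS]/(tay a 0 p) tay_at0 pa.
by rewrite coefXM /= coef_drop_poly addn1.
Qed.

Lemma tay_vanish a p q i j k r : p.[a] = 0 -> q.[a] = 0 -> (k < i + j)%N ->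
  tay a k (p ^+ i * q ^+ j * r) = 0.
Proof.
move=> /vanish_factor[p1 E1] /vanish_factor[q1 E2] kij.
rewrite /tay !comp_polyM !rmorphXn /= E1 E2 !exprMn.
have -> : 'X^i * p1 ^+ i * ('X^j * q1 ^+ j) * (r \Po ('X + a%:P)) =
  'X^(i + j) * (p1 ^+ i * q1 ^+ j * (r \Po ('X + a%:P))) by rewrite exprD; ring.
by rewrite coefXnM kij.
Qed.

End TaylorCoefficients.

Lemma tay_map (A B : comNzRingType) (f : {rmorphism A -> B}) a k (p : {poly A}) :
  tay (f a) k (map_poly f p) = f (tay a k p).
Proof.
rewrite /tay -coef_map map_comp_poly rmorphD /= map_polyX map_polyC //.
Qed.

(* [(site x, lev x)] runs over all pairs of a point and an order [< n]; the
   ordering of the indices makes multiplication by a polynomial triangular on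
   Taylor coefficients. *)
Record sites (K : fieldType) (d n : nat) := Sites {
  site :> 'I_d -> K;
  lev : 'I_d -> nat;
  lev_lt : forall x, (lev x < n)%N;
  site_inj : forall x y, site x = site y -> lev x = lev y -> x = y;
  site_lev : forall x k, (k < n)%N -> exists y, site y = site x /\ lev y = k;
  site_leq : forall x y, site x = site y -> (lev x <= lev y)%N -> (x <= y)%N
}.

(** * Jets at the sites and Hermite interpolation *)

Section SiteCoordinates.
Variables (K : numFieldType) (d n : nat) (S : sites K d n).

Section Ring.
Variables (A : comNzRingType) (f : {rmorphism K -> A}).
Implicit Types p q w : {poly A}.

Definition nu p : 'cV[A]_d := \col_x tay (f (S x)) (lev S x) p.

(** Multiplication by [w] on jets, in the coordinates of [nu]; the Leibniz rule couples only indices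
    of the same site. *)
Definition Tmx w : 'M[A]_d := \matrix_(x, y)
  if (S y == S x) && (lev S y <= lev S x)%N then tay (f (S x)) (lev S x - lev S y) w else 0.

Lemma nuD p q : nu (p + q) = nu p + nu q.
Proof. by apply/colP => x; rewrite !mxE tayD. Qed.
Lemma nuB p q : nu (p - q) = nu p - nu q.
Proof. by apply/colP => x; rewrite !mxE tayB. Qed.
Lemma nuZ c p : nu (c *: p) = c *: nu p.
Proof. by apply/colP => x; rewrite !mxE tayZ. Qed.
Lemma nu0 : nu 0 = 0.
Proof. by apply/colP => x; rewrite !mxE tay0. Qed.
Lemma nu_sum (J : Type) (r : seq J) (P : pred J) (F : J -> {poly A}) :
  nu (\sum_(i <- r | P i) F i) = \sum_(i <- r | P i) nu (F i).
Proof. by apply: (big_morph nu) => [p q|]; rewrite ?nuD ?nu0. Qed.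

Lemma TmxD p q : Tmx (p + q) = Tmx p + Tmx q.
Proof. by apply/matrixP => x y; rewrite !mxE tayD; case: ifP; rewrite ?addr0. Qed.
Lemma TmxZ c p : Tmx (c *: p) = c *: Tmx p.
Proof. by apply/matrixP => x y; rewrite !mxE tayZ; case: ifP; rewrite ?mulr0. Qed.
Lemma Tmx0 : Tmx 0 = 0.
Proof. by apply/matrixP => x y; rewrite !mxE tay0; case: ifP. Qed.
Lemma Tmx_sum (J : Type) (r : seq J) (P : pred J) (F : J -> {poly A}) :
  Tmx (\sum_(i <- r | P i) F i) = \sum_(i <- r | P i) Tmx (F i).
Proof. by apply: (big_morph Tmx) => [p q|]; rewrite ?TmxD ?Tmx0. Qed.

Lemma nuM w p : nu (w * p) = Tmx w *m nu p.
Proof.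
apply/colP => x; rewrite !mxE tayM.
rewrite [RHS](bigID (fun y => (S y == S x) && (lev S y <= lev S x)%N)) /=.
rewrite [X in _ + X]big1 ?addr0 => [|y /negbTE yx]; last by rewrite mxE yx mul0r.
(* At the site of [x], [site_lev] supplies an index for each order, so the sum over indices becomes
   the Leibniz sum over orders. *)
have ex (j : 'I_(lev S x).+1) : exists y, (S y == S x) && (lev S y == j).
  have jn : (j < n)%N by apply: leq_trans (ltn_ord j) (lev_lt S x).
  by have [y [Sy ly]] := site_lev S x jn; exists y; rewrite Sy ly !eqxx.
pose h j := xchoose (ex j).
have hP j : S (h j) = S x /\ lev S (h j) = j.
  by have /andP[/eqP ? /eqP ?] := xchooseP (ex j).
rewrite (reindex_onto h (fun y => inord (lev S y))) /=; last first.
  move=> y /andP[/eqP Sy ly]; have [Sh lh] := hP (inord (lev S y)).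
  by apply: (site_inj (s := S)); rewrite ?Sh ?Sy // lh inordK.
apply: eq_big => j.
  by have [-> ->] := hP j; rewrite eqxx inord_val eqxx andbT -ltnS ltn_ord.
by have [Sh lh] := hP j; rewrite !mxE Sh lh eqxx -ltnS ltn_ord.
Qed.

Lemma nu_mul0 w p : nu w = 0 -> nu (w * p) = 0.
Proof. by move=> w0; rewrite mulrC nuM w0 mulmx0. Qed.

Lemma nu_congr w p q : nu p = nu q -> nu (w * p) = nu (w * q).
Proof. by move=> pq; rewrite !nuM pq. Qed.

(** The nonzero entries of [Tmx w] are entries of [nu w], because the order [lev S x - lev S y] also
    has an index at that site. *)
Lemma Tmx_nu0 w : nu w = 0 -> Tmx w = 0.
Proof.
move=> w0; apply/matrixP => x y; rewrite !mxE; case: ifP => // /andP[_ _].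
have [|z [Sz zl]] := @site_lev _ _ _ S x (lev S x - lev S y).
  exact: leq_ltn_trans (leq_subr _ _) (lev_lt S x).
by rewrite -zl -Sz; move/colP/(_ z): w0; rewrite !mxE.
Qed.

Lemma Tmx_trig w : is_trig_mx (Tmx w).
Proof.
apply/is_trig_mxP => x y xy; rewrite mxE; case: ifP => // /andP[/eqP Sxy].
by move/(site_leq Sxy); rewrite leqNgt xy.
Qed.

Lemma Tmx_diag w x : Tmx w x x = w.[f (S x)].
Proof. by rewrite mxE eqxx leqnn subnn tay_at0. Qed.

Definition vanishing p := forall x, p.[f (S x)] = 0.

Lemma nu_vanish p q i j r : vanishing p -> vanishing q -> (n <= i + j)%N ->
  nu (p ^+ i * q ^+ j * r) = 0.
Proof.
move=> vp vq nij; apply/colP => x; rewrite !mxE; apply: tay_vanish => //.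
exact: leq_trans (lev_lt S x) nij.
Qed.

(** For [p] vanishing at the sites, the powers of exponent [n] or more have zero [n]-jet, so
    truncating at [n] loses nothing that [nu] can see. *)
Definition pexp p := texp (@polyC A \o f) n p.

Lemma pexpE p : pexp p = texp (@polyC A \o f) n p. Proof. by []. Qed.

Lemma nu_pexpD p q : vanishing p -> vanishing q -> nu (pexp (p + q)) = nu (pexp p * pexp q).
Proof.
move=> vp vq; apply/esym/eqP; rewrite -subr_eq0 -nuB; apply/eqP.
apply: (@texpD _ _ _ (fun r => nu r = 0)) => [|a b a0 b0|a b b0|i j ij].
- exact: nu0.
- by rewrite nuD a0 b0 addr0.
- by rewrite mulrC nu_mul0.
- by rewrite -[_ * _]mulr1 nu_vanish.
Qed.

End Ring.

Lemma nu_map (A B : comNzRingType) (f : {rmorphism K -> A}) (f' : {rmorphism K -> B})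
    (h : {rmorphism A -> B}) p : (forall c, h (f c) = f' c) ->
  nu f' (map_poly h p) = map_mx h (nu f p).
Proof. by move=> hf; apply/colP => x; rewrite !mxE -hf tay_map. Qed.

Lemma Tmx_map (A B : comNzRingType) (f : {rmorphism K -> A}) (f' : {rmorphism K -> B})
    (h : {rmorphism A -> B}) p : (forall c, h (f c) = f' c) ->
  Tmx f' (map_poly h p) = map_mx h (Tmx f p).
Proof.
move=> hf; apply/matrixP => x y; rewrite !mxE -hf tay_map; case: ifP => //.
by rewrite rmorph0.
Qed.

Lemma dvdp_prod_XsubC_exp (s : seq K) (p : {poly K}) : uniq s ->
  (forall a, a \in s -> ('X - a%:P) ^+ n %| p) ->
  \prod_(a <- s) ('X - a%:P) ^+ n %| p.
Proof.
elim: s => [|a s IH] /=; first by rewrite big_nil dvd1p.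
move=> /andP[as_ us] h; rewrite big_cons Gauss_dvdp; last first.
  apply: coprimep_expl; rewrite coprimep_sym coprimep_XsubC.
  rewrite /root horner_prod; rewrite prodf_seq_neq0; apply/allP => b bs.
  by rewrite /= horner_exp expf_neq0 // hornerXsubC subr_eq0; apply: contraNneq as_ => ->.
by rewrite h ?mem_head // IH // => b bs; apply: h; rewrite in_cons bs orbT.
Qed.

Lemma tay_dvdp (a : K) (p : {poly K}) :
  (forall k, (k < n)%N -> tay a k p = 0) -> ('X - a%:P) ^+ n %| p.
Proof.
move=> h; have -> : p = (p \Po ('X + a%:P)) \Po ('X - a%:P).
  by rewrite -comp_polyA comp_polyD comp_polyX comp_polyC subrK comp_polyXr.
have -> : p \Po ('X + a%:P) = 'X^n * drop_poly n (p \Po ('X + a%:P)).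
  rewrite -[LHS](poly_take_drop n) mulrC [X in X + _](_ : _ = 0) ?add0r //.
  by apply/polyP => i; rewrite coef_take_poly coef0; case: ifP => // /h.
by rewrite comp_polyM rmorphXn /= comp_polyX dvdp_mulr.
Qed.

(** Such a [p] is divisible by the product of the [(X - a)^n], whose degree is at least [d] since an
    index is determined by its site and its order. *)
Lemma nu_eq0_size (p : {poly K}) : (size p <= d)%N -> nu idfun p = 0 -> p = 0.
Proof.
move=> sp p0; pose s := undup [seq S x | x <- enum 'I_d].
have sS x : S x \in s by rewrite mem_undup map_f ?mem_enum.
have dvd : \prod_(a <- s) ('X - a%:P) ^+ n %| p.
  apply: dvdp_prod_XsubC_exp => [|a]; first exact: undup_uniq.
  rewrite mem_undup => /mapP[x _ ->]; apply: tay_dvdp => k kn.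
  by have [y [Sy <-]] := site_lev S x kn; move/colP/(_ y): p0; rewrite -Sy !mxE.
have ds : (d <= size s * n)%N.
  have ix x : (index (S x) s < size s)%N by rewrite index_mem.
  pose h x : 'I_(size s) * 'I_n := (Ordinal (ix x), Ordinal (lev_lt S x)).
  have : injective h.
    move=> x y [E1 E2]; apply: (site_inj (s := S)) => //.
    by rewrite -(nth_index 0 (sS x)) E1 nth_index.
  by move/leq_card; rewrite card_prod !card_ord.
apply/eqP; apply: contraTT sp => p0'; rewrite -ltnNge.
apply: leq_trans (dvdp_leq p0' dvd).
have -> : \prod_(a <- s) ('X - a%:P) ^+ n = \prod_(a <- flatten [seq nseq n a | a <- s]) ('X - a%:P).
  rewrite big_flatten /= big_map; apply: eq_bigr => a _.
  by rewrite big_nseq iter_mulr_1.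
rewrite size_prod_XsubC ltnS size_flatten /shape -map_comp.
rewrite (eq_map (_ : size \o _ =1 fun=> n)) => [|a] /=; last by rewrite size_nseq.
by rewrite sumnE big_map big_const_seq count_predT iter_addn_0 mulnC.
Qed.

Definition hermite_mx : 'M[K]_d := \matrix_(j, x) tay (S x) (lev S x) 'X^j.
(** Hermite interpolation: the polynomial of degree less than [d] with jet [c]. The linear system is
    invertible by [nu_eq0_size]. *)
Definition hermite (c : 'cV[K]_d) : {poly K} := rVpoly (c^T *m invmx hermite_mx).

Lemma nu_hermite (c : 'cV[K]_d) : nu idfun (hermite c) = c.
Proof.
have nuN (u : 'rV_d) : (nu idfun (rVpoly u))^T = u *m hermite_mx.
  apply/rowP => x; rewrite !mxE /rVpoly /= poly_def tay_sum.
  by apply: eq_bigr => j _; rewrite tayZ !mxE insubT //= => jd; congr (u _ _ * _); apply/val_inj.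
have Nfree : row_free hermite_mx.
  rewrite -kermx_eq0; apply/eqP/row_matrixP => i; rewrite row0.
  apply: (can_inj (@rVpolyK _ _)) => /=; rewrite linear0.
  apply: nu_eq0_size; first exact: size_poly.
  by apply: (can_inj (@trmxK _ _ _)); rewrite nuN trmx0 -row_mul mulmx_ker row0.
by apply: (can_inj (@trmxK _ _ _)); rewrite nuN mulmxKV // -row_free_unit.
Qed.

End SiteCoordinates.

(** * Frames of functionals and the theta determinant *)

(** What the proof retains of the curve: the matrix of the functionals [ell_c], the absence of
    residues ([fmx_lev0]) and the stability of the common kernel under products ([fmx_mul]). *)
Record frame (K : numFieldType) (g d n : nat) := Frame {
  fsites :> sites K d n;
  fmx : 'M[K]_(g, d);
  fmx_free : row_free fmx;
  fmx_lev0 : forall c x, lev fsites x = 0%N -> fmx c x = 0;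
  fmx_mul : forall p q : {poly K}, fmx *m nu fsites idfun p = 0 ->
    fmx *m nu fsites idfun q = 0 -> fmx *m nu fsites idfun (p * q) = 0
}.

Lemma col_mulmx (R : pzSemiRingType) m n p (M : 'M[R]_(m, n)) (N : 'M_(n, p)) j :
  col j (M *m N) = M *m col j N.
Proof. by apply/colP => i; rewrite !mxE; apply: eq_bigr => k _; rewrite mxE. Qed.

Section Functionals.
Variables (K : numFieldType) (g d n : nat) (F : frame K g d n).

Section Ring.
Variables (A : comNzRingType) (f : {rmorphism K -> A}).
Implicit Types p q w : {poly A}.

Definition ell p : 'cV[A]_g := map_mx f (fmx F) *m nu F f p.

Lemma ellE p : ell p = map_mx f (fmx F) *m nu F f p. Proof. by []. Qed.

Lemma ellD p q : ell (p + q) = ell p + ell q.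
Proof. by rewrite /ell nuD mulmxDr. Qed.
Lemma ellB p q : ell (p - q) = ell p - ell q.
Proof. by rewrite /ell nuB mulmxBr. Qed.
Lemma ellZ c p : ell (c *: p) = c *: ell p.
Proof. by rewrite /ell nuZ scalemxAr. Qed.
Lemma ell0 : ell 0 = 0.
Proof. by rewrite /ell nu0 mulmx0. Qed.
Lemma ell_sum (J : Type) (r : seq J) (P : pred J) (G : J -> {poly A}) :
  ell (\sum_(i <- r | P i) G i) = \sum_(i <- r | P i) ell (G i).
Proof. by apply: (big_morph ell) => [p q|]; rewrite ?ellD ?ell0. Qed.

Lemma ell_congr w p q : nu F f p = nu F f q -> ell (w * p) = ell (w * q).
Proof. by move=> pq; rewrite /ell (nu_congr w pq). Qed.

Lemma ell_lev0 p : (forall x, lev F x != 0%N -> nu F f p x 0 = 0) -> ell p = 0.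
Proof.
move=> h; apply/colP => c; rewrite !mxE big1 // => x _; rewrite mxE.
by have [/fmx_lev0->|/h->] := eqVneq (lev F x) 0%N; rewrite ?rmorph0 ?mul0r ?mulr0.
Qed.

Lemma ell_C c : ell c%:P = 0.
Proof. by apply: ell_lev0 => x; rewrite mxE tayC => /negbTE ->. Qed.

End Ring.

Lemma ell_map (A B : comNzRingType) (f : {rmorphism K -> A}) (f' : {rmorphism K -> B})
    (h : {rmorphism A -> B}) p : (forall c, h (f c) = f' c) ->
  ell f' (map_poly h p) = map_mx h (ell f p).
Proof.
move=> hf; rewrite /ell (nu_map _ _ hf) map_mxM; congr (_ *m _).
by apply/matrixP => i j; rewrite !mxE hf.
Qed.

Lemma ell_idE p : ell idfun p = fmx F *m nu F idfun p.
Proof. by rewrite /ell map_mx_id. Qed.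

Lemma ell_mul0 (p q : {poly K}) :
  ell idfun p = 0 -> ell idfun q = 0 -> ell idfun (p * q) = 0.
Proof. by rewrite !ell_idE; apply: fmx_mul. Qed.

(* The functionals annihilating [ker ell] are the combinations of the [ell_c],
   so an element of the subring [ker ell] acts on the latter. *)
Lemma ell_mul_action (w : {poly K}) : ell idfun w = 0 ->
  exists B : 'M[K]_g, fmx F *m Tmx F idfun w = B *m fmx F.
Proof.
move=> w0; suff : (fmx F *m Tmx F idfun w <= fmx F)%MS by case/submxP => B ->; exists B.
rewrite submxE; apply/eqP/matrixP => i j; rewrite [RHS]mxE.
have -> (M : 'M[K]_(g, d)) : M i j = (col j M) i 0 by rewrite mxE.
rewrite col_mulmx.
have c0 : fmx F *m nu F idfun (hermite F (col j (cokermx (fmx F)))) = 0.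
  by rewrite nu_hermite -col_mulmx mulmx_coker; apply/colP => k; rewrite !mxE.
by rewrite -(nu_hermite F (col j _)) -mulmxA -nuM fmx_mul ?mxE // -ell_idE.
Qed.

(** [fmx_mul] concerns polynomials over [K]; it passes to [A] because the jet of [w] is an
    [A]-combination of jets of kernel elements over [K]. The action of [w] comes from the triangular
    matrix [Tmx], so its determinant is a product of values at sites fixed in advance. *)
Theorem ell_norm : exists I : {set 'I_d},
  forall (A : comNzRingType) (f : {rmorphism K -> A}) (w : {poly A}), ell f w = 0 ->
    exists2 B : 'M[A]_g, forall p, ell f (w * p) = B *m ell f p
      & \det B = \prod_(x in I) w.[f (F x)].
Proof.
have [I HI] := det_triangular_action (fmx_free F); exists I => A f w w0.
have [R LR] := row_freeP (fmx_free F).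
(* [Pi] is the projection onto the kernel of [fmx F] along the range of [R]; its columns are the
   jets of polynomials [P i] in the kernel of [ell]. *)
pose Pi : 'M[K]_d := 1%:M - R *m fmx F.
have LPi : fmx F *m Pi = 0 by rewrite mulmxBr mulmx1 mulmxA LR mul1mx subrr.
pose P i := hermite F (col i Pi).
have ellP i : ell idfun (P i) = 0.
  by rewrite ell_idE nu_hermite -col_mulmx LPi; apply/colP => k; rewrite !mxE.
have exB i : exists B : 'M[K]_g, fmx F *m Tmx F idfun (P i) == B *m fmx F.
  by have [B ->] := ell_mul_action (ellP i); exists B.
pose B i := xchoose (exB i).
have BE i : fmx F *m Tmx F idfun (P i) = B i *m fmx F by apply/eqP/(xchooseP (exB i)).
pose x := nu F f w.
have xE : x = \sum_i x i 0 *: map_mx f (col i Pi).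
  have : map_mx f Pi *m x = x.
    by rewrite map_mxB map_mx1 map_mxM mulmxBl mul1mx -mulmxA [_ *m x]w0 mulmx0 subr0.
  move=> {1}<-; apply/colP => k; rewrite !mxE summxE; apply: eq_bigr => i _.
  by rewrite !mxE mulrC.
have wE : Tmx F f w = \sum_i x i 0 *: map_mx f (Tmx F idfun (P i)).
  have : nu F f (w - \sum_i x i 0 *: map_poly f (P i)) = 0.
    rewrite nuB nu_sum -/x {1}xE -sumrB big1 // => i _.
    by rewrite nuZ (@nu_map _ _ _ F _ _ idfun f f) // nu_hermite subrr.
  move/Tmx_nu0; rewrite -scaleN1r TmxD TmxZ scaleN1r Tmx_sum => /subr0_eq ->.
  by apply: eq_bigr => i _; rewrite TmxZ (@Tmx_map _ _ _ F _ _ idfun f f).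
pose BA := \sum_i x i 0 *: map_mx f (B i).
have TE : map_mx f (fmx F) *m Tmx F f w = BA *m map_mx f (fmx F).
  rewrite wE mulmx_sumr mulmx_suml; apply: eq_bigr => i _.
  by rewrite -scalemxAr -scalemxAl -!map_mxM BE.
exists BA => [p|]; first by rewrite /ell nuM !mulmxA TE.
rewrite (HI A f _ _ _ TE); last exact: Tmx_trig.
by apply: eq_bigr => i _; rewrite Tmx_diag.
Qed.

(** A column of a right inverse of [fmx F], with the entries of order 0 reset to 0. The functionals
    ignore these entries, and the polynomial then vanishes at the sites, so that its truncated
    exponential behaves well. *)
Definition dual c : {poly K} :=
  hermite F (\col_x if lev F x == 0%N then 0 else pinvmx (fmx F) x c).

Lemma ell_dual c : ell idfun (dual c) = delta_mx c 0.
Proof.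
rewrite ell_idE nu_hermite; apply/colP => e.
have := mulmxVp (fmx_free F) => /matrixP/(_ e c); rewrite !mxE eqxx andbT => <-.
apply: eq_bigr => x _; rewrite mxE; case: eqP => // /fmx_lev0 ->.
by rewrite !mul0r.
Qed.

Lemma hermite_horner (c : 'cV[K]_d) (G : K -> K) x :
  (forall y, lev F y = 0%N -> c y 0 = G (F y)) -> (hermite F c).[F x] = G (F x).
Proof.
move=> h; have [|y [Fy ly]] := @site_lev _ _ _ F x 0 _.
  exact: leq_ltn_trans (lev_lt F x).
rewrite -tay_at0 -Fy -(h y ly) -[in RHS](nu_hermite F c) mxE ly.
by [].
Qed.

Lemma dual_vanish c : vanishing F idfun (dual c).
Proof.
by move=> x; rewrite (@hermite_horner _ (fun=> 0)) // => y ly; rewrite mxE ly eqxx.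
Qed.

Section Theta.
Variables (A : comNzRingType) (f : {rmorphism K -> A}).

Definition zdual (z : 'I_g -> A) : {poly A} := \sum_c z c *: map_poly f (dual c).

Lemma zdualE z : zdual z = \sum_c z c *: map_poly f (dual c). Proof. by []. Qed.

Lemma zdual_vanish z : vanishing F f (zdual z).
Proof.
move=> x; rewrite horner_sum big1 // => c _.
by rewrite hornerZ horner_map (dual_vanish c x) rmorph0 mulr0.
Qed.

Lemma ell_zdual z c : ell f (zdual z) c 0 = z c.
Proof.
rewrite ell_sum summxE (bigD1 c) //= big1 ?addr0 => [|e ec];
  rewrite ellZ (@ell_map _ _ idfun f f) // ell_dual !mxE ?eqxx ?rmorph1 ?mulr1 //.
by rewrite eq_sym (negbTE ec) rmorph0 mulr0.
Qed.

Definition zexp z := pexp n f (zdual z).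

Lemma zexpE z : zexp z = pexp n f (zdual z). Proof. by []. Qed.

(** The order of the columns given by [rev_ord] is that of the Schur determinants with which it is
    compared. *)
Definition thetaR (z : 'I_g -> A) : A :=
  \det (\matrix_(c, j < g) ell f ('X^(rev_ord j) * zexp z) c 0).

End Theta.

Lemma zexp_map (A B : comNzRingType) (f : {rmorphism K -> A}) (f' : {rmorphism K -> B})
    (h : {rmorphism A -> B}) z : (forall c, h (f c) = f' c) ->
  map_poly h (zexp f z) = zexp f' (h \o z).
Proof.
move=> hf; rewrite /zexp /pexp (rmorph_texp (f' := @polyC B \o f')) => [|c] /=; last first.
  by rewrite map_polyC /= hf.
congr texp; rewrite rmorph_sum; apply: eq_bigr => c _ /=.
rewrite map_polyZ /= -map_poly_comp; congr (_ *: _).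
by apply: eq_map_poly => a /=; rewrite hf.
Qed.

Lemma eq_zexp (A : comNzRingType) (f : {rmorphism K -> A}) (z z' : 'I_g -> A) :
  z =1 z' -> zexp f z = zexp f z'.
Proof. by move=> zz; congr pexp; apply: eq_bigr => c _; rewrite zz. Qed.

Lemma eq_thetaR (A : comNzRingType) (f : {rmorphism K -> A}) (z z' : 'I_g -> A) :
  z =1 z' -> thetaR f z = thetaR f z'.
Proof. by move=> zz; rewrite /thetaR (eq_zexp _ zz). Qed.

Lemma thetaR_map (A B : comNzRingType) (f : {rmorphism K -> A}) (f' : {rmorphism K -> B})
    (h : {rmorphism A -> B}) z : (forall c, h (f c) = f' c) ->
  h (thetaR f z) = thetaR f' (h \o z).
Proof.
move=> hf; rewrite /thetaR -det_map_mx; congr (\det _); apply/matrixP => c j.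
rewrite [LHS]mxE [X in h X]mxE [RHS]mxE -(zexp_map _ hf).
have := congr1 (fun M : 'cV_g => M c 0) (ell_map ('X^(rev_ord j) * zexp f z) hf).
by rewrite [X in _ = X]mxE rmorphM /= map_polyXn => ->.
Qed.

Definition Theta : {mpoly K[g]} := thetaR (@mpolyC g K) (fun c => 'X_c).

Lemma Theta_meval z : Theta.@[z] = thetaR idfun z.
Proof.
rewrite /Theta (@thetaR_map _ _ _ idfun) => [|c]; last by rewrite /= mevalC.
by apply: eq_thetaR => c /=; rewrite mevalXU.
Qed.

Lemma Theta_comp N (lq : g.-tuple {mpoly K[N]}) :
  Theta \mPo lq = thetaR (@mpolyC N K) (tnth lq).
Proof.
rewrite /Theta (@thetaR_map _ _ _ (@mpolyC N K)) => [|c]; last by rewrite /= comp_mpolyC.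
by apply: eq_thetaR => c /=; rewrite comp_mpolyXU -tnth_nth.
Qed.

End Functionals.

(** * The Abel map *)

Lemma coef_texp_congr (K : numFieldType) n (p q : {poly K}) k :
  (forall i, (i < n)%N -> p`_i = q`_i) -> (k < n)%N ->
  (texp (@polyC K) n p)`_k = (texp (@polyC K) n q)`_k.
Proof.
move=> pq kn; apply/eqP; rewrite -subr_eq0 -coefB /texp -sumrB; apply/eqP.
have pqE : p - q = 'X^n * drop_poly n (p - q).
  rewrite -[LHS](poly_take_drop n) mulrC [X in X + _](_ : _ = 0) ?add0r //.
  by apply/polyP => i; rewrite coef_take_poly coef0 coefB; case: ifP => // /pq ->; rewrite subrr.
rewrite coef_sum big1 // => i _.
by rewrite /texp_term -mulrBr subrXX pqE mulrC -!mulrA coefXnM kn.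
Qed.

Section Abel.
Variables (K : numFieldType) (g d n : nat) (F : frame K g d n).
Implicit Types (u : K) (z : 'I_g -> K).

Local Notation pexp p := (pexp n (idfun : {rmorphism K -> K}) p).
Local Notation nu p := (nu F (idfun : {rmorphism K -> K}) p).
Local Notation ell p := (ell F (idfun : {rmorphism K -> K}) p).
Local Notation zexp z := (zexp F (idfun : {rmorphism K -> K}) z).
Local Notation zdual z := (zdual F (idfun : {rmorphism K -> K}) z).
Local Notation vanishing p := (vanishing F (idfun : {rmorphism K -> K}) p).
Local Notation theta z := (thetaR F (idfun : {rmorphism K -> K}) z).

(** These are the [u]-coordinates of the smooth points: the site [F x] has [u = 1 / F x]. *)
Definition good u := forall x, 1 - F x * u != 0.

(** Near [a = F x], with [X = v - a], one has [1 - u v = (1 - a u)(1 - c X)] where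
    [c = u / (1 - a u)]. The prescribed jet is that of log(1 - c X), that is, log(1 - u v) without
    its constant term; the entry of order 0 is a division by zero, hence 0. *)
Definition lam u : {poly K} :=
  hermite F (\col_x - ((u / (1 - F x * u)) ^+ lev F x / (lev F x)%:R)).
(** Locally constant at the sites, hence in the kernel of [ell]; it divides out the factor [1 - a u]
    whose logarithm [lam] leaves out. *)
Definition eps u : {poly K} :=
  hermite F (\col_x if lev F x == 0%N then (1 - F x * u)^-1 else 0).
Definition abel u c : K := - ell (lam u) c 0.

Lemma lam_vanish u : vanishing (lam u).
Proof.
move=> x; rewrite (@hermite_horner _ _ _ _ F _ (fun=> 0)) // => y ly.
by rewrite mxE ly invr0 mulr0 oppr0.
Qed.

Lemma ell_eps u : ell (eps u) = 0.
Proof. by apply: ell_lev0 => x /negbTE lx; rewrite nu_hermite mxE lx. Qed.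

Lemma eps_site u x : (eps u).[F x] = (1 - F x * u)^-1.
Proof.
by rewrite (@hermite_horner _ _ _ _ F _ (fun a => (1 - a * u)^-1)) // => y ly; rewrite mxE ly.
Qed.

Lemma nu_pexp_lam u : good u -> nu (pexp (lam u)) = nu ((1 - u *: 'X) * eps u).
Proof.
move=> gu; apply/colP => x; rewrite !mxE; set k := lev F x; set a := F x.
have kn : (k < n)%N := lev_lt F x; pose c := u / (1 - a * u).
have a0 : 1 - a * u != 0 := gu x.
transitivity ((texp (@polyC K) n (tlog c n))`_k).
  rewrite /tay pexpE (rmorph_texp (f' := @polyC K)) => [|b]; last by rewrite /= comp_polyC.
  apply: coef_texp_congr => // i i_n; rewrite coef_tlog i_n.
  have [y [Fy ly]] := site_lev F x i_n.
  have := nu_hermite F (\col_x - ((u / (1 - F x * u)) ^+ lev F x / (lev F x)%:R)).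
  by move/colP/(_ y); rewrite !mxE Fy ly.
rewrite texp_tlog // /tay comp_polyM.
have -> : (1 - u *: 'X) \Po ('X + a%:P) = (1 - a * u)%:P - u *: 'X :> {poly K}.
  rewrite comp_polyB comp_polyZ comp_polyX -[1 in LHS]/(1%:P) comp_polyC.
  by rewrite polyCB polyCM scalerDr -!mul_polyC; ring.
have epsc i : (i < n)%N -> (eps u \Po ('X + a%:P))`_i = if i == 0%N then (1 - a * u)^-1 else 0.
  move=> i_n; have [y [Fy ly]] := site_lev F x i_n.
  have := nu_hermite F (\col_x if lev F x == 0%N then (1 - F x * u)^-1 else 0).
  by move/colP/(_ y); rewrite !mxE Fy ly.
rewrite /= mulrBl !coefB coefCM -scalerAl !coefZ coefXM coef1 coefX.
rewrite epsc //; case: k kn => [|k] kn /=.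
  by rewrite divff // !mulr0.
rewrite epsc ?(ltnW kn) // mulr0 !sub0r eqSS; case: eqP => _; rewrite ?mulr0 //.
by rewrite mulr1.
Qed.

Lemma pexp0 : (0 < n)%N -> pexp 0 = 1.
Proof. exact: texp_at0. Qed.

Lemma ell_pexp y : ell y = 0 -> ell (pexp y) = 0.
Proof.
move=> y0; have yk k : ell (y ^+ k) = 0.
  elim: k => [|k IH]; first exact: ell_C.
  by rewrite exprS ell_mul0.
rewrite pexpE /texp ell_sum big1 // => k _.
by rewrite /texp_term /= mul_polyC ellZ yk scaler0.
Qed.

Lemma pexp_site y x : vanishing y -> (pexp y).[F x] = 1.
Proof.
move=> vy; have -> : (pexp y).[F x] = texp (idfun : {rmorphism K -> K}) n y.[F x].
  by apply: (rmorph_texp (h := horner_eval (F x))) => c /=; rewrite /horner_eval hornerC.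
by rewrite (vy x) texp_at0 // (leq_ltn_trans _ (lev_lt F x)).
Qed.

Lemma vanishingD p q : vanishing p -> vanishing q -> vanishing (p + q).
Proof. by move=> vp vq x; rewrite hornerD vp vq addr0. Qed.
Lemma vanishingN p : vanishing p -> vanishing (- p).
Proof. by move=> vp x; rewrite hornerN vp oppr0. Qed.

(* [M] is the action of an invertible element of [ker ell]. *)
Lemma abel_step : exists I : {set 'I_d}, forall u z, good u ->
  exists2 M : 'M[K]_g, forall p,
    ell (zexp (fun c => z c - abel u c) * p) = M *m ell ((1 - u *: 'X) * zexp z * p)
    & \det M = \prod_(x in I) (1 - F x * u)^-1.
Proof.
have [I HI] := ell_norm F; exists I => u z gu.
(* [z' - z = - abel u] is also the image of [lam u] under [ell]. So [y] lies in the kernel, and on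
   jets [exp(zdual z') = exp(y) exp(lam u) exp(zdual z)]. *)
pose z' := fun c : 'I_g => z c - abel u c; rewrite -/z'; pose y := zdual z' - zdual z - lam u.
have vz := zdual_vanish F (idfun : {rmorphism K -> K}).
have vy : vanishing y.
  by apply: vanishingD; [apply: vanishingD; [|apply: vanishingN]; exact: vz|apply: vanishingN; exact: lam_vanish].
have y0 : ell y = 0.
  apply/colP => c; rewrite /y !ellB.
  have E (M N P : 'cV[K]_g) : (M - N - P) c 0 = M c 0 - N c 0 - P c 0 by rewrite !mxE.
  by rewrite E !ell_zdual /z' /abel [RHS]mxE; ring.
have zE : nu (zexp z') = nu (pexp y * eps u * (1 - u *: 'X) * zexp z).
  have -> : zexp z' = pexp (y + (lam u + zdual z)).
    by congr (pexp _); rewrite /y; ring.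
  rewrite nu_pexpD //; last by apply: vanishingD; [exact: lam_vanish|exact: vz].
  rewrite -!mulrA; apply: nu_congr.
  rewrite nu_pexpD //; last exact: lam_vanish.
  by rewrite mulrC (nu_congr _ (nu_pexp_lam gu)); congr (nu _); rewrite zexpE; ring.
have [B1 E1 D1] := HI K _ _ (ell_pexp y0).
have [B2 E2 D2] := HI K _ _ (ell_eps u).
exists (B1 *m B2) => [p|].
  rewrite mulrC (ell_congr _ zE) mulrC -mulmxA -E2 -E1.
  by congr (ell _); ring.
rewrite det_mulmx D1 D2 big1 ?mul1r => [|x _]; last exact: pexp_site.
by apply: eq_bigr => x _; rewrite eps_site.
Qed.

Definition wcol z j : 'cV[K]_g := ell ('X^j * zexp z).

Lemma thetaE z : theta z = \det (\matrix_(c, j < g) wcol z (rev_ord j) c 0).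
Proof. by []. Qed.

Lemma ell_poly_zexp z (P : {poly K}) m : (size P <= m)%N ->
  ell (P * zexp z) = \sum_(j < m) P`_j *: wcol z j.
Proof.
move=> sP; have {1}-> : P = \sum_(j < m) P`_j *: 'X^j.
  rewrite -[LHS]coefK poly_def -!(big_mkord xpredT (fun j => P`_j *: 'X^j)).
  rewrite [RHS](big_cat_nat (leq0n _) sP) /=.
  rewrite [X in _ + X]big_nat [X in _ + X]big1 ?addr0 // => j /andP[Pj _].
  by rewrite nth_default ?scale0r.
rewrite mulr_suml ell_sum; apply: eq_bigr => j _.
by rewrite -scalerAl ellZ.
Qed.

(** Multiplication by [1 - u v] replaces the column of [v^j] by itself minus [u] times the column of
    [v^(j+1)]. The right-hand side is thus a polynomial in [u] of degree at most [g]. *)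
Lemma theta_shift : exists I : {set 'I_d}, forall u z, good u ->
  theta (fun c => z c - abel u c) * \prod_(x in I) (1 - F x * u) =
  \det (\matrix_(c, j < g) (wcol z (rev_ord j) c 0 - u * wcol z (rev_ord j).+1 c 0)).
Proof.
have [I HI] := abel_step; exists I => u z gu.
have [M ME MD] := HI u z gu; rewrite thetaE.
have -> : \matrix_(c, j < g) wcol (fun c => z c - abel u c) (rev_ord j) c 0 =
   M *m \matrix_(c, j < g) (wcol z (rev_ord j) c 0 - u * wcol z (rev_ord j).+1 c 0).
  apply/matrixP => c j; rewrite [LHS]mxE /wcol mulrC ME.
  have -> : (1 - u *: 'X) * zexp z * 'X^(rev_ord j) =
     'X^(rev_ord j) * zexp z - u *: ('X^((rev_ord j).+1) * zexp z).
    by rewrite exprS -!mul_polyC; ring.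
  rewrite ellB ellZ [LHS]mxE [RHS]mxE; apply: eq_bigr => e _.
  have E (a : K) (U V : 'cV[K]_g) : (U - a *: V) e 0 = U e 0 - a * V e 0 by rewrite !mxE.
  by rewrite E; congr (_ * _); rewrite [RHS]mxE.
rewrite det_mulmx MD mulrAC -big_split /= big1 ?mul1r // => x _.
by rewrite mulVf ?gu.
Qed.

(** Iterate [abel_step] down to the origin, where the exponential is 1. Under [ell], the exponential
    of a sum of Abel images acts as the inverse of the product of the [1 - u v], up to an invertible
    matrix. *)
Lemma abel_sum (us : seq K) : (0 < n)%N -> (forall u, u \in us -> good u) ->
  exists2 M : 'M[K]_g, \det M != 0 &
    forall p, ell (\prod_(u <- us) (1 - u *: 'X) * zexp (fun c => \sum_(u <- us) abel u c) * p)
     = M *m ell p.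
Proof.
move=> n0; have [I HI] := abel_step; elim: us => [|u us IH] gus.
  exists 1%:M => [|p]; first by rewrite det1 oner_neq0.
  rewrite big_nil mul1r mul1mx zexpE zdualE big1 => [|c _]; last by rewrite big_nil scale0r.
  by rewrite pexp0 // mul1r.
have gu : good u by apply: gus; rewrite mem_head.
have [|M M0 ME] := IH; first by move=> v vus; apply: gus; rewrite in_cons vus orbT.
have [N NE ND] := HI u (fun c => \sum_(v <- u :: us) abel v c) gu.
have N0 : \det N != 0 by rewrite ND; apply/prodf_neq0 => x _; rewrite invr_neq0.
have NU : N \in unitmx by rewrite unitmxE unitfE.
exists (invmx N *m M) => [|p].
  by rewrite det_mulmx mulf_neq0 // -unitfE -unitmxE unitmx_inv.
rewrite -mulmxA -ME big_cons; apply: (canRL (mulKmx NU)).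
rewrite [X in ell X](_ : _ = (1 - u *: 'X) * zexp (fun c => \sum_(v <- u :: us) abel v c) *
   (\prod_(j <- us) (1 - j *: 'X) * p)); last by ring.
rewrite -NE; congr (ell _).
rewrite (eq_zexp _ _ (_ : _ =1 (fun c => \sum_(v <- us) abel v c))); first by ring.
by move=> c; rewrite big_cons addrC addrA addNr add0r.
Qed.

Lemma size_prod_1subX (us : seq K) : (size (\prod_(u <- us) (1 - u *: 'X) : {poly K})%R <= (size us).+1)%N.
Proof.
elim: us => [|u us IH]; first by rewrite big_nil size_poly1.
rewrite big_cons (leq_trans (size_polyMleq _ _)) //.
have : (size (1 - u *: 'X : {poly K})%R <= 2)%N.
  rewrite (leq_trans (size_polyD _ _)) // geq_max size_poly1 size_polyN.
  by rewrite (leq_trans (size_scale_leq _ _)) ?size_polyX.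
by move=> s2; rewrite -subn1 leq_subLR (leq_trans (leq_add s2 IH)).
Qed.

Lemma prod_1subX_neq0 (us : seq K) : \prod_(u <- us) (1 - u *: 'X) != 0 :> {poly K}.
Proof.
apply/eqP => /(congr1 (horner^~ 0)); rewrite horner_prod horner0 big1 => [/eqP|u _].
  by rewrite oner_eq0.
by rewrite !hornerE ?mulr0 ?subr0.
Qed.

(** The coefficients of [P] are a linear relation between the columns of the determinant. *)
Lemma theta_eq0_kernel z (P : {poly K}) : P != 0 -> (size P <= g)%N ->
  ell (P * zexp z) = 0 -> theta z = 0.
Proof.
move=> P0 sP; rewrite (ell_poly_zexp z sP) thetaE => E; apply/eqP.
rewrite -det_tr; apply/det0P; exists (\row_(j < g) P`_(rev_ord j)).
  apply: contraNneq P0 => h; apply/eqP/polyP => j; rewrite coef0.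
  have [jg|gj] := ltnP j g; last by rewrite nth_default // (leq_trans sP).
  by move/rowP/(_ (rev_ord (Ordinal jg))): h; rewrite !mxE rev_ordK.
apply/rowP => c; rewrite !mxE; move/colP/(_ c): E; rewrite summxE mxE => E.
rewrite -[RHS]E [RHS](reindex_inj rev_ord_inj); apply: eq_bigr => j _.
by rewrite !mxE.
Qed.

Lemma frame_order_gt0 : (0 < g)%N -> (0 < n)%N.
Proof.
move=> g0; have d0 : (0 < d)%N.
  by apply: leq_trans g0 _; move: (fmx_free F); rewrite /row_free => /eqP <-; apply: rank_leq_col.
exact: leq_ltn_trans (leq0n _) (lev_lt F (Ordinal d0)).
Qed.

(** The product of the [1 - u v] has degree less than [g], and [abel_sum] at [p = 1] puts its
    multiple by the exponential in the kernel, as [ell] kills constants. *)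
Lemma theta_abel_sum (us : seq K) : (size us < g)%N -> (forall u, u \in us -> good u) ->
  theta (fun c => \sum_(u <- us) abel u c) = 0.
Proof.
move=> sus gus; have n0 : (0 < n)%N by apply: frame_order_gt0; apply: leq_ltn_trans sus.
have [M _ ME] := abel_sum n0 gus.
apply: (@theta_eq0_kernel _ (\prod_(u <- us) (1 - u *: 'X))).
- exact: prod_1subX_neq0.
- exact: leq_trans (size_prod_1subX us) sus.
by rewrite -[X in ell X]mulr1 ME -[1]/(1%:P) ell_C mulmx0.
Qed.

End Abel.

(** * Partial fractions and Jacobi inversion *)

Lemma poly_eq0_except (K : numFieldType) (p q : {poly K}) : p != 0 ->
  (forall a, p.[a] != 0 -> q.[a] = 0) -> q = 0.
Proof.
move=> p0 h; apply/eqP/negPn/negP => q0.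
have [||j] := @poly_nonvanishing K (fun j => j%:R) _ (p * q).
- by move=> i j /eqP; rewrite eqr_nat => /eqP.
- by rewrite mulf_neq0.
by rewrite hornerM mulf_eq0 negb_or => /andP[/h ->]; rewrite eqxx.
Qed.

Lemma poly_eq0_nat (K : numFieldType) (p : {poly K}) : (forall k : nat, p.[k%:R] = 0) -> p = 0.
Proof.
move=> h; apply/eqP/negPn/negP => p0.
have [|j] := @poly_nonvanishing K (fun j => j%:R) _ p p0; last by rewrite h eqxx.
by move=> i j /eqP; rewrite eqr_nat => /eqP.
Qed.

(** Vectors are added one at a time: while fewer than [g] are chosen, their cokernel has a nonzero
    column, a functional that some further [k t] does not annihilate. *)
Lemma spanning_tuple (K : fieldType) g (T : Type) (P : T -> Prop) (k : T -> 'cV[K]_g) :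
  (forall x : 'rV_g, (forall t, P t -> x *m k t = 0) -> x = 0) ->
  exists2 ts : 'I_g -> T, (forall i, P (ts i)) & \det (\matrix_(c, i) k (ts i) c 0) != 0.
Proof.
move=> h; suff [ts Pts rf] : exists2 ts : 'I_g -> T, (forall i, P (ts i)) &
    row_free (\matrix_(i < g, c < g) k (ts i) c 0).
  exists ts => //; rewrite -det_tr; move: rf; rewrite row_free_unit unitmxE unitfE.
  by congr (\det _ != 0); apply/matrixP => i j; rewrite !mxE.
suff H : forall m, (m <= g)%N -> exists2 ts : 'I_m -> T, (forall i, P (ts i)) &
    row_free (\matrix_(i < m, c < g) k (ts i) c 0) by exact: H.
elim=> [|m IH] mg.
  (* [T] may be empty, so the empty tuple is built by elimination on ['I_0]. *)
  by exists (fun i : 'I_0 => match i with Ordinal _ H => False_rect T (Bool.diff_false_true H) end);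
    [case|rewrite /row_free; apply/eqP/eqP; rewrite -leqn0 rank_leq_row].
have [ts Pts rf] := IH (ltnW mg).
set M := \matrix_(i, c) _ in rf.
have [t Pt tM] : exists2 t, P t & ~~ ((k t)^T <= M)%MS.
  apply: contrapT => /forall2NP hN.
  have C0 : cokermx M = 0.
    apply/matrixP => i j; rewrite [RHS]mxE.
    have : (col j (cokermx M))^T = 0.
      apply: h => t Pt; apply: (can_inj (@trmxK _ _ _)).
      rewrite trmx_mul trmxK trmx0 -col_mulmx.
      have [//|/negP/negPn] := hN t; rewrite submxE => /eqP ->.
      by apply/colP => e; rewrite !mxE.
    by move/rowP/(_ i); rewrite !mxE.
  have := mxrank_coker M; rewrite C0 mxrank0 (eqP rf) => /eqP.
  by rewrite eq_sym subn_eq0 leqNgt mg.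
exists (fun i => if unlift ord_max i is Some i' then ts i' else t) => [i|].
  by case: unliftP => [i' _|_].
have -> : \matrix_(i < m.+1, c < g) k (if unlift ord_max i is Some i' then ts i' else t) c 0 =
   castmx (addn1 m, erefl g) (col_mx M (k t)^T).
  apply/matrixP => i c; rewrite castmxE !mxE cast_ord_id /=.
  case: splitP => j /= ji; rewrite !mxE.
    have -> : i = lift ord_max j by apply/val_inj; rewrite /= ji /bump leqNgt ltn_ord.
    by rewrite liftK.
  have -> : i = ord_max by apply/val_inj; rewrite /= ji ord1 addn0.
  by rewrite unlift_none ord1.
rewrite row_free_castmx /row_free -addsmxE; apply/eqP.
have kt : ((k t)^T :&: M = 0)%MS.
  apply/eqP; rewrite -submx0; apply: contraNT tM => h0.
  have : \rank ((k t)^T :&: M) != 0%N by rewrite mxrank_eq0 -submx0.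
  move=> r0; have r1 : (\rank ((k t)^T) <= \rank ((k t)^T :&: M))%N.
    by rewrite (leq_trans (rank_leq_row _)) // lt0n.
  have := capmxSl ((k t)^T) M => s.
  have : ((k t)^T :&: M == (k t)^T)%MS.
    by rewrite -(geq_leqif (mxrank_leqif_eq s)).
  by case/andP => _ /submx_trans; apply; apply: capmxSr.
have tk0 : (k t)^T != 0 by apply: contraNneq tM => ->; apply: sub0mx.
have rkt : \rank (k t)^T = 1%N.
  by apply/eqP; rewrite eqn_leq rank_leq_row lt0n mxrank_eq0.
rewrite addsmxC mxrank_disjoint_sum // rkt (eqP rf) addnC addn1 //.
Qed.

Section PartialFractions.
Variables (K : numFieldType) (d n : nat) (S : sites K d n).

Definition site_seq : seq K := undup [seq S x | x <- enum 'I_d].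
Definition pole_poly : {poly K} := \prod_(a <- site_seq) ('X - a%:P) ^+ n.
Definition pole_cofactor x : {poly K} :=
  ('X - (S x)%:P) ^+ (n - (lev S x).+1) * \prod_(a <- site_seq | a != S x) ('X - a%:P) ^+ n.

Lemma mem_site_seq x : S x \in site_seq.
Proof. by rewrite mem_undup map_f ?mem_enum. Qed.

Lemma pole_cofactorE x : pole_poly = ('X - (S x)%:P) ^+ (lev S x).+1 * pole_cofactor x.
Proof.
rewrite /pole_cofactor mulrA -exprD subnKC ?lev_lt // /pole_poly.
by rewrite (bigD1_seq (S x)) ?mem_site_seq ?undup_uniq.
Qed.

Lemma pole_poly_monic : pole_poly \is monic.
Proof. by apply: monic_prod => a _; rewrite monic_exp ?monicXsubC. Qed.

Lemma pole_poly_horner a : (pole_poly.[a] != 0) -> forall x, a != S x.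
Proof.
rewrite horner_prod prodf_seq_neq0 => /allP h x; have := h _ (mem_site_seq x).
rewrite /= horner_exp hornerXsubC; apply: contraTneq => ->.
by rewrite negbK subrr expr0n gtn_eqF // (leq_ltn_trans _ (lev_lt S x)).
Qed.

Lemma tay_mul_exp (a : K) k m (p : {poly K}) :
  tay a k (('X - a%:P) ^+ m * p) = if (k < m)%N then 0 else tay a (k - m) p.
Proof.
rewrite /tay comp_polyM rmorphXn /= comp_polyB comp_polyX comp_polyC addrK.
exact: coefXnM.
Qed.

(** Descending induction on the order. In the Taylor coefficient of order [n - (lev S x).+1] at
    [S x], the terms from other sites or of lower order vanish, and those of higher order are
    already known to be 0. *)
Lemma partial_fractions_free (b : 'I_d -> K) :
  \sum_x b x *: pole_cofactor x = 0 -> forall x, b x = 0.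
Proof.
move=> h x; move: {2}(n - lev S x)%N (leqnn (n - lev S x)) => m.
elim: m x => [|m IH] x.
  by rewrite leqn0 subn_eq0 leqNgt lev_lt.
move=> xm; have := congr1 (tay (S x) (n - (lev S x).+1)) h.
rewrite tay0 tay_sum (bigD1 x) //= big1 ?addr0 => [|y yx].
  rewrite tayZ tay_mul_exp ltnn subnn tay_at0 => /eqP; rewrite mulf_eq0 => /orP[/eqP //|].
  rewrite horner_prod prodf_seq_eq0 => /hasP[a _ /andP[ax]].
  by rewrite horner_exp hornerXsubC expf_eq0 subr_eq0 eq_sym (negbTE ax) andbF.
rewrite tayZ; have [Syx|Syx] := eqVneq (S y) (S x); last first.
  rewrite /pole_cofactor.
  have -> : \prod_(a <- site_seq | a != S y) ('X - a%:P) ^+ n =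
     ('X - (S x)%:P) ^+ n * \prod_(a <- site_seq | (a != S y) && (a != S x)) ('X - a%:P) ^+ n.
    rewrite (big_rem _ (mem_site_seq x)) /= eq_sym Syx; congr (_ * _).
    rewrite (rem_filter _ (undup_uniq _)) big_filter_cond; apply: eq_bigl => a.
    by rewrite andbC.
  rewrite mulrCA tay_mul_exp ifT ?mulr0 //.
  by rewrite ltn_subrL /= (leq_ltn_trans _ (lev_lt S x)).
case: (ltngtP (lev S y) (lev S x)) => lxy.
- rewrite /pole_cofactor Syx tay_mul_exp ifT ?mulr0 //.
  by rewrite ltn_sub2l // (leq_ltn_trans _ (lev_lt S x)) .
- rewrite IH ?mul0r // -ltnS (leq_trans _ xm) // ltn_sub2l //.
  exact: lev_lt.
- by case/eqP: yx; apply: (site_inj (s := S)).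
Qed.

Lemma partial_fractions_free_eval (b : 'I_d -> K) :
  (forall p, p != 0 -> (forall x, p != S x) -> \sum_x b x / (p - S x) ^+ (lev S x).+1 = 0) ->
  forall x, b x = 0.
Proof.
move=> h; apply: partial_fractions_free.
apply: (@poly_eq0_except _ ('X * pole_poly)).
  by rewrite mulf_neq0 ?polyX_eq0 ?monic_neq0 ?pole_poly_monic.
move=> p; rewrite hornerM hornerX mulf_eq0 negb_or => /andP[p0 pp].
have pS := pole_poly_horner pp; rewrite -[RHS](mulr0 (pole_poly.[p])) -(h p p0 pS).
rewrite horner_sum mulr_sumr; apply: eq_bigr => x _.
rewrite (pole_cofactorE x) hornerZ [in RHS]hornerM [in RHS]horner_exp [in RHS]hornerXsubC.
have nz : (p - S x) ^+ (lev S x).+1 != 0 by rewrite expf_neq0 // subr_eq0.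
by rewrite [RHS]mulrC -[RHS]mulrA mulKf.
Qed.

End PartialFractions.

Section Inversion.
Variables (K : numFieldType) (g d n : nat) (F : frame K g d n).
Implicit Types (u : K) (z : 'I_g -> K).

Local Notation pexp p := (pexp n (idfun : {rmorphism K -> K}) p).
Local Notation nu p := (nu F (idfun : {rmorphism K -> K}) p).
Local Notation ell p := (ell F (idfun : {rmorphism K -> K}) p).
Local Notation zexp z := (zexp F (idfun : {rmorphism K -> K}) z).
Local Notation zdual z := (zdual F (idfun : {rmorphism K -> K}) z).
Local Notation theta z := (thetaR F (idfun : {rmorphism K -> K}) z).
Local Notation good := (good F).
Local Notation abel := (abel F).

(** The prescribed jet is that of [1 / (1 - u v)]. *)
Definition geom u : {poly K} :=
  hermite F (\col_x (u ^+ lev F x / (1 - F x * u) ^+ (lev F x).+1)).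

Lemma nu_geom u : good u -> nu ((1 - u *: 'X) * geom u) = nu 1.
Proof.
move=> gu; apply/colP => x; rewrite !mxE /tay comp_polyM.
set k := lev F x; set a := F x; have kn : (k < n)%N := lev_lt F x.
have a0 : 1 - a * u != 0 := gu x.
have -> : (1 - u *: 'X) \Po ('X + (idfun a)%:P) = (1 - a * u)%:P - u *: 'X :> {poly K}.
  rewrite comp_polyB comp_polyZ comp_polyX -[1 in LHS]/(1%:P) comp_polyC.
  by rewrite polyCB polyCM scalerDr -!mul_polyC; ring.
have gc i : (i < n)%N -> (geom u \Po ('X + (idfun a)%:P))`_i = u ^+ i / (1 - a * u) ^+ i.+1.
  move=> i_n; have [y [Fy ly]] := site_lev F x i_n.
  have := nu_hermite F (\col_x (u ^+ lev F x / (1 - F x * u) ^+ (lev F x).+1)).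
  by move/colP/(_ y); rewrite !mxE Fy ly.
rewrite mulrBl coefB coefCM -scalerAl coefZ coefXM gc // -[1 in RHS]/(1%:P) comp_polyC coefC.
case: k kn => [|k] kn /=.
  by rewrite expr0 expr1 mul1r divff // mulr0 subr0.
rewrite gc ?(ltnW kn) // exprS [(_ - _) ^+ k.+2]exprS.
have e0 : (1 - a * u) ^+ k.+1 != 0 by rewrite expf_neq0.
by move: ((1 - a * u) ^+ k.+1) e0 => e e0; apply/eqP; rewrite subr_eq0; apply/eqP; field; rewrite e0 a0.
Qed.

(** With [u = 1/p] the pairing becomes [p] times a sum of partial fractions [1 / (p - a)^(k+1)]
    whose coefficients are the entries of [x *m fmx F]. Partial fractions are independent, and
    [fmx F] is row free. *)
Lemma kappa_spans (x : 'rV_g) : (forall u, good u -> x *m ell (geom u) = 0) -> x = 0.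
Proof.
move=> h; have xF : x *m fmx F = 0.
  apply/rowP => y; rewrite [RHS]mxE.
  move: y; apply: (partial_fractions_free_eval (S := F)) => p p0 pS.
  have gp : good p^-1.
    move=> y; apply: contraNneq (pS y) => /eqP; rewrite subr_eq0 => /eqP E.
    by rewrite -[p]mul1r E mulfVK.
  have := h _ gp; rewrite ell_idE mulmxA nu_hermite => /matrixP/(_ 0 0).
  rewrite !mxE => E; apply: (mulfI p0); rewrite mulr0 -[RHS](mulr0 1) -[in RHS]E mul1r mulr_sumr.
  apply: eq_bigr => y _; rewrite !mxE.
  have py : p - F y != 0 by rewrite subr_eq0.
  have -> : 1 - F y / p = (p - F y) / p by rewrite mulrBl divff.
  rewrite mulrCA; congr (_ * _); rewrite expr_div_n exprVn invf_div mulrA; congr (_ / _).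
  by rewrite exprS mulrCA mulVf ?mulr1 ?expf_neq0.
by apply: (row_free_inj (fmx_free F)); rewrite xF mul0mx.
Qed.

Definition zsum (q : 'I_g -> K) : 'I_g -> K := fun c => \sum_i abel (q i) c.

Lemma zsumE q c : zsum q c = \sum_i abel (q i) c. Proof. by []. Qed.

(** The [q i] are chosen so that the vectors [ell(1 / (1 - q_i v))] form a basis. A row annihilating
    the columns of the determinant annihilates [ell(P exp(z))] for all [P] of degree less than [g];
    when [P] is the product of the [1 - q_k v] with [k != i], this is [M] applied to the [i]-th
    vector. *)
Lemma exists_theta_neq0 : exists2 q : 'I_g -> K, (forall i, good (q i)) & theta (zsum q) != 0.
Proof.
have [g0|g0] := posnP g.
  exists (fun=> 0) => [i|]; first by have := ltn_ord i; rewrite [X in (_ < X)%N]g0.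
  suff E m (M : 'M[K]_m) : m = 0%N -> \det M = 1 by rewrite /thetaR E // oner_neq0.
  by move=> m0; subst m; rewrite det_mx00.
have n0 := frame_order_gt0 F g0.
have [q gq dq] := spanning_tuple kappa_spans; exists q => //.
pose us := [seq q i | i <- enum 'I_g].
have zE : zsum q =1 fun c => \sum_(u <- us) abel u c.
  by move=> c; rewrite big_map big_enum.
have gus u : u \in us -> good u by case/mapP => i _ ->.
have [M M0 ME] := abel_sum n0 gus.
rewrite (eq_thetaR _ _ zE) thetaE; set z := (fun c => \sum_(u <- us) _) in ME *.
apply/negP => /det0P[x x0 xW]; case/eqP: x0.
have xw j : (j < g)%N -> x *m wcol F z j = 0.
  move=> jg; apply/matrixP => i0 j0; rewrite !ord1.
  move/rowP/(_ (rev_ord (Ordinal jg))): xW; rewrite !mxE => E; rewrite -[RHS]E.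
  by apply: eq_bigr => c _; rewrite [in RHS]mxE rev_ordK.
have xP (P : {poly K}) : (size P <= g)%N -> x *m ell (P * zexp z) = 0.
  move=> sP; rewrite (ell_poly_zexp F z sP) mulmx_sumr big1 // => j _.
  by rewrite -scalemxAr xw ?scaler0.
have MU : M \in unitmx by rewrite unitmxE unitfE.
have xM i : x *m M *m ell (geom (q i)) = 0.
  pose P : {poly K} := \prod_(k <- enum 'I_g | k != i) (1 - q k *: 'X).
  have PE : \prod_(u <- us) (1 - u *: 'X) = (1 - q i *: 'X) * P.
    by rewrite big_map (bigD1_seq i) ?mem_enum ?enum_uniq.
  have sP : (size P <= g)%N.
    have := size_prod_1subX [seq q k | k <- enum 'I_g & k != i].
    rewrite big_map big_filter => /leq_trans; apply; rewrite size_map size_filter.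
    have := count_predC (pred1 i) (enum 'I_g).
    by rewrite count_uniq_mem ?enum_uniq // mem_enum size_enum_ord add1n => E; apply: eq_leq E.
  rewrite -mulmxA -ME PE -[RHS](xP P sP); congr (_ *m _).
  rewrite -mulrA mulrC -!mulrA -[RHS](congr1 (fun p => ell p) (mulr1 _)).
  rewrite [X in ell X](_ : _ = (P * zexp z) * ((1 - q i *: 'X) * geom (q i))); last by ring.
  exact: ell_congr (nu_geom (gq i)).
apply: (can_inj (mulmxK MU)); rewrite mul0mx.
have : x *m M *m \matrix_(c, i) ell (geom (q i)) c 0 = 0.
  apply/rowP => i; rewrite [RHS]mxE.
  have E : (x *m M *m ell (geom (q i))) 0 0 = 0 by rewrite xM mxE.
  rewrite -[RHS]E [LHS]mxE [RHS]mxE; apply: eq_bigr => c _; congr (_ * _).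
  by rewrite [LHS]mxE.
have NU : \matrix_(c, i) ell (geom (q i)) c 0 \in unitmx by rewrite unitmxE unitfE.
by move=> E; rewrite -[LHS](mulmxK NU) E mul0mx.
Qed.

(* [ell (exp (k y)) = 0] for all natural [k], and this is polynomial in [k]
   with linear coefficient [ell y]. *)
Lemma ell_zexp_inj z : ell (zexp z) = 0 -> forall c, z c = 0.
Proof.
move=> h; pose y := zdual z.
have vy : vanishing F (idfun : {rmorphism K -> K}) y by apply: zdual_vanish.
suff y0 : ell y = 0 by move=> c; rewrite -(ell_zdual F (idfun : {rmorphism K -> K})) -/y y0 mxE.
(* If [n <= 1], only order 0 occurs and [ell] is zero; otherwise the linear term survives the
   truncation. *)
have [n1|n1] := leqP n 1.
  by apply: ell_lev0 => x; have := leq_trans (lev_lt F x) n1; rewrite ltnS leqn0 => ->.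
have n0 := ltnW n1.
have powE k : nu (pexp (k%:R *: y)) = nu ((pexp y) ^+ k).
  elim: k => [|k IH]; first by rewrite scale0r pexp0.
  rewrite -natr1 scalerDl scale1r nu_pexpD //; last first.
    by move=> x; rewrite hornerZ vy mulr0.
  by rewrite mulrC (nu_congr _ IH) exprS.
have ellk k : ell (pexp (k%:R *: y)) = 0.
  rewrite ellE powE -[_ *m _]/(ell (pexp y ^+ k)).
  elim: k => [|k IH]; first exact: ell_C.
  by rewrite exprS ell_mul0.
apply/colP => c; rewrite [RHS]mxE.
pose p : {poly K} := \poly_(i < n) (i`!%:R^-1 * ell (y ^+ i) c 0).
have p0 : p = 0.
  apply: (@poly_eq0_nat K) => k.
  have E : ell (pexp (k%:R *: y)) c 0 = 0 by rewrite ellk mxE.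
  rewrite horner_poly -[RHS]E pexpE /texp big_mkord ell_sum summxE; apply: eq_bigr => i _.
  rewrite /texp_term /= exprZn mul_polyC scalerA ellZ [RHS]mxE.
  by rewrite mulrAC.
have := congr1 (fun r : {poly K} => r`_1) p0.
by rewrite coef0 coef_poly n1 invr1 mul1r expr1.
Qed.

(** [abel_step] removes one factor [1 - u v] at a time, until [ell(exp(z)) = 0] remains, which
    forces [z = 0]. *)
Lemma jacobi_inversion (us : seq K) z : (forall u, u \in us -> good u) ->
  ell (\prod_(u <- us) (1 - u *: 'X) * zexp z) = 0 ->
  forall c, z c = \sum_(u <- us) abel u c.
Proof.
have [I HI] := abel_step F; elim: us z => [|u us IH] z gus h c.
  by rewrite big_nil; apply: ell_zexp_inj; rewrite big_nil mul1r in h.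
have [M ME _] := HI u z (gus _ (mem_head _ _)).
rewrite big_cons -(IH (fun c => z c - abel u c)); first by rewrite addrC subrK.
  by move=> v vus; apply: gus; rewrite in_cons vus orbT.
rewrite mulrC ME [X in ell X](_ : _ = \prod_(u <- u :: us) (1 - u *: 'X) * zexp z) ?h ?mulmx0 //.
by rewrite big_cons; ring.
Qed.

End Inversion.

Section KernelPolynomial.
Variables (K : numFieldType) (g d n : nat) (F : frame K g d n).

Section Ring.
Variables (A : comNzRingType) (f : {rmorphism K -> A}) (z : 'I_g -> A).

Definition ker_mx : 'M[A]_g := \matrix_(c, j < g) ell F f ('X^(rev_ord j) * zexp F f z) c 0.
Definition ker_vec : 'cV[A]_g := \adj ker_mx *m ell F f ('X^g * zexp F f z).

(* Cramer's rule: the polynomial [Q] of degree [g] with leading coefficient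
   [theta z] such that [ell (Q exp(z . dual)) = 0]. *)
Definition ker_poly : {poly A} :=
  thetaR F f z *: 'X^g - \sum_(j < g) ker_vec j 0 *: 'X^(rev_ord j).

Lemma ell_ker_poly : ell F f (ker_poly * zexp F f z) = 0.
Proof.
rewrite mulrBl ellB -scalerAl ellZ mulr_suml ell_sum.
have -> : \sum_(j < g) ell F f (ker_vec j 0 *: 'X^(rev_ord j) * zexp F f z) = ker_mx *m ker_vec.
  apply/colP => c; rewrite summxE [RHS]mxE; apply: eq_bigr => j _.
  by rewrite -scalerAl ellZ [LHS]mxE mulrC [X in _ = X * _]mxE.
by rewrite /ker_vec mulmxA mul_mx_adj mul_scalar_mx subrr.
Qed.

Lemma size_ker_poly : (size ker_poly <= g.+1)%N.
Proof.
rewrite (leq_trans (size_polyD _ _)) // geq_max size_polyN.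
rewrite (leq_trans (size_scale_leq _ _)) ?size_polyXn //=.
rewrite (leq_trans (size_sum _ _ _)) //; apply/bigmax_leqP => j _.
by rewrite (leq_trans (size_scale_leq _ _)) // size_polyXn ltnS leq_subr.
Qed.

Lemma coef_ker_poly : ker_poly`_g = thetaR F f z.
Proof.
rewrite coefB coefZ coefXn eqxx mulr1 coef_sum big1 ?subr0 // => j _.
by rewrite coefZ coefXn gtn_eqF ?mulr0 // (ltn_ord (rev_ord j)).
Qed.

End Ring.

Lemma ker_poly_map (A B : comNzRingType) (f : {rmorphism K -> A}) (f' : {rmorphism K -> B})
    (h : {rmorphism A -> B}) z : (forall c, h (f c) = f' c) ->
  map_poly h (ker_poly f z) = ker_poly f' (h \o z).
Proof.
move=> hf; have ellh k : map_mx h (ell F f ('X^k * zexp F f z)) = ell F f' ('X^k * zexp F f' (h \o z)).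
  by rewrite -(ell_map _ _ hf) rmorphM /= map_polyXn (zexp_map _ _ hf).
have mxh : map_mx h (ker_mx f z) = ker_mx f' (h \o z).
  by apply/matrixP => c j; rewrite [LHS]mxE [X in h X]mxE [RHS]mxE -ellh [RHS]mxE.
have vech : map_mx h (ker_vec f z) = ker_vec f' (h \o z).
  by rewrite /ker_vec map_mxM map_mx_adj mxh ellh.
rewrite rmorphB rmorph_sum /= map_polyZ map_polyXn (thetaR_map _ _ hf); congr (_ - _).
apply: eq_bigr => j _; rewrite map_polyZ /= map_polyXn -vech; congr (_ *: _).
by rewrite [RHS]mxE.
Qed.

End KernelPolynomial.

(** * Density of the sums of [g] Abel images *)

Section Density.
Variables (K : numClosedFieldType) (g d n : nat) (F : frame K g d n).
Hypothesis site0 : exists x, F x = 0.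

Local Notation idK := (idfun : {rmorphism K -> K}).

Lemma horner_ker_poly (a : K) (z : 'I_g -> K) :
  ((ker_poly F (@mpolyC g K) (fun c => 'X_c)).[a%:MP]).@[z] = (ker_poly F idK z).[a].
Proof.
have zE : meval z \o (fun c => 'X_c) = z by apply/funext => c /=; rewrite mevalXU.
rewrite -[in RHS]zE -(@ker_poly_map _ _ _ _ F _ _ (@mpolyC g K) idK (meval z)); last first.
  by move=> c; rewrite /= mevalC.
set Q := ker_poly _ _ _; rewrite -{2}[a](mevalC z) horner_map //.
Qed.

(** If [Theta] and all the [Qs x] are nonzero at [z], the kernel polynomial of [z] has [g] roots,
    none of them a site, and Jacobi inversion writes [z] as [zsum q] for the inverses [q] of the
    roots. So [f] times these polynomials vanishes identically. *)
Theorem abel_dense (f : {mpoly K[g]}) :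
  (forall q : 'I_g -> K, (forall i, good F (q i)) -> f.@[zsum F q] = 0) -> f = 0.
Proof.
move=> fq; have [q0 gq0 Tq0] := exists_theta_neq0 F.
pose us := [seq q0 i | i <- enum 'I_g].
have zE : zsum F q0 =1 fun c => \sum_(u <- us) abel F u c.
  by move=> c; rewrite big_map big_enum.
have gus u : u \in us -> good F u by case/mapP => i _ ->.
pose Qs x := (ker_poly F (@mpolyC g K) (fun c => 'X_c)).[(F x)%:MP].
have Qs0 x : Qs x != 0.
  have [g0|g0] := posnP g.
    apply/eqP => /(congr1 (meval (zsum F q0))); rewrite horner_ker_poly meval0.
    move/eqP; apply/negP; rewrite /ker_poly.
    have no_ord (V : nmodType) (G : 'I_g -> V) : \sum_(j < g) G j = 0.
      by apply: big1 => j; have := ltn_ord j; rewrite [X in (_ < X)%N]g0.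
    by rewrite no_ord subr0 [X in 'X^X]g0 expr0 alg_polyC hornerC.
  have n0 := frame_order_gt0 F g0.
  apply/eqP => /(congr1 (meval (zsum F q0))); rewrite horner_ker_poly meval0 => QF.
  have [M _ ME] := abel_sum n0 gus.
  pose P : {poly K} := \prod_(u <- us) (1 - u *: 'X).
  have eP : ell F idK (P * zexp F idK (zsum F q0)) = 0.
    by rewrite (eq_zexp _ _ zE) -[X in ell _ _ X]mulr1 ME -[1]/(1%:P) ell_C mulmx0.
  pose Q := ker_poly F idK (zsum F q0).
  (* This combination has degree less than [g] and gives an element of the kernel, so it is 0 where
     theta is not. Hence [P] is a multiple of [Q], yet [P] has no zero at a site. *)
  have E : P`_g *: Q - (thetaR F idK (zsum F q0)) *: P = 0.
    apply/eqP; apply: contraNT Tq0 => R0; apply/eqP.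
    apply: (theta_eq0_kernel R0); last first.
      by rewrite mulrBl ellB -!scalerAl !ellZ eP ell_ker_poly !scaler0 subrr.
    apply/leq_sizeP => j; rewrite leq_eqVlt => /predU1P[<-|gj].
      by rewrite coefB !coefZ coef_ker_poly mulrC subrr.
    have Qj : Q`_j = 0 by rewrite nth_default // (leq_trans (size_ker_poly _ _ _)).
    have Pj : P`_j = 0.
      by rewrite nth_default // (leq_trans (size_prod_1subX us)) // size_map size_enum_ord.
    by rewrite coefB !coefZ Qj Pj !mulr0 subrr.
  have := congr1 (horner^~ (F x)) E; rewrite hornerD hornerN !hornerZ QF mulr0 sub0r horner0.
  move/eqP; rewrite oppr_eq0 mulf_eq0 (negbTE Tq0) /= horner_prod prodf_seq_eq0.
  case/hasP => u /gus /(_ x) gu /=; rewrite !hornerE mulrC.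
  by rewrite (negbTE gu).
apply/eqP; apply: contraT => f0.
have T0 : Theta F != 0 by apply: contraNneq Tq0 => T0; rewrite -Theta_meval T0 meval0.
have : f * Theta F * \prod_x Qs x != 0.
  by rewrite !mulf_neq0 //; apply/prodf_neq0 => x _; apply: Qs0.
case/negP; apply/eqP/mpoly_eq0 => z; rewrite !mevalM rmorph_prod /=.
apply/eqP; rewrite !mulf_eq0 Theta_meval.
have [//|T0z] := eqVneq (thetaR F idK z) 0; first by rewrite orbT.
rewrite orbF; have [Q0|Q0] := eqVneq (\prod_x (Qs x).@[z]) 0; first by rewrite orbT.
rewrite orbF; pose Q := ker_poly F idK z.
have Qx x : Q.[F x] != 0 by move/prodf_neq0: Q0 => /(_ x isT); rewrite horner_ker_poly.
have [rs QE] := closed_field_poly_normal Q.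
have lQ : lead_coef Q = thetaR F idK z.
  have sQ : size Q = g.+1.
    apply/eqP; rewrite eqn_leq size_ker_poly ltnNge; apply: contra T0z => sQ.
    by rewrite -coef_ker_poly nth_default.
  by rewrite lead_coefE sQ coef_ker_poly.
have rs0 r x : r \in rs -> F x != r.
  move=> rrs; apply: contraNneq (Qx x) => ->.
  by rewrite QE -rootE rootZ ?lQ // root_prod_XsubC.
have srs : size rs = g.
  have := congr1 (size : {poly K} -> nat) QE; rewrite size_scale ?lQ // size_prod_XsubC => -[].
  move=> sQ; apply/eqP; rewrite -eqSS -sQ eqn_leq size_ker_poly ltnNge.
  by apply: contra T0z => sQ'; rewrite -coef_ker_poly nth_default.
(* Since 0 is a site, no root is 0 and the roots can be inverted. *)
have [x0 Fx0] := site0.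
have r0 r : r \in rs -> r != 0 by move=> /(rs0 r x0); rewrite Fx0 eq_sym.
pose vs := [seq r^-1 | r <- rs].
have gvs u : u \in vs -> good F u.
  case/mapP => r rrs -> x; rewrite subr_eq0 eq_sym -(inj_eq (mulIf (r0 r rrs))).
  by rewrite mul1r mulfVK ?r0 // rs0.
have QP : exists c, Q = c *: \prod_(u <- vs) (1 - u *: 'X) /\ c != 0.
  exists (thetaR F idK z * \prod_(r <- rs) - r); split; last first.
    rewrite mulf_neq0 // prodf_seq_neq0; apply/allP => r /r0 /=.
    by rewrite oppr_eq0.
  rewrite QE lQ -scalerA; congr (_ *: _); rewrite big_map.
  rewrite -mul_polyC rmorph_prod -big_split /=; apply: eq_big_seq => r /r0 rn0.
  rewrite -mul_polyC mulrBr mulr1 mulrA -polyCM mulNr mulfV // !polyCN.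
  by rewrite mulNr mul1r opprK addrC.
have [c [Qc c0]] := QP.
have ev : ell F idK (\prod_(u <- vs) (1 - u *: 'X) * zexp F idK z) = 0.
  apply/eqP; have := ell_ker_poly F idK z; rewrite -/Q Qc -scalerAl ellZ => /eqP.
  by rewrite scaler_eq0 (negbTE c0).
have zvs := jacobi_inversion gvs ev.
pose q i := nth 0 vs (nat_of_ord (i : 'I_g)).
have svs : size vs = g by rewrite size_map.
have gq i : good F (q i) by apply: gvs; rewrite mem_nth // svs.
rewrite -(fq q gq); apply/eqP; apply: meval_eq => e; rewrite zvs.
by rewrite (big_nth 0) svs big_mkord.
Qed.

End Density.

(** * Polynomials on sums of Abel images *)

Section UnitTranslation.
Variable K : numFieldType.
Implicit Types a b : {poly K}.

Lemma poly_nonzero_eventually b : b != 0 ->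
  exists k0, forall k, (k0 <= k)%N -> b.[k%:R] != 0.
Proof.
move: {2}(size b) (leqnn (size b)) => m; elim: m b => [|m IH] b.
  by rewrite leqn0 size_poly_eq0 => ->.
move=> sb b0; have [[j bj]|h] := pselect (exists j : nat, b.[j%:R] = 0); last first.
  by exists 0%N => k _; apply/eqP => bk; apply: h; exists k.
have /factor_theorem[c bc] : root b j%:R by rewrite rootE bj.
have c0 : c != 0 by apply: contraNneq b0 => c0; rewrite bc c0 mul0r.
have [||k0 hk0] := IH c => //.
  by move: sb; rewrite bc size_Mmonic ?monicXsubC // size_XsubC addn2.
exists (maxn k0 j.+1) => k; rewrite geq_max => /andP[k0k jk].
rewrite bc hornerM mulf_neq0 ?hk0 // hornerXsubC subr_eq0 eqr_nat.
by rewrite gtn_eqF.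
Qed.

(** A translation preserves leading coefficients, so [s = 1]. Then [a / b] is constant along the
    large integers, which determine it. *)
Lemma translation_quasi_invariant a b (s : K) : 
  (forall t, a.[t - 1] * b.[t] = s * (a.[t] * b.[t - 1])) ->
  forall t, a.[t] * b.[0] = a.[0] * b.[t].
Proof.
move=> h t; have [->|a0] := eqVneq a 0; first by rewrite !horner0 !mul0r.
have [->|b0] := eqVneq b 0; first by rewrite !horner0 !mulr0.
have lc (p : {poly K}) : lead_coef (p \Po ('X - 1%:P)) = lead_coef p.
  by rewrite lead_coef_comp ?size_XsubC // lead_coefXsubC expr1n mulr1.
have E : (a \Po ('X - 1%:P)) * b = s *: (a * (b \Po ('X - 1%:P))).
  apply/eqP; rewrite -subr_eq0; apply/eqP/poly_eq0_nat => k.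
  by rewrite hornerD hornerN hornerZ !hornerM !horner_comp hornerXsubC h subrr.
have s1 : s = 1.
  have L0 : lead_coef a * lead_coef b != 0 by rewrite mulf_neq0 ?lead_coef_eq0.
  by apply: (mulIf L0); have := congr1 lead_coef E; rewrite lead_coefZ !lead_coefM !lc mul1r.
have [k0 hk0] := poly_nonzero_eventually b0.
have hk k : a.[(k0 + k)%:R] * b.[k0%:R] = a.[k0%:R] * b.[(k0 + k)%:R].
  elim: k => [|k IH]; first by rewrite addn0.
  have := h (k0 + k.+1)%:R; rewrite s1 mul1r addnS -natr1 addrK natr1 => E'.
  apply: (mulIf (hk0 (k0 + k)%N (leq_addr _ _))).
  by rewrite mulrAC -E' mulrAC IH; ring.
have {}E : b.[k0%:R] *: a = a.[k0%:R] *: b.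
  apply/eqP; rewrite -subr_eq0; apply/eqP.
  apply/eqP/negPn/negP => r0.
  have [|k] := @poly_nonvanishing K (fun j => (k0 + j)%:R) _ _ r0.
    by move=> i j /eqP; rewrite eqr_nat eqn_add2l => /eqP.
  by rewrite !hornerE mulrC hk mulrC subrr eqxx.
have bk := hk0 k0 (leqnn _); apply: (mulfI bk).
have := congr1 (horner^~ t) E; have := congr1 (horner^~ 0) E; rewrite !hornerZ => E0 Et.
by rewrite mulrA Et [RHS]mulrA E0; ring.
Qed.

End UnitTranslation.

Section AbelPolynomials.
Variables (K : numFieldType) (g d n : nat) (F : frame K g d n).

(** A common denominator of the [abel u c] as rational functions of [u]; it is nonzero exactly at
    the good [u]. *)
Definition apole : {poly K} := \prod_x (1 - F x *: 'X) ^+ n.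
Definition anum c : {poly K} := \sum_x (fmx F c x / (lev F x)%:R) *:
  ('X ^+ lev F x * (1 - F x *: 'X) ^+ (n - lev F x) * \prod_(y | y != x) (1 - F y *: 'X) ^+ n).

Lemma apole0 : apole.[0] = 1.
Proof. by rewrite horner_prod big1 // => x _; rewrite horner_exp !hornerE ?mulr0 ?subr0 expr1n. Qed.

Lemma apole_neq0 u : (apole.[u] != 0) <-> good F u.
Proof.
rewrite horner_prod; split => [/prodf_neq0 h x|gu].
  have := h x isT; rewrite !hornerE expf_eq0 negb_and => /orP[|//].
  by rewrite -leqNgt leqNgt (leq_ltn_trans _ (lev_lt F x)).
by apply/prodf_neq0 => x _; rewrite !hornerE expf_neq0 // gu.
Qed.

Lemma anumE c u : good F u -> (anum c).[u] = apole.[u] * abel F u c.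
Proof.
move=> gu; rewrite /abel ell_idE nu_hermite mxE -sumrN mulr_sumr horner_sum.
apply: eq_bigr => x _; rewrite mxE -mulrN opprK hornerZ /apole [in RHS](bigD1 x) //=.
have nl : (lev F x + (n - lev F x))%N = n by rewrite subnKC // ltnW ?lev_lt.
have e0 : (1 - F x * u) ^+ lev F x != 0 by rewrite expf_neq0 // gu.
rewrite hornerM [in RHS]hornerM hornerM hornerXn !horner_exp.
have -> : (1 - F x *: 'X).[u] = 1 - F x * u :> K by rewrite !hornerE.
have -> : (1 - F x * u) ^+ n = (1 - F x * u) ^+ lev F x * (1 - F x * u) ^+ (n - lev F x).
  by rewrite -exprD nl.
rewrite expr_div_n.
move: ((1 - F x * u) ^+ lev F x) ((1 - F x * u) ^+ (n - _)) e0 => e1 e2 e0.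
move: (_.[u]) (u ^+ _) (fmx F c x) ((_%:R)^-1) => e3 e4 e5 e6.
have -> : e1 * e2 * e3 * (e5 * (e4 / e1 * e6)) = (e1 / e1) * (e2 * e3 * e5 * e4 * e6) by ring.
by rewrite divff // mul1r; ring.
Qed.

Lemma good0 : good F 0.
Proof. by move=> x; rewrite mulr0 subr0 oner_neq0. Qed.

Lemma abel0 c : abel F 0 c = 0.
Proof.
have := anumE c good0; rewrite apole0 mul1r => <-.
rewrite horner_sum big1 // => x _; rewrite hornerZ.
have [/(fmx_lev0 c)->|l0] := eqVneq (lev F x) 0%N; first by rewrite !mul0r.
by rewrite !hornerM hornerXn expr0n (negbTE l0) !mul0r mulr0.
Qed.

Section Ring.
Variables (A : comNzRingType) (f : {rmorphism K -> A}) (M : nat) (p : {mpoly K[g]}).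
Variables (U : 'I_g -> A) (V : A).

Definition pole_val := \prod_i (map_poly f apole).[U i] * (map_poly f apole).[V].

Definition num_val c :=
  (\sum_i (map_poly f (anum c)).[U i] * \prod_(k | k != i) (map_poly f apole).[U k])
    * (map_poly f apole).[V]
  - (map_poly f (anum c)).[V] * \prod_i (map_poly f apole).[U i].

(* [p] at the difference of the Abel images of the divisor [U] and the point
   [V], with denominators cleared. *)
Definition abel_pullback : A := mhom f M p num_val pole_val.

End Ring.

Lemma abel_pullback_map (A B : comNzRingType) (f : {rmorphism K -> A}) (f' : {rmorphism K -> B})
    (h : {rmorphism A -> B}) M p U V : (forall c, h (f c) = f' c) ->
  h (abel_pullback f M p U V) = abel_pullback f' M p (h \o U) (h V).
Proof.
move=> hf; rewrite /abel_pullback (rmorph_mhom _ _ _ _ hf).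
have E (q : {poly K}) (a : A) : h (map_poly f q).[a] = (map_poly f' q).[h a].
  by rewrite -horner_map -map_poly_comp; congr (_.[_]); apply: eq_map_poly => c /=; rewrite hf.
have -> : h (pole_val f U V) = pole_val f' (h \o U) (h V).
  by rewrite rmorphM rmorph_prod E; congr (_ * _); apply: eq_bigr => i _; rewrite E.
apply: eq_mhom => c; rewrite /= rmorphB !rmorphM rmorph_sum !E (rmorph_prod h).
congr (_ * _ - _ * _); last by apply: eq_bigr => i _; rewrite E.
apply: eq_bigr => i _; rewrite rmorphM (rmorph_prod h) E; congr (_ * _).
by apply: eq_bigr => k _; rewrite E.
Qed.

Lemma abel_pullbackE M p (q : 'I_g -> K) u : (msize p <= M.+1)%N ->
  (forall i, good F (q i)) -> good F u ->
  abel_pullback idfun M p q u =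
    (\prod_i apole.[q i] * apole.[u]) ^+ M * p.@[fun c => zsum F q c - abel F u c].
Proof.
move=> pM gq gu.
have pv : pole_val idfun q u = \prod_i apole.[q i] * apole.[u].
  by rewrite /pole_val !map_poly_id.
have w0 : pole_val idfun q u != 0.
  rewrite pv mulf_neq0 //; last exact/apole_neq0.
  by apply/prodf_neq0 => i _; apply/apole_neq0.
rewrite -pv -(mhom_meval _ pM w0); apply: eq_mhom => c.
rewrite /num_val !map_poly_id // pv mulrBr /zsum mulr_sumr mulr_suml; congr (_ - _).
  by apply: eq_bigr => i _; rewrite anumE // [in RHS](bigD1 i) //=; ring.
by rewrite anumE //; ring.
Qed.

End AbelPolynomials.

(** * Quotients that are quasi-invariant under Abel translations *)

Section ThetaFunctionUnique.
Variables (K : numClosedFieldType) (g d n : nat) (F : frame K g d n).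
Hypothesis site0 : exists x, F x = 0.
Hypothesis g_gt0 : (0 < g)%N.

Local Notation idK := (idfun : {rmorphism K -> K}).
Local Notation good := (good F).
Local Notation abel := (abel F).
Local Notation zsum := (zsum F).
Local Notation Theta := (Theta F).

Lemma mpoly_nonvanishing_good (p : {mpoly K[g]}) : p != 0 ->
  exists2 q : 'I_g -> K, (forall i, good (q i)) & p.@[q] != 0.
Proof.
move=> p0; pose w : {mpoly K[g]} := \prod_i (map_poly (@mpolyC g K) (apole F)).['X_i].
have wE q : w.@[q] = \prod_i (apole F).[q i].
  rewrite (rmorph_prod (meval q)); apply: eq_bigr => i _ /=.
  rewrite -horner_map /= mevalXU -map_poly_comp; congr (_.[_]).
  by rewrite map_poly_id // => c _ /=; rewrite mevalC.
have w0 : w != 0.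
  apply/eqP => /(congr1 (meval (fun=> 0))); rewrite wE meval0 big1 => [/eqP|i _].
    by rewrite oner_eq0.
  exact: apole0.
have [||v _] := @mpoly_nonvanishing K (fun j => j%:R) _ g (p * w).
- by move=> i j /eqP; rewrite eqr_nat => /eqP.
- by rewrite mulf_neq0.
rewrite mevalM mulf_eq0 negb_or wE => /andP[pv /prodf_neq0 wv].
by exists v => // i; apply/apole_neq0/wv.
Qed.

Lemma mpoly_eq0_good (p : {mpoly K[g]}) :
  (forall q : 'I_g -> K, (forall i, good (q i)) -> p.@[q] = 0) -> p = 0.
Proof. by move=> h; apply/eqP/negPn/negP => /mpoly_nonvanishing_good[q /h ->]; rewrite eqxx. Qed.

(** The pullback of [f] to the space of the [q], times [h], vanishes at all good [q]; so the
    pullback is 0 and [abel_dense] applies. *)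
Lemma abel_dense_generic (f h : {mpoly K[g]}) : h != 0 ->
  (forall q : 'I_g -> K, (forall i, good (q i)) -> h.@[q] != 0 -> f.@[zsum q] = 0) -> f = 0.
Proof.
move=> h0 fh; pose fb := abel_pullback F (@mpolyC g K) (msize f) f (fun i => 'X_i) 0.
have fbE q : (forall i, good (q i)) ->
    fb.@[q] = (\prod_i (apole F).[q i]) ^+ msize f * f.@[zsum q].
  move=> gq; rewrite /fb (@abel_pullback_map _ _ _ _ F _ _ _ idK (meval q)) => [|c]; last first.
    by rewrite /= mevalC.
  have -> : meval q \o (fun i => 'X_i) = q by apply/funext => i /=; rewrite mevalXU.
  rewrite rmorph0 abel_pullbackE //; last exact: good0.
  rewrite apole0 mulr1; congr (_ * _); apply: meval_eq => c.
  by rewrite abel0 subr0.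
have : fb * h == 0.
  apply/eqP/mpoly_eq0_good => q gq; rewrite mevalM fbE //.
  by have [->|/(fh q gq)->] := eqVneq h.@[q] 0; rewrite ?mulr0 ?mul0r.
rewrite mulf_eq0 (negbTE h0) orbF => /eqP fb0.
apply: (abel_dense (F := F) site0) => q gq.
have := fbE q gq; rewrite fb0 meval0 => /esym/eqP; rewrite mulf_eq0 => /orP[|/eqP //].
rewrite expf_eq0 => /andP[_ /eqP] P0; have : \prod_i (apole F).[q i] != 0.
  by apply/prodf_neq0 => i _; apply/apole_neq0.
by rewrite P0 eqxx.
Qed.

(** A linear form vanishing on all Abel images would vanish on their sums, hence everywhere by
    density. *)
Lemma abel_spans : exists2 q : 'I_g -> K, (forall i, good (q i)) &
  forall y : 'I_g -> K, exists t : 'I_g -> K, forall c, y c = \sum_i t i * abel (q i) c.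
Proof.
have [x h|q gq dq] := @spanning_tuple K g K good (fun u => \col_c abel u c).
  pose f : {mpoly K[g]} := \sum_c x 0 c *: 'X_c.
  have fE z : f.@[z] = \sum_c x 0 c * z c.
    by rewrite raddf_sum /=; apply: eq_bigr => c _; rewrite mevalZ mevalXU.
  have f0 : f = 0.
    apply: (abel_dense (F := F) site0) => q gq; rewrite fE.
    rewrite (eq_bigr (fun c => \sum_i x 0 c * abel (q i) c)) => [|c _]; last by rewrite mulr_sumr.
    rewrite exchange_big big1 //= => i _; have /matrixP/(_ 0 0) := h _ (gq i).
    by rewrite !mxE => E; rewrite -[RHS]E; apply: eq_bigr => c _; rewrite [in RHS]mxE.
  apply/rowP => c; have := fE (fun e => (e == c)%:R); rewrite f0 meval0 (bigD1 c) //= eqxx mulr1.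
  rewrite big1 ?addr0 => [<-|e /negbTE ec]; last by rewrite ec mulr0.
  by rewrite mxE.
exists q => // y; set M := \matrix_(c, i) _ in dq.
have MU : M \in unitmx by rewrite unitmxE unitfE.
pose t := invmx M *m \col_c y c; exists (fun i => t i 0) => c.
have : M *m t = \col_c y c by rewrite mulKVmx.
move/colP/(_ c); rewrite !mxE => <-; apply: eq_bigr => i _.
by rewrite !mxE mulrC.
Qed.

Definition mshift (p : {mpoly K[g]}) (y : 'I_g -> K) : {mpoly K[g]} :=
  p \mPo [tuple 'X_c - (y c)%:MP | c < g].

Lemma mshiftE p y z : (mshift p y).@[z] = p.@[fun c => z c - y c].
Proof.
rewrite comp_mpoly_meval; apply: meval_eq => c.
by rewrite tnth_mktuple mevalB mevalXU mevalC.
Qed.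

Lemma mshift_eq0 p y : mshift p y = 0 -> p = 0.
Proof.
move=> h; apply: mpoly_eq0 => v; have := mshiftE p y (fun c => v c + y c).
rewrite h meval0 => E; rewrite [RHS]E; apply: meval_eq => c.
by rewrite addrK.
Qed.

(** On a line in the direction [abel u], a unit step multiplies [a / b] by a constant, so [a / b] is
    constant there. These directions span the space. *)
Lemma abel_quasi_invariant (a b : {mpoly K[g]}) : a != 0 -> b != 0 ->
  (forall u, good u -> exists s, forall z, a.@[fun c => z c - abel u c] * b.@[z] =
     s * (a.@[z] * b.@[fun c => z c - abel u c])) ->
  exists2 c, c != 0 & a = c *: b.
Proof.
move=> a0 b0 h; pose Y (y : 'I_g -> K) := forall z,
  a.@[fun c => z c + y c] * b.@[z] = a.@[z] * b.@[fun c => z c + y c].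
pose line (p : {mpoly K[g]}) (z y : 'I_g -> K) : {poly K} :=
  mmap (@polyC K) (fun c => (z c)%:P + y c *: 'X) p.
have lineE p z y t : (line p z y).[t] = p.@[fun c => z c + t * y c].
  rewrite /line /mmap horner_sum mevalE; apply: eq_bigr => m _.
  rewrite hornerM hornerC horner_prod; congr (_ * _); apply: eq_bigr => c _.
  by rewrite horner_exp !hornerE mulrC.
have YA u t : good u -> Y (fun c => t * abel u c).
  move=> gu z; have [s hs] := h u gu.
  have := @translation_quasi_invariant K (line a z (abel u)) (line b z (abel u)) s.
  move=> /(_ _ t); rewrite !lineE.
  have z0 p : p.@[fun c => z c + 0 * abel u c] = p.@[z].
    by apply: meval_eq => c; rewrite mul0r addr0.
  rewrite !z0; apply => t'; rewrite !lineE.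
  have e1 p : p.@[fun c => z c + (t' - 1) * abel u c] =
     p.@[fun c => (z c + t' * abel u c) - abel u c].
    by apply: meval_eq => c; rewrite mulrBl mul1r addrA.
  by rewrite !e1 hs.
(* Combining the two invariances gives the claim times the translate of [b] by [y], a nonzero
   polynomial that can be cancelled. *)
have YD y y' : Y y -> Y y' -> Y (fun c => y c + y' c).
  move=> hy hy' z.
  pose N w : 'I_g -> K := fun c => - w c.
  have sE p w v : (mshift p (N w)).@[v] = p.@[fun c => v c + w c].
    by rewrite mshiftE; apply: meval_eq => c; rewrite /N opprK.
  pose f : {mpoly K[g]} := mshift a (N (fun c => y c + y' c)) * b - a * mshift b (N (fun c => y c + y' c)).
  have fb : f * mshift b (N y) = 0.
    apply: mpoly_eq0 => v; rewrite mevalM mevalB !mevalM !sE.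
    have E p : p.@[fun c => v c + (y c + y' c)] = p.@[fun c => (v c + y c) + y' c].
      by apply: meval_eq => c; rewrite addrA.
    have h1 := hy v; have h2 := hy' (fun c => v c + y c); rewrite !E.
    rewrite mulrBl mulrAC h2 [in X in _ - X]mulrAC -h1; ring.
  have : f = 0.
    apply/eqP; move/eqP: fb; rewrite mulf_eq0 => /orP[//|/eqP/mshift_eq0 b0'].
    by rewrite b0' eqxx in b0.
  move/(congr1 (meval z)); rewrite mevalB !mevalM !sE meval0 => /eqP.
  by rewrite subr_eq0 => /eqP.
have Yall y : Y y.
  have [q gq span] := abel_spans; have [t yE] := span y.
  have Ysum (r : seq 'I_g) : Y (fun c => \sum_(i <- r) t i * abel (q i) c).
    elim: r => [|i r IH].
      move=> z; have e p : p.@[fun c => z c + \sum_(i <- [::]) t i * abel (q i) c] = p.@[z].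
        by apply: meval_eq => c; rewrite big_nil addr0.
      by rewrite !e.
    have := YD _ _ (YA _ (t i) (gq i)) IH; rewrite /Y => hz z.
    have e p : p.@[fun c => z c + \sum_(j <- i :: r) t j * abel (q j) c] =
       p.@[fun c => z c + (t i * abel (q i) c + \sum_(j <- r) t j * abel (q j) c)].
      by apply: meval_eq => c; rewrite big_cons.
    by rewrite !e hz.
  move=> z; have e p : p.@[fun c => z c + y c] =
      p.@[fun c => z c + \sum_(i <- index_enum _) t i * abel (q i) c].
    by apply: meval_eq => c; rewrite yE.
  by rewrite !e Ysum.
have [z0 _ bz0] := mpoly_nonvanishing_good b0.
have E : a = (a.@[z0] / b.@[z0]) *: b.
  apply/eqP; rewrite -subr_eq0; apply/eqP/mpoly_eq0 => v.
  have := Yall (fun c => v c - z0 c) z0.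
  have e p : p.@[fun c => z0 c + (v c - z0 c)] = p.@[v].
    by apply: meval_eq => c; rewrite addrC subrK.
  rewrite !e mevalB mevalZ => E; apply/eqP; rewrite subr_eq0; apply/eqP.
  by apply: (mulIf bz0); rewrite E mulrAC mulfVK.
exists (a.@[z0] / b.@[z0]) => //.
by apply: contraNneq a0 => c0; rewrite E c0 scale0r.
Qed.

End ThetaFunctionUnique.

(** * Uniqueness of the theta function *)

Section ThetaDivisor.
Variables (K : numClosedFieldType) (g d n : nat) (F : frame K g d n).
Hypothesis site0 : exists x, F x = 0.
Hypothesis g_gt0 : (0 < g)%N.

Local Notation idK := (idfun : {rmorphism K -> K}).
Local Notation good := (good F).
Local Notation abel := (abel F).
Local Notation zsum := (zsum F).
Local Notation Theta := (Theta F).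
Local Notation theta z := (thetaR F idK z).

Definition shift_det z : {poly K} := \det (\matrix_(c, j < g)
  ((wcol F z (rev_ord j) c 0)%:P - wcol F z (rev_ord j).+1 c 0 *: 'X)).

Lemma horner_shift_det z u : (shift_det z).[u] =
  \det (\matrix_(c, j < g) (wcol F z (rev_ord j) c 0 - u * wcol F z (rev_ord j).+1 c 0)).
Proof.
rewrite -[LHS]/(horner_eval u _) -det_map_mx; congr (\det _); apply/matrixP => c j.
rewrite [LHS]mxE [RHS]mxE /= /horner_eval [X in X.[_]]mxE.
by rewrite hornerD hornerN hornerC hornerZ hornerX mulrC.
Qed.

Lemma size_shift_det z : (size (shift_det z) <= g.+1)%N.
Proof.
rewrite /shift_det /determinant (leq_trans (size_sum _ _ _)) //; apply/bigmax_leqP => s _.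
rewrite -signr_odd mulr_sign; set P := \prod_i _.
have sP : (size P <= g.+1)%N.
  rewrite (leq_trans (size_poly_prod_leq _ _)) //.
  have s2 i : (size ((\matrix_(c, j < g)
     ((wcol F z (rev_ord j) c 0)%:P - wcol F z (rev_ord j).+1 c 0 *: 'X)) i (s i) : {poly K})%R <= 2)%N.
    rewrite mxE (leq_trans (size_polyD _ _)) // geq_max size_polyN.
    rewrite (leq_trans (size_polyC_leq1 _)) //.
    by rewrite (leq_trans (size_scale_leq _ _)) ?size_polyX.
  rewrite leq_subLR addnS ltnS (leq_trans (leq_sum _ (fun i _ => s2 i))) //.
  by rewrite sum_nat_const card_ord muln2 addnn.
by case: (odd _); rewrite ?size_polyN.
Qed.

Lemma zsum_sub_abel q i : zsum q =1
  fun c => abel (q i) c + \sum_(u <- [seq q k | k <- enum 'I_g & k != i]) abel u c.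
Proof.
move=> c; rewrite zsumE (bigD1 i) //= big_map big_filter; congr (_ + _).
by rewrite big_enum_cond.
Qed.

Lemma size_other (q : 'I_g -> K) i : size [seq q k | k <- enum 'I_g & k != i] = g.-1.
Proof.
rewrite size_map size_filter; have := count_predC (pred1 i) (enum 'I_g).
by rewrite count_uniq_mem ?enum_uniq // mem_enum size_enum_ord add1n => E; exact: (congr1 predn E).
Qed.

(** By [theta_shift] both sides are polynomials in [u] of degree at most [g]. They agree at [u = 0],
    and both vanish at each [q i], where the argument of theta is a sum of [g - 1] Abel images. *)
Lemma pencil : exists I : {set 'I_d}, forall q : 'I_g -> K,
  (forall i, good (q i)) -> (forall i, q i != 0) -> injective q ->
  forall u, good u ->
  theta (fun c => zsum q c - abel u c) * \prod_(x in I) (1 - F x * u) =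
  theta (zsum q) * \prod_i (1 - (q i)^-1 * u).
Proof.
have [I HI] := theta_shift F; exists I => q gq q0 qi u gu.
rewrite HI // -(horner_shift_det (zsum q) u); pose z := zsum q.
pose P : {poly K} := \prod_i (1 - (q i)^-1 *: 'X).
have Pu v : P.[v] = \prod_i (1 - (q i)^-1 * v).
  by rewrite horner_prod; apply: eq_bigr => i _; rewrite hornerD hornerN hornerC hornerZ hornerX.
rewrite -Pu -hornerZ; suff -> : shift_det z = theta z *: P by [].
apply/eqP; rewrite -subr_eq0; apply: contraT => R0.
have D0 : (shift_det z).[0] = theta z.
  rewrite horner_shift_det thetaE; congr (\det _); apply/matrixP => c j.
  by rewrite [LHS]mxE [RHS]mxE mul0r subr0.
have Dq i : (shift_det z).[q i] = 0.
  rewrite horner_shift_det -HI //.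
  rewrite (eq_thetaR _ _ (_ : _ =1 fun c => \sum_(v <- [seq q k | k <- enum 'I_g & k != i]) abel v c)).
    rewrite theta_abel_sum ?mul0r ?size_other ?prednK // => v /mapP[k _ ->]; exact: gq.
  by move=> c; rewrite -[z c]/(zsum q c) (zsum_sub_abel q i) addrAC subrr add0r.
pose rs : seq K := 0 :: [seq q i | i <- enum 'I_g].
pose D : {poly K} := shift_det z - theta z *: P.
have : (size rs < size D)%N.
  apply: max_poly_roots => //=.
    rewrite rootE hornerD hornerN hornerZ D0 Pu big1 => [|i _]; last by rewrite mulr0 subr0.
    rewrite mulr1 subrr eqxx; apply/allP => v /mapP[i _ ->].
    rewrite rootE hornerD hornerN hornerZ Dq Pu (bigD1 i) //= mulVf // subrr.
    by rewrite mul0r mulr0 subr0.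
  rewrite map_inj_uniq ?enum_uniq // andbT.
  by apply/mapP => -[i _ /esym/eqP]; rewrite (negbTE (q0 i)).
rewrite /= size_map size_enum_ord ltnNge => /negP[].
rewrite (leq_trans (size_polyD _ _)) // geq_max size_shift_det size_polyN.
rewrite (leq_trans (size_scale_leq _ _)) //.
have := size_prod_1subX [seq (q i)^-1 | i <- enum 'I_g].
by rewrite size_map size_enum_ord big_map big_enum.
Qed.

(** A number that is not good is [1 / F x] for some [x]. The bound on the exponents leaves finitely
    many possible products. *)
Lemma bad_root_prod (rs : seq K) : (forall r, r \in rs -> ~ good r) ->
  exists2 e : 'I_d -> nat, (forall x, (e x <= size rs)%N) &
    forall u, \prod_(r <- rs) (u - r) = \prod_(r <- rs) (- r) * \prod_x (1 - F x * u) ^+ e x.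
Proof.
elim: rs => [|r rs IH] hr.
  by exists (fun=> 0%N) => // u; rewrite !big_nil mul1r big1.
have [|e es eP] := IH; first by move=> r' hr'; apply: hr; rewrite in_cons hr' orbT.
have [x /eqP xr] : exists x, 1 - F x * r == 0.
  apply: contrapT => h; apply: (hr r (mem_head _ _)) => x.
  by apply/eqP => hx; apply: h; exists x; rewrite hx.
exists (fun y => (e y + (y == x))%N) => [y|u].
  by rewrite /= -addn1 leq_add // leq_b1.
rewrite !big_cons eP.
have -> : \prod_y (1 - F y * u) ^+ (e y + (y == x)) =
   (\prod_y (1 - F y * u) ^+ e y) * (1 - F x * u).
  under eq_bigr => y _ do rewrite exprD.
  rewrite big_split /=; congr (_ * _); rewrite (bigD1 x) //= eqxx expr1 big1 ?mulr1 // => y.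
  by move/negbTE ->; rewrite expr0.
have -> : u - r = - r * (1 - F x * u).
  have Fr : F x * r = 1 by apply/esym/eqP; rewrite -subr_eq0 xr.
  have -> : - r * (1 - F x * u) = F x * r * u - r by ring.
  by rewrite Fr mul1r.
ring.
Qed.

Variable th : {mpoly K[g]}.
Hypothesis th0 : th != 0.
Hypothesis th_W : forall us : seq K, size us = g.-1 -> (forall u, u \in us -> good u) ->
  th.@[fun c => \sum_(u <- us) abel u c] = 0.
Hypothesis th_theta : forall z, th.@[z] = 0 -> theta z = 0.

Let M := msize th.

Definition fiber (q : 'I_g -> K) : {poly K} :=
  abel_pullback F (@polyC K) M th (fun i => (q i)%:P) 'X.

(** [fiber] with indeterminates in place of [q], so that the orders of vanishing for generic [q] can
    be read off. *)
Definition gen_fiber : {poly {mpoly K[g]}} :=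
  abel_pullback F (@polyC {mpoly K[g]} \o @mpolyC g K) M th (fun i => ('X_i)%:P) 'X.

Lemma horner_fiber q u : (forall i, good (q i)) -> good u ->
  (fiber q).[u] = (\prod_i (apole F).[q i] * (apole F).[u]) ^+ M *
     th.@[fun c => zsum q c - abel u c].
Proof.
move=> gq gu; rewrite -abel_pullbackE // /fiber.
rewrite -[LHS]/(horner_eval u _) (@abel_pullback_map _ _ _ _ F _ _ _ idK) => [|c]; last first.
  by rewrite /= /horner_eval hornerC.
have -> : horner_eval u \o (fun i => (q i)%:P) = q.
  by apply/funext => i /=; rewrite /horner_eval hornerC.
by rewrite /= /horner_eval hornerX.
Qed.

Lemma map_gen_fiber q : map_poly (meval q) gen_fiber = fiber q.
Proof.
rewrite /gen_fiber (@abel_pullback_map _ _ _ _ F _ _ _ (@polyC K) (map_poly (meval q))) => [|c].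
  have -> : map_poly (meval q) \o (fun i => ('X_i)%:P) = (fun i => (q i)%:P).
    by apply/funext => i /=; rewrite map_polyC /= mevalXU.
  by rewrite /= map_polyX.
by rewrite /= map_polyC /= mevalC.
Qed.

Lemma fiber_perm q (s : 'S_g) : (forall i, good (q i)) -> fiber (q \o s) = fiber q.
Proof.
move=> gq; apply/eqP; rewrite -subr_eq0; apply/eqP/(@poly_eq0_except _ (apole F)).
  by apply: contraPneq (apole0 F) => -> /eqP; rewrite horner0 eq_sym oner_eq0.
move=> u /apole_neq0 gu; rewrite hornerD hornerN !horner_fiber //; last by move=> i; apply: gq.
have -> : \prod_i (apole F).[(q \o s) i] = \prod_i (apole F).[q i].
  by rewrite [RHS](reindex_inj (@perm_inj _ s)).
have -> : th.@[fun c => zsum (q \o s) c - abel u c] = th.@[fun c => zsum q c - abel u c].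
  by apply: meval_eq => c; rewrite zsumE zsumE [in RHS](reindex_inj (@perm_inj _ s)).
by rewrite subrr.
Qed.

Definition fiber_tay i k : {mpoly K[g]} := tay 'X_i k gen_fiber.

Lemma fiber_tayE i k q : (fiber_tay i k).@[q] = tay (q i) k (fiber q).
Proof. by rewrite /fiber_tay -tay_map /= mevalXU map_gen_fiber. Qed.

(** [zsum] is symmetric in the points, so exchanging [q i] and [q j] exchanges the two
    coefficients. *)
Lemma fiber_tay_sym i j k : fiber_tay i k = 0 -> fiber_tay j k = 0.
Proof.
move=> h; apply: (mpoly_eq0_good (F := F)) => q gq.
have gq' : forall e, good ((q \o tperm i j) e) by move=> e; apply: gq.
have := congr1 (meval (q \o tperm i j)) h.
by rewrite !fiber_tayE meval0 fiber_perm //= tpermL.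
Qed.

(** At [u = 0] its value is, up to a nonzero factor, [th] at a sum of [g] Abel images, and these
    sums are dense. *)
Lemma gen_fiber_neq0 : gen_fiber != 0.
Proof.
apply/eqP => h; case/eqP: th0; apply: (abel_dense (F := F) site0) => q gq.
have := horner_fiber gq (good0 F); rewrite -map_gen_fiber h rmorph0 horner0.
move/esym/eqP; rewrite mulf_eq0 expf_eq0 => /orP[/andP[_]|/eqP <-]; last first.
  by apply: meval_eq => c; rewrite abel0 subr0.
rewrite apole0 mulr1 prodf_seq_eq0 => /hasP[i _ /= /negPn]; rewrite negbK => /eqP qi.
by have /apole_neq0 := gq i; rewrite qi eqxx.
Qed.

(* The order of vanishing of [theta (sum A(q_i) - A(u))] at [u = q_i], for
   generic [q], does not depend on [i]. *)
Lemma generic_multiplicity : exists m, (forall i, fiber_tay i m != 0) /\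
  (forall i k, (k < m)%N -> fiber_tay i k = 0).
Proof.
pose i0 := Ordinal g_gt0.
have ex : exists k, fiber_tay i0 k != 0.
  apply: contrapT => h; case/eqP: gen_fiber_neq0.
  have -> : gen_fiber = (gen_fiber \Po ('X + ('X_i0)%:P)) \Po ('X - ('X_i0)%:P).
    by rewrite -comp_polyA comp_polyD comp_polyX comp_polyC subrK comp_polyXr.
  have -> : gen_fiber \Po ('X + ('X_i0)%:P) = 0; last by rewrite comp_poly0.
  apply/polyP => k; rewrite coef0; apply/eqP/negPn/negP => hk.
  by apply: h; exists k.
case: (ex_minnP ex) => m m0 mmin; exists m; split => [i|i k km].
  by apply: contraNneq m0 => /(fiber_tay_sym i0) ->.
apply: (@fiber_tay_sym i0); apply/eqP; apply: contraLR km => /mmin.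
by rewrite -leqNgt.
Qed.

Lemma fiber_factor q m : injective q ->
  (forall i, tay (q i) m (fiber q) != 0) ->
  (forall i k, (k < m)%N -> tay (q i) k (fiber q) = 0) ->
  exists2 E, fiber q = \prod_i ('X - (q i)%:P) ^+ m * E & forall i, E.[q i] != 0.
Proof.
move=> qi qm qk.
have : \prod_(a <- [seq q i | i <- enum 'I_g]) ('X - a%:P) ^+ m %| fiber q.
  apply: dvdp_prod_XsubC_exp; first by rewrite map_inj_uniq ?enum_uniq.
  by move=> a /mapP[i _ ->]; apply: tay_dvdp => k /(qk i).
rewrite big_map big_enum /= => /dvdpP[E EE]; exists E => [|i]; first by rewrite mulrC.
have := qm i; rewrite EE mulrC (bigD1 i) //= -mulrA tay_mul_exp ltnn subnn tay_at0 hornerM.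
by rewrite mulf_eq0 negb_or => /andP[].
Qed.

Lemma theta_zsum_neq0_generic : exists2 h : {mpoly K[g]}, h != 0 &
  forall q, (forall i, good (q i)) -> h.@[q] != 0 -> theta (zsum q) != 0.
Proof.
pose h := abel_pullback F (@mpolyC g K) (msize Theta) Theta (fun i => 'X_i) 0.
have hE q : (forall i, good (q i)) ->
    h.@[q] = (\prod_i (apole F).[q i]) ^+ msize Theta * theta (zsum q).
  move=> gq; rewrite /h (@abel_pullback_map _ _ _ _ F _ _ _ idK (meval q)) => [|c]; last first.
    by rewrite /= mevalC.
  have -> : meval q \o (fun i => 'X_i) = q by apply/funext => i /=; rewrite mevalXU.
  rewrite rmorph0 abel_pullbackE //; last exact: good0.
  rewrite apole0 mulr1 -Theta_meval; congr (_ * _); apply: meval_eq => c.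
  by rewrite abel0 subr0.
exists h => [|q gq].
  have [q gq Tq] := exists_theta_neq0 F; apply: contraNneq Tq => h0.
  have := hE q gq; rewrite h0 meval0 => /esym/eqP; rewrite mulf_eq0 => /orP[|//].
  rewrite expf_eq0 => /andP[_ /eqP P0]; have : \prod_i (apole F).[q i] != 0.
    by apply/prodf_neq0 => i _; apply/apole_neq0.
  by rewrite P0 eqxx.
by rewrite hE // mulf_eq0 negb_or => /andP[].
Qed.

(** For generic [q], the values of [th] and theta at [zsum q - A(u)] vanish, among good [u], exactly
    at the [q i], with multiplicities [m] and 1. So translation by [A(u)] changes their quotient
    [th / theta^m] only by powers of the [1 - F x * u], and [abel_quasi_invariant] applies. *)
Lemma theta_power : exists m, exists2 c, c != 0 & th = c *: Theta ^+ m.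
Proof.
have [m [m0 mk]] := generic_multiplicity.
have [hT hT0 hTP] := theta_zsum_neq0_generic.
have [I HI] := pencil.
pose dist : {mpoly K[g]} := \prod_i \prod_(j | j != i) ('X_i - 'X_j).
(* [G] excludes the [q] at which the multiplicity jumps, theta vanishes, two coordinates coincide or
   one is 0. *)
pose G : {mpoly K[g]} := (\prod_i fiber_tay i m) * hT * dist * \prod_i 'X_i.
have G0 : G != 0.
  have X0 (p : {mpoly K[g]}) (v : 'I_g -> K) : p.@[v] != 0 -> p != 0.
    by apply: contraNneq => ->; rewrite meval0.
  rewrite !mulf_neq0 //; apply/prodf_neq0 => i _ //.
  - apply/prodf_neq0 => j ji; apply: (X0 _ (fun k => (k == i)%:R)).
    by rewrite mevalB !mevalXU eqxx (negbTE ji) subr0 oner_neq0.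
  - by apply: (X0 _ (fun=> 1)); rewrite mevalXU oner_neq0.
pose B := size gen_fiber.
have Theta0 : Theta != 0.
  have [q gq Tq] := exists_theta_neq0 F; apply: contraNneq Tq => h0.
  by rewrite -Theta_meval h0 meval0.
exists m; apply: (abel_quasi_invariant site0) => //; first by rewrite expf_neq0.
move=> u gu; pose chi (e : {ffun 'I_d -> 'I_B.+1}) := \prod_x (1 - F x * u) ^+ e x.
pose s e := chi e * (\prod_(x in I) (1 - F x * u)) ^+ m / (apole F).[u] ^+ M.
have pu0 : (apole F).[u] != 0 by apply/apole_neq0.
(* The exponents [e] may depend on [q]. They range over a finite set, and for each generic [q] some
   [fe e] vanishes; so the product of all of them is 0, hence one [fe e] is 0 identically and its
   [s e] serves all [z]. *)
pose fe e : {mpoly K[g]} := mshift th (abel u) * Theta ^+ m - s e *: (th * mshift Theta (abel u) ^+ m).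
suff : \prod_e fe e = 0.
  move/eqP; rewrite prodf_seq_eq0 => /hasP[e _ /= /eqP fe0]; exists (s e) => z.
  have := congr1 (meval z) fe0; rewrite meval0 mevalB mevalZ !mevalM !rmorphXn /= !mshiftE.
  by move/eqP; rewrite subr_eq0 => /eqP.
apply: (abel_dense_generic site0 G0) => q gq.
rewrite !mevalM !mulf_eq0 !negb_or => /andP[/andP[/andP[Gm GT] Gd] GX].
have q0 i : q i != 0.
  by move: GX; rewrite rmorph_prod => /prodf_neq0/(_ i isT); rewrite /= mevalXU.
have qi : injective q.
  move=> i j E; apply/eqP/negPn/negP => ij; move: Gd; rewrite rmorph_prod.
  move=> /prodf_neq0/(_ i isT) /=; rewrite rmorph_prod => /prodf_neq0/(_ j).
  by rewrite eq_sym ij => /(_ isT) /=; rewrite mevalB !mevalXU E subrr eqxx.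
have Tq := hTP q gq GT.
have tm i : tay (q i) m (fiber q) != 0.
  by rewrite -fiber_tayE; move: Gm; rewrite rmorph_prod => /prodf_neq0/(_ i isT).
have tk i k : (k < m)%N -> tay (q i) k (fiber q) = 0.
  by move=> km; rewrite -fiber_tayE mk // meval0.
have [E FE Eq] := fiber_factor qi tm tk.
have E0 : E != 0 by apply: contraNneq (Eq (Ordinal g_gt0)) => ->; rewrite horner0.
have [rs EE] := closed_field_poly_normal E.
(* A good root of [E] would be a zero of [th], hence of theta, hence one of the [q i] by [pencil];
   but [E] does not vanish there. *)
have bad r : r \in rs -> ~ good r.
  move=> rrs gr; have Er : E.[r] = 0.
    by apply/eqP; rewrite EE -rootE rootZ ?lead_coef_eq0 // root_prod_XsubC.
  have := horner_fiber gq gr; rewrite FE hornerM Er mulr0 => /esym/eqP.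
  rewrite mulf_eq0 => /orP[|/eqP/th_theta Tr].
    rewrite expf_eq0 => /andP[_]; rewrite mulf_eq0 => /orP[|/eqP h].
      by rewrite prodf_seq_eq0 => /hasP[i _ /= /eqP h]; have /apole_neq0 := gq i; rewrite h eqxx.
    by have /apole_neq0 := gr; rewrite h eqxx.
  have := HI q gq q0 qi r gr; rewrite Tr mul0r => /esym/eqP; rewrite mulf_eq0 (negbTE Tq) /=.
  rewrite prodf_seq_eq0 => /hasP[i _ /=]; rewrite subr_eq0 => /eqP h.
  have qr : r = q i by rewrite -[q i]mulr1 h mulVKf.
  by have := Eq i; rewrite -qr Er eqxx.
have [e es eP] := bad_root_prod bad.
have sB : (size rs <= B)%N.
  have fq0 : fiber q != 0.
    by rewrite FE mulf_neq0 //; apply/prodf_neq0 => i _; rewrite expf_neq0 ?polyXsubC_eq0.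
  have sE : (size E <= size (fiber q))%N by apply: dvdp_leq fq0 _; rewrite FE dvdp_mull.
  have sF : (size (fiber q) <= B)%N by rewrite -map_gen_fiber size_poly.
  rewrite (leq_trans _ (leq_trans sE sF)) // EE size_scale ?lead_coef_eq0 //.
  by rewrite size_prod_XsubC.
pose e' : {ffun 'I_d -> 'I_B.+1} := [ffun x => inord (e x)].
have e'E x : e' x = e x :> nat.
  by rewrite ffunE inordK // ltnS (leq_trans (es x)).
rewrite rmorph_prod (bigD1 e') //=; apply/eqP; rewrite mulf_eq0; apply/orP; left.
rewrite mevalB mevalZ !mevalM !rmorphXn /= !mshiftE Theta_meval Theta_meval subr_eq0; apply/eqP.
set z := zsum q in Tq *; set zu := fun c => z c - abel u c.
pose W := \prod_i (1 - (q i)^-1 * u); pose Q := \prod_i - q i.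
have qE v : E.[v] = lead_coef E * \prod_(r <- rs) (v - r).
  rewrite {1}EE hornerZ horner_prod; congr (_ * _); apply: eq_bigr => r _.
  exact: hornerXsubC.
have Eu : E.[u] = E.[0] * chi e'.
  rewrite !qE eP -mulrA; congr (_ * (_ * _)); first by apply: eq_bigr => r _; rewrite sub0r.
  by apply: eq_bigr => x _; rewrite e'E.
have Pv v : (\prod_i ('X - (q i)%:P) ^+ m).[v] = (\prod_i (v - q i)) ^+ m.
  rewrite horner_prod -prodrXl; apply: eq_bigr => i _.
  by rewrite horner_exp hornerXsubC.
have PW : \prod_i (u - q i) = Q * W.
  rewrite -big_split; apply: eq_bigr => i _ /=.
  by rewrite mulrBr mulr1 mulNr mulVKf // opprK addrC.
have P0 : \prod_i (0 - q i) = Q by apply: eq_bigr => i _; rewrite sub0r.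
have Fu := horner_fiber gq gu; have F0 := horner_fiber gq (good0 F).
have z0 : th.@[fun c => zsum q c - abel 0 c] = th.@[z].
  by apply: meval_eq => c; rewrite abel0 subr0.
rewrite FE hornerM Pv PW Eu exprMn in Fu; rewrite FE hornerM Pv P0 z0 apole0 mulr1 in F0.
set Pq := \prod_i _ in Fu F0.
have Pq0 : Pq ^+ M != 0.
  by rewrite expf_neq0 //; apply/prodf_neq0 => i _; apply/apole_neq0.
have key : (apole F).[u] ^+ M * th.@[zu] = th.@[z] * (W ^+ m * chi e').
  apply: (mulfI Pq0); rewrite mulrA -exprMn -Fu [in RHS]mulrA -F0; ring.
have keyT := HI q gq q0 qi u gu.
apply: (mulfI (expf_neq0 M pu0)); rewrite mulrA key /s.
set J := \prod_(x in I) _ in keyT *; set pM := (apole F).[u] ^+ M.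
have -> : pM * (chi e' * J ^+ m / pM * (th.@[z] * theta zu ^+ m)) =
   (pM / pM) * (chi e' * th.@[z] * (theta zu * J) ^+ m) by rewrite exprMn; ring.
by rewrite divff ?expf_neq0 // mul1r keyT exprMn; ring.
Qed.

Hypothesis th_reduced : forall q r : {mpoly K[g]}, th = q ^+ 2 * r -> (msize q <= 1)%N.

(** In [th = c Theta^m] the exponent 0 is impossible because [th] has zeros. For [m >= 2]
    reducedness makes [Theta] constant, thus 0 since it has a zero. *)
Theorem theta_unique : exists2 c, c != 0 & Theta = c *: th.
Proof.
have [m [c c0 thE]] := theta_power.
pose us := nseq g.-1 (0 : K).
have gus u : u \in us -> good u by move=> /nseqP[-> _]; apply: good0.
have Tus : Theta.@[fun c => \sum_(u <- us) abel u c] = 0.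
  by rewrite Theta_meval theta_abel_sum // size_nseq prednK.
case: m thE => [|[|m]] thE.
- have := th_W (size_nseq _ _) gus.
  by rewrite thE expr0 mevalZ meval1 mulr1 => /eqP; rewrite (negbTE c0).
- exists c^-1; first by rewrite invr_neq0.
  by rewrite thE expr1 scalerA mulVf ?scale1r.
have := @th_reduced Theta (c *: Theta ^+ m).
rewrite thE -scalerAr -exprD add2n => /(_ erefl) /msize1_polyC TC.
have T0 : Theta = 0.
  by rewrite TC -[Theta@_0](mevalC (fun c => \sum_(u <- us) abel u c)) -TC Tus mpolyC0.
by case/eqP: th0; rewrite thE T0 expr0n scaler0.
Qed.

End ThetaDivisor.

(** * The tau determinant *)

Section WeightFiltration.
Variables (K : numFieldType) (N : nat).
Implicit Types (p q : {mpoly K[N]}) (P Q : {poly {mpoly K[N]}}).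

(* ['X_i] has weight [i + 1]. *)
Definition wge k p := forall m, (mnmwgt m < k)%N -> p@_m = 0.

Lemma wge0 k : wge k 0.
Proof. by move=> m _; rewrite mcoeff0. Qed.
Lemma wgeD k p q : wge k p -> wge k q -> wge k (p + q).
Proof. by move=> hp hq m mk; rewrite mcoeffD hp ?hq ?addr0. Qed.
Lemma wgeN k p : wge k p -> wge k (- p).
Proof. by move=> hp m mk; rewrite mcoeffN hp ?oppr0. Qed.
Lemma wgeM k l p q : wge k p -> wge l q -> wge (k + l) (p * q).
Proof.
move=> hp hq m mkl; rewrite mcoeffM big1 // => -[m1 m2] /= /eqP E.
have [m1k|km1] := ltnP (mnmwgt m1) k; first by rewrite hp ?mul0r.
rewrite hq ?mulr0 //; rewrite E mnmwgtD in mkl; lia.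
Qed.
Lemma wge_any p : wge 0 p. Proof. by []. Qed.
Lemma wgeMl k p q : wge k q -> wge k (p * q).
Proof. by move=> hq; rewrite -[k]add0n; apply: wgeM. Qed.
Lemma wgeW k l p : (l <= k)%N -> wge k p -> wge l p.
Proof. by move=> lk hp m ml; apply: hp; apply: leq_trans lk. Qed.
Lemma wge_sum (J : Type) k (r : seq J) (R : pred J) (G : J -> {mpoly K[N]}) :
  (forall j, R j -> wge k (G j)) -> wge k (\sum_(j <- r | R j) G j).
Proof. by move=> h; elim/big_ind: _ => //; [exact: wge0|move=> *; exact: wgeD]. Qed.

Lemma wge_prodB (J : Type) k (r : seq J) (G H : J -> {mpoly K[N]}) :
  (forall j, wge k (G j - H j)) -> wge k (\prod_(j <- r) G j - \prod_(j <- r) H j).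
Proof.
move=> h; elim: r => [|j r IH]; first by rewrite !big_nil subrr; apply: wge0.
rewrite !big_cons.
have -> : G j * \prod_(i <- r) G i - H j * \prod_(i <- r) H i =
  G j * (\prod_(i <- r) G i - \prod_(i <- r) H i) + (\prod_(i <- r) H i) * (G j - H j) by ring.
by apply: wgeD; apply: wgeMl.
Qed.

Lemma wge_detB k g (G H : 'M[{mpoly K[N]}]_g) :
  (forall i j, wge k (G i j - H i j)) -> wge k (\det G - \det H).
Proof.
move=> h; rewrite /determinant -sumrB; apply: wge_sum => s _.
by rewrite -mulrBr; apply: wgeMl; apply: wge_prodB.
Qed.

Lemma wge_det_row k g (G : 'M[{mpoly K[N]}]_g) i :
  (forall j, wge k (G i j)) -> wge k (\det G).
Proof.
move=> h; rewrite (expand_det_row _ i); apply: wge_sum => j _.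
by rewrite mulrC; apply: wgeMl.
Qed.

Definition pwge k P := forall i, wge k P`_i.

Lemma pwge0 k : pwge k 0.
Proof. by move=> i; rewrite coef0; apply: wge0. Qed.
Lemma pwgeD k P Q : pwge k P -> pwge k Q -> pwge k (P + Q).
Proof. by move=> hP hQ i; rewrite coefD; apply: wgeD. Qed.
Lemma pwgeN k P : pwge k P -> pwge k (- P).
Proof. by move=> hP i; rewrite coefN; apply: wgeN. Qed.
Lemma pwgeM k l P Q : pwge k P -> pwge l Q -> pwge (k + l) (P * Q).
Proof. by move=> hP hQ i; rewrite coefM; apply: wge_sum => j _; apply: wgeM. Qed.
Lemma pwgeMl k P Q : pwge k Q -> pwge k (P * Q).
Proof. by move=> hQ; rewrite -[k]add0n; apply: pwgeM => // i; apply: wge_any. Qed.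
Lemma pwgeX k P : pwge 1 P -> pwge k (P ^+ k).
Proof.
move=> hP; elim: k => [|k IH]; first by move=> i; apply: wge_any.
by rewrite exprS -add1n; apply: pwgeM.
Qed.

Lemma wgeX k p : wge 1 p -> wge k (p ^+ k).
Proof.
move=> hp; elim: k => [|k IH]; first exact: wge_any.
by rewrite exprS -add1n; apply: wgeM.
Qed.

Lemma wgeXi i : wge 1 ('X_i : {mpoly K[N]}).
Proof.
move=> m; rewrite ltnS leqn0 => /eqP m0; rewrite mcoeffX; case: eqP => // E.
by rewrite -E mnmwgt1 in m0.
Qed.

Lemma wgeZ k (c : K) p : wge k p -> wge k (c *: p).
Proof. by move=> hp m mk; rewrite mcoeffZ hp ?mulr0. Qed.

(** The series [exp(sum_i x_i v^i)] has this property, so its coefficients at high powers of [v]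
    have high weight. *)
Definition weighted P := forall i m, mnmwgt m != i -> (P`_i)@_m = 0.

Lemma weightedM P Q : weighted P -> weighted Q -> weighted (P * Q).
Proof.
move=> hP hQ i m mi; rewrite coefM raddf_sum big1 //= => j _.
rewrite mcoeffM big1 // => -[m1 m2] /= /eqP E.
have [m1j|m1j] := eqVneq (mnmwgt m1) j; last by rewrite hP ?mul0r.
rewrite hQ ?mulr0 //; rewrite E mnmwgtD in mi; have := ltn_ord j; lia.
Qed.

Lemma weightedX P k : weighted P -> weighted (P ^+ k).
Proof.
move=> hP; elim: k => [|k IH]; last by rewrite exprS; apply: weightedM.
move=> i m mi; rewrite coef1; case: eqP => [i0|_]; last by rewrite mcoeff0.
by rewrite mcoeff1; case: eqP => // E; rewrite E i0 mnmwgt0 in mi.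
Qed.

Lemma weighted_wge P i k : weighted P -> (k <= i)%N -> wge k P`_i.
Proof. by move=> hP ki m mk; apply: hP; rewrite ltn_eqF // (leq_trans mk). Qed.

Definition xi : {poly {mpoly K[N]}} := \sum_(i < N) 'X_i *: 'X^(i.+1).
Definition xi_at (a : K) : {mpoly K[N]} := \sum_(i < N) a ^+ i.+1 *: 'X_i.

Lemma coef_xi j : xi`_j = \sum_(i < N) 'X_i *+ (j == i.+1).
Proof.
rewrite coef_sum; apply: eq_bigr => i _; rewrite coefZ coefXn.
by case: eqP; rewrite ?mulr1 ?mulr0 ?mulr1n ?mulr0n.
Qed.

Lemma weighted_xi : weighted xi.
Proof.
move=> j m mj; rewrite coef_xi raddf_sum big1 //= => i _; rewrite mcoeffMn mcoeffX.
case: eqP => [E|_]; last by rewrite mul0rn.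
by case: eqP => // ji; rewrite -E mnmwgt1 ji eqxx in mj.
Qed.

Lemma pwge_xi : pwge 1 xi.
Proof.
move=> j; rewrite coef_xi; apply: wge_sum => i _; case: eqP => _ /=; last exact: wge0.
exact: wgeXi.
Qed.

Lemma horner_xi a : xi.[a%:MP] = xi_at a.
Proof.
rewrite horner_sum; apply: eq_bigr => i _; rewrite hornerZ hornerXn -rmorphXn /=.
by rewrite mulrC mul_mpolyC.
Qed.

Lemma wge_xi_at a : wge 1 (xi_at a).
Proof. by apply: wge_sum => i _; apply: wgeZ; apply: wgeXi. Qed.

Lemma texp_xi_at_prod D (J : Type) (r : seq J) (a : J -> K) : (0 < D)%N ->
  wge D (\prod_(j <- r) texp (@mpolyC N K) D (xi_at (a j)) -
           texp (@mpolyC N K) D (\sum_(j <- r) xi_at (a j))).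
Proof.
move=> D0; elim: r => [|j r IH].
  by rewrite !big_nil texp_at0 // subrr; apply: wge0.
rewrite !big_cons; set e := texp _ D; set s := \sum_(i <- r) _.
set P := \prod_(i <- r) _ in IH *; set E := e (xi_at (a j)).
have -> : E * P - e (xi_at (a j) + s) = E * (P - e s) + (E * e s - e (xi_at (a j) + s)).
  by rewrite mulrBr addrA subrK.
apply: wgeD; first exact: wgeMl.
apply: texpD => [|p q|p q|i k ik]; [exact: wge0|exact: wgeD|exact: wgeMl|].
apply: (wgeW ik); apply: wgeM; apply: wgeX; first exact: wge_xi_at.
by apply: wge_sum => l _; apply: wge_xi_at.
Qed.

Definition expxi D := texp (@polyC {mpoly K[N]} \o @mpolyC N K) D xi.

Lemma weighted_expxi D : weighted (expxi D).
Proof.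
move=> i m mi; rewrite /expxi /texp coef_sum raddf_sum big1 //= => k _.
by rewrite /texp_term /= coefCM mcoeffCM (weightedX _ weighted_xi) ?mulr0.
Qed.

End WeightFiltration.

(** * The determinant of the exponential series *)

Section FormalDeterminant.
Variables (K : numFieldType) (g d n : nat) (F : frame K g d n).

Section Variables.
Variable N : nat.

Local Notation mpC := (@mpolyC N K : {rmorphism K -> {mpoly K[N]}}).

(** For the forms of the curve, [moment c k.+1] is the coefficient [a_(k, c)]; [moment c 0] is 0
    because constants lie in the kernel. *)
Definition moment c k : K := ell F (idfun : {rmorphism K -> K}) 'X^k c 0.

Lemma moment0 c : moment c 0 = 0.
Proof. by rewrite /moment expr0 -[1]/(1%:P) ell_C mxE. Qed.

Lemma ell_poly_moment (P : {poly {mpoly K[N]}}) c L : (size P <= L)%N ->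
  ell F mpC P c 0 = \sum_(l < L) moment c l *: P`_l.
Proof.
move=> sP; have {1}-> : P = \sum_(j < L) P`_j *: 'X^j.
  rewrite -[LHS]coefK poly_def -!(big_mkord xpredT (fun j => P`_j *: 'X^j)).
  rewrite [RHS](big_cat_nat (leq0n _) sP) /=.
  rewrite [X in _ + X]big_nat [X in _ + X]big1 ?addr0 // => j /andP[Pj _].
  by rewrite nth_default ?scale0r.
rewrite ell_sum summxE; apply: eq_bigr => l _; rewrite ellZ [LHS]mxE.
have := ell_map F 'X^l (fun c => erefl (mpC c)) (f := (idfun : {rmorphism K -> K})) (h := mpC).
rewrite map_polyXn => ->; rewrite [X in _ * X]mxE -/(moment c l).
by rewrite mulrC mul_mpolyC.
Qed.

Definition lin_form c : {mpoly K[N]} := \sum_(i < N) moment c i.+1 *: 'X_i.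

Lemma ell_xi c : ell F mpC (xi K N) c 0 = lin_form c.
Proof.
rewrite ell_sum summxE; apply: eq_bigr => i _; rewrite ellZ [LHS]mxE.
have := ell_map F 'X^(i.+1) (fun c => erefl (mpC c)) (f := (idfun : {rmorphism K -> K})) (h := mpC).
rewrite map_polyXn => ->; rewrite [X in _ * X]mxE -/(moment c i.+1).
by rewrite mulrC mul_mpolyC.
Qed.

End Variables.

(* Split [xi] into an element [y] of [ker ell] and a combination of the
   [dual c], and use the norm character of [exp y]. *)
Theorem det_expxi : exists I : {set 'I_d}, forall N D, (n <= D)%N -> (0 < D)%N ->
  wge D (\det (\matrix_(c, j < g) ell F (@mpolyC N K) ('X^(rev_ord j) * expxi K N D) c 0) -
    texp (@mpolyC N K) D (\sum_(x in I) xi_at N (F x)) * thetaR F (@mpolyC N K) (lin_form N)).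
Proof.
have [I HI] := ell_norm F; exists I => N D nD D0.
pose mpC := @mpolyC N K : {rmorphism K -> {mpoly K[N]}}; pose lin_form := lin_form N.
pose w := zdual F mpC lin_form; pose y := xi K N - w.
have vw : vanishing F mpC w by apply: zdual_vanish.
have y0 : ell F mpC y = 0.
  apply/colP => c; rewrite ellB.
  transitivity (ell F mpC (xi K N) c 0 - ell F mpC w c 0).
    by rewrite [LHS]mxE [X in _ + X]mxE.
  have E1 := ell_xi N c; have E2 : ell F mpC w c 0 = lin_form c by exact: ell_zdual.
  have E3 : lin_form c - lin_form c = 0 by rewrite subrr.
  have E4 : (0 : 'cV[{mpoly K[N]}]_g) c 0 = 0.
    by rewrite mxE.
  by rewrite E4 -E3; congr (_ - _); [exact: E1|exact: E2].
have yk k : ell F mpC (y ^+ k) = 0.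
  case: k => [|k]; first exact: ell_C.
  elim: k => [|k IH]; first by rewrite expr1.
  by have [B E _] := HI _ _ _ y0; rewrite exprS E IH mulmx0.
pose ex := texp (@polyC {mpoly K[N]} \o @mpolyC N K) D.
have ey0 : ell F mpC (ex y) = 0.
  rewrite /ex /texp ell_sum; apply: big1 => k _; rewrite /texp_term.
  have -> : (polyC \o @mpolyC N K) k`!%:R^-1 * y ^+ k = (k`!%:R^-1)%:MP_[N] *: y ^+ k.
    exact: mul_polyC.
  rewrite ellZ yk; exact: scaler0.
have [B BE BD] := HI _ _ _ ey0.
have pw : pwge 1 w.
  move=> i; rewrite coef_sum; apply: wge_sum => c _; rewrite coefZ mulrC; apply: wgeMl.
  by apply: wge_sum => k _; apply: wgeZ; apply: wgeXi.
have py : pwge 1 y by apply: pwgeD; [exact: pwge_xi|exact: pwgeN].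
have eE : pwge D (ex y * ex w - expxi K N D).
  have xiE : xi K N = y + w by rewrite subrK.
  have T := @texpD K _ (@polyC {mpoly K[N]} \o @mpolyC N K) (pwge (N:=N) D) D y w
    (@pwge0 K N D) (fun a b => @pwgeD K N D a b) (fun a b => @pwgeMl K N D a b).
  rewrite /expxi xiE; apply: T => i k ik l.
  have h : pwge (i + k) (y ^+ i * w ^+ k) by apply: pwgeM; apply: pwgeX.
  by apply: (wgeW ik); apply: h.
have ellw P c : pwge D P -> wge D (ell F mpC P c 0).
  move=> hP; rewrite (ell_poly_moment c (leqnn (size P))); apply: wge_sum => l _.
  by apply: wgeZ.
(* The powers [w^k] with [k >= n] have zero jets, so truncating at [D] or at [n] is the same for
   [ell]. *)
have ewE P : ell F mpC (P * ex w) = ell F mpC (P * zexp F mpC lin_form).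
  rewrite /ex /zexp /pexp -/w /texp (big_cat_nat (leq0n _) nD) /= mulrDr ellD.
  set T := \sum_(n <= i < D) _; have T0 : ell F mpC (P * T) = 0.
    rewrite /T big_nat mulr_sumr ell_sum; apply: big1 => k /andP[nk _].
    rewrite /ell /texp_term.
    have -> (a : {poly {mpoly K[N]}}) : P * (a * w ^+ k) = w ^+ k * w ^+ 0 * (P * a).
      by rewrite expr0 mulr1 mulrA mulrC.
    rewrite (nu_vanish _ vw vw) ?addn0; first exact: mulmx0.
    exact: nk.
  by rewrite T0; apply: addr0.
pose G := \matrix_(c, j < g) ell F mpC ('X^(rev_ord j) * (ex y * ex w)) c 0.
(* [w] vanishes at the sites, so [exp(y)] takes there the value of [exp(xi)]: this is the origin of
   the exponential factor of tau. *)
have GE : \det G = (\prod_(x in I) texp mpC D (xi_at N (F x))) * thetaR F mpC lin_form.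
  have -> : G = B *m \matrix_(c, j < g) ell F mpC ('X^(rev_ord j) * zexp F mpC lin_form) c 0.
    apply/matrixP => c j; rewrite [LHS]mxE [RHS]mxE.
    rewrite (_ : 'X^(rev_ord j) * (ex y * ex w) = ex y * ('X^(rev_ord j) * ex w)); last by ring.
    rewrite BE ewE [LHS]mxE; apply: eq_bigr => e _; congr (_ * _).
    by rewrite [RHS]mxE.
  rewrite det_mulmx BD; congr (_ * _); apply: eq_bigr => x _.
  have -> : (ex y).[mpC (F x)] = texp mpC D y.[mpC (F x)].
    by apply: (rmorph_texp (h := horner_eval (mpC (F x)))) => c /=; rewrite /horner_eval hornerC.
  by rewrite hornerD hornerN (vw x) subr0 horner_xi.
set T := thetaR _ _ _ in GE *; set H := \det (\matrix_(c, j) _).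
have -> : H - texp mpC D (\sum_(x in I) xi_at N (F x)) * T = (H - \det G) +
   T * (\prod_(x in I) texp mpC D (xi_at N (F x)) - texp mpC D (\sum_(x in I) xi_at N (F x))).
  by rewrite GE; ring.
apply: wgeD; last by apply: wgeMl; rewrite -!big_enum; apply: texp_xi_at_prod.
apply: wge_detB => c j; rewrite [X in X - _]mxE [X in _ - X]mxE.
have -> (U V : 'cV[{mpoly K[N]}]_g) : U c 0 - V c 0 = (U - V) c 0.
  by rewrite [RHS]mxE [X in _ = _ + X]mxE.
rewrite -ellB -mulrBr; apply: ellw; apply: pwgeMl; rewrite -opprB; exact: pwgeN.
Qed.

End FormalDeterminant.

(** * Schur expansion of the tau function *)

From mathcomp Require Import classical_sets fsbigop.

Lemma stable_valueE (K : fieldType) (s : nat -> K) N0 d :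
  (forall N, (N0 <= N)%N -> s N = d) -> stable_value s = d.
Proof.
move=> h; rewrite /stable_value; case: xgetP => [e _ [N1 h1]|/(_ d) []]; last by exists N0.
by rewrite -(h1 (maxn N0 N1)) ?leq_maxr // h ?leq_maxl.
Qed.

Section Tau.
Variables (K : numFieldType) (g : nat) (f : nat -> int -> K) (al : 'I_g -> nat -> K).
Hypothesis f_lt : forall (c : 'I_g) (k : nat), frame_coef f (k%:Z - g%:Z) c = al c k.
Hypothesis f_ge : forall c (i : int), (g <= c)%N -> frame_coef f i c = (i == - c.+1%:Z)%:R.
Hypothesis al0 : forall c, al c 0 = 0.

Lemma det_col0 (A : comNzRingType) m (M : 'M[A]_m) j : (forall i, M i j = 0) -> \det M = 0.
Proof. by move=> h; rewrite (expand_det_col _ j) big1 // => i _; rewrite h mul0r. Qed.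

Lemma det_row0 (A : comNzRingType) m (M : 'M[A]_m) i : (forall j, M i j = 0) -> \det M = 0.
Proof. by move=> h; rewrite (expand_det_row _ i) big1 // => j _; rewrite h mul0r. Qed.

(** The columns from index [g] on are pure powers of [u]. The rows from index [g] on belong to zero
    parts, so the lower right block of the truncated minor is the identity and the block above it is
    0. *)
Lemma frame_minor_short lam : (size lam <= g)%N ->
  frame_minor f lam = \det (\matrix_(r < g, c < g) al c (nth 0%N lam r + rev_ord r)).
Proof.
move=> sl; apply: (@stable_valueE _ _ g) => N gN; rewrite -(subnKC gN); move: (N - g)%N => k {N gN}.
rewrite /truncated_minor.
have -> : \matrix_(r < g + k, c < g + k) frame_coef f ((nth 0%N lam r)%:Z - r.+1%:Z) c =
  block_mx (\matrix_(r < g, c < g) al c (nth 0%N lam r + rev_ord r)) 0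
    (\matrix_(r < k, c < g) frame_coef f ((nth 0%N lam (g + r))%:Z - (g + r).+1%:Z) c) 1%:M.
  apply/matrixP => r c; rewrite !mxE; case: splitP => r' rE; rewrite !mxE; case: splitP => c' cE; rewrite !mxE rE cE.
  - rewrite -f_lt; congr (frame_coef f _ _); have := ltn_ord r'; rewrite /=; lia.
  - rewrite f_ge ?leq_addr //; case: eqP => //; have := ltn_ord r'; lia.
  - by [].
  - rewrite f_ge ?leq_addr // nth_default ?(leq_trans sl) ?leq_addr //.
    rewrite -val_eqE /=; congr ((_ : bool)%:R); apply/eqP/eqP; lia.
by rewrite det_lblock det1 mulr1.
Qed.

(** Column number [size lam] lies beyond [g], so it could be nonzero only in a row with
    [lam_i - i = - size lam]. Positive parts keep [lam_i - i] above that value, zero parts below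
    it. *)
Lemma frame_minor_long lam : (g < size lam)%N -> 0%N \notin lam -> frame_minor f lam = 0.
Proof.
move=> sl lam0; apply: (@stable_valueE _ _ (size lam)) => N sN.
have lt : ((size lam).-1 < N)%N by lia.
apply: (@det_col0 _ _ _ (Ordinal lt)) => r; rewrite mxE f_ge /=; last by rewrite -ltnS prednK // (leq_ltn_trans _ sl).
have [rl|lr] := ltnP r (size lam).
  have n0 : (0 < nth 0%N lam r)%N.
    by rewrite lt0n; apply: contraNneq lam0 => <-; apply: mem_nth.
  case: eqP => // E; move: rl n0 lt E sl; set S := size lam; set v := nth _ _ _; clearbody S v; lia.
rewrite nth_default //; case: eqP => // E.
by move: lr lt E sl; set S := size lam; clearbody S; lia.
Qed.

Variable N : nat.

Definition sg (a b : nat) : {mpoly K[N]} := if (b <= a)%N then sigma_poly K N (a - b) else 0.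

Lemma sigma_int_sg (a b : nat) : sigma_int K N (a%:Z - b%:Z) = sg a b.
Proof.
rewrite /sg; case: leqP => [ba|ab]; first by rewrite subzn.
have -> : a%:Z - b%:Z = Negz (b - a).-1 by lia.
by [].
Qed.

Lemma schur_det m lam : size lam = m ->
  schur_weierstrass K N lam = \det (\matrix_(i < m, j < m) sg (nth 0%N lam i + rev_ord i) (rev_ord j)).
Proof.
move=> <-; congr (\det _); apply/matrixP => i j; rewrite !mxE -sigma_int_sg.
by congr sigma_int; have := ltn_ord i; have := ltn_ord j; rewrite /=; lia.
Qed.

Lemma coef_xi_lt (k i : nat) : (i < k)%N -> (xi K N ^+ k)`_i = 0.
Proof.
have -> : xi K N = 'X * drop_poly 1 (xi K N).
  apply/polyP => -[|j]; rewrite coefXM /= ?coef_drop_poly ?addn1 // coef_xi big1 // => l _.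
by move=> ik; rewrite exprMn coefXnM ik.
Qed.

Lemma sigma_poly_expxi D k : (k < D)%N -> sigma_poly K N k = (expxi K N D)`_k.
Proof.
move=> kD; rewrite /sigma_poly /expxi /texp (big_cat_nat (leq0n _) kD) /= coefD.
rewrite [X in _ = _ + X](_ : _ = 0) ?addr0; last first.
  rewrite coef_sum big_nat; apply: big1 => j /andP[kj _].
  by rewrite /texp_term coefCM coef_xi_lt // mulr0.
rewrite big_mkord !coef_sum; apply: eq_bigr => j _.
by rewrite /texp_term /= coefZ coefCM.
Qed.

Lemma sigma_poly_wge k : wge k (sigma_poly K N k).
Proof.
rewrite (@sigma_poly_expxi k.+1) //; apply: weighted_wge => //.
exact: weighted_expxi.
Qed.

Variables (D : nat) (m : 'X_{1..N}).
Hypothesis mD : (mnmwgt m <= D)%N.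

Definition summand lam := frame_minor f lam * (schur_weierstrass K N lam)@_m.

(** The last row of the minor belongs to a zero part and consists of the [al c 0], which are 0. With
    [frame_minor_long], only partitions with exactly [g] parts contribute. *)
Lemma summand_short lam : (size lam < g)%N -> summand lam = 0.
Proof.
move=> sl; rewrite /summand frame_minor_short ?(ltnW sl) //.
have lt : (g.-1 < g)%N by lia.
rewrite (@det_row0 _ _ _ (Ordinal lt)) ?mul0r // => c; rewrite mxE nth_default /=; last by lia.
by rewrite (_ : _ + _ = 0)%N //; lia.
Qed.

(** The first row of the Schur determinant consists of [sigma_k] with [k > D], of weight more than
    [D]. *)
Lemma summand_heavy lam : (0 < size lam)%N -> (D < nth 0 lam 0)%N -> summand lam = 0.
Proof.
move=> s0 Dl; rewrite /summand (schur_det (erefl _)).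
have E : wge D.+1 (\det (\matrix_(i < size lam, j < size lam) sg (nth 0%N lam i + rev_ord i) (rev_ord j))).
  apply: (@wge_det_row _ _ _ _ _ (Ordinal s0)) => j; rewrite mxE /sg; case: ifP => _; last exact: wge0.
  apply: wgeW (@sigma_poly_wge _); rewrite /=; have := ltn_ord j; lia.
by rewrite E ?mulr0 // ltnS.
Qed.

Let L := (D + g)%N.

(** The values of an increasing [h] are the numbers [lam_i + g - i] (parts counted from 1), which
    encode a partition with at most [g] parts; parts at most [D] keep them below [L = D + g]. *)
Definition lam_of (h : {ffun 'I_g -> 'I_L}) : seq nat :=
  mkseq (fun i => if insub i is Some i' then (h (rev_ord i') - rev_ord i')%N else 0%N) g.

Lemma size_lam_of h : size (lam_of h) = g.
Proof. exact: size_mkseq. Qed.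

Lemma nth_lam_of h (i : 'I_g) : nth 0%N (lam_of h) i = (h (rev_ord i) - rev_ord i)%N.
Proof. by rewrite nth_mkseq // insubT // => ig; rewrite (_ : Sub _ _ = i) //; apply/val_inj. Qed.

Lemma increasing_ge (h : {ffun 'I_g -> 'I_L}) : increasing h -> forall i : 'I_g, (i <= h i)%N.
Proof.
move=> /increasingP hi [i]; elim: i => // i IH ig.
by apply: leq_ltn_trans (IH (ltnW ig)) _; apply: hi.
Qed.

Lemma increasing_gap (h : {ffun 'I_g -> 'I_L}) : increasing h ->
  forall (k : nat) (i j : 'I_g), (j = i + k :> nat)%N -> (h i + k <= h j)%N.
Proof.
move=> /increasingP hi; elim=> [|k IH] i j jE.
  by rewrite addn0 (_ : i = j) //; apply/val_inj; rewrite /= jE addn0.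
have lt : (j.-1 < g)%N by have := ltn_ord j; lia.
have := IH i (Ordinal lt); have := hi (Ordinal lt) j; rewrite /=.
have j1 : (j.-1 < j)%N by lia.
have j2 : (j.-1 = i + k)%N by lia.
by move=> /(_ j1) + /(_ j2); lia.
Qed.

Lemma lam_ofE h (i : 'I_g) : increasing h -> (nth 0%N (lam_of h) i + rev_ord i = h (rev_ord i))%N.
Proof. by move=> hi; rewrite nth_lam_of subnK // increasing_ge. Qed.

Lemma lam_of_inj : {in [pred h | increasing h] &, injective lam_of}.
Proof.
move=> h h'; rewrite !inE => hi hi' E; apply/ffunP => i; apply/val_inj.
by rewrite /= -[i]rev_ordK -!lam_ofE // E.
Qed.

(** Excluding the value 0 makes the last part positive. *)
Definition admissible (h : {ffun 'I_g -> 'I_L}) := increasing h && [forall i, h i != 0%N :> nat].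

Lemma lam_of_partition h : admissible h -> is_partition (lam_of h).
Proof.
case/andP => hi /forallP h0; apply/andP; split.
  apply/(sortedP 0%N) => i; rewrite size_lam_of => ig.
  have ig' : (i < g)%N by lia.
  have e1 := nth_lam_of h (Ordinal ig'); have e2 := nth_lam_of h (Ordinal ig).
  rewrite /= in e1 e2; rewrite /geq /= e1 e2.
  have lt : (rev_ord (Ordinal ig) < rev_ord (Ordinal ig'))%N by rewrite /=; lia.
  by move/increasingP: (hi) => /(_ _ _ lt) /=; lia.
apply/negP => /(nthP 0%N)[i]; rewrite size_lam_of => ig E.
have E' : h (rev_ord (Ordinal ig)) = rev_ord (Ordinal ig) :> nat.
  by have := lam_ofE (Ordinal ig) hi; rewrite /= E add0n => <-.
have g0 : (0 < g)%N by lia.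
have := increasing_gap hi (k := rev_ord (Ordinal ig)) (i := Ordinal g0) erefl.
by rewrite E'; have := h0 (Ordinal g0); lia.
Qed.

Lemma lam_of_surj lam : is_partition lam -> summand lam != 0 ->
  exists2 h, admissible h & lam_of h = lam.
Proof.
case/andP => srt l0 nz.
have sl : size lam = g.
  apply/eqP; rewrite eqn_leq; apply/andP; split; rewrite leqNgt; apply: contra nz => h; apply/eqP.
    by rewrite /summand frame_minor_long ?mul0r.
  exact: summand_short.
have anti i j : (i <= j)%N -> (j < g)%N -> (nth 0%N lam j <= nth 0%N lam i)%N.
  move=> ij jg; have := sorted_leq_nth (leT := geq) _ _ 0%N srt.
  move=> /(_ _ _ i j); apply => //; rewrite ?inE ?sl //.
  - by move=> x y z yx zy; rewrite /geq /= in yx zy *; lia.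
  - by move=> x; rewrite /geq /=.
  - by lia.
have lD i : (i < g)%N -> (nth 0%N lam i <= D)%N.
  move=> ig; apply: leq_trans (anti 0%N i _ ig) _ => //.
  rewrite leqNgt; apply: contra nz => h; apply/eqP; apply: summand_heavy => //.
  by rewrite sl; lia.
have hlt (i : 'I_g) : (nth 0%N lam (rev_ord i) + i < L)%N.
  have := lD _ (ltn_ord (rev_ord i)); have := ltn_ord i; rewrite /L; lia.
pose h := [ffun i : 'I_g => Ordinal (hlt i)].
have hi : increasing h.
  apply/increasingP => i j ij; rewrite !ffunE /=.
  have := anti (rev_ord j) (rev_ord i); rewrite /=; have := ltn_ord i; have := ltn_ord j; lia.
exists h.
  rewrite /admissible hi; apply/forallP => i; rewrite ffunE /=.
  have n0 : (0 < nth 0%N lam (rev_ord i))%N.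
    by rewrite lt0n; apply: contraNneq l0 => <-; apply: mem_nth; rewrite sl ltn_ord.
  by rewrite -lt0n ltn_addr.
apply: (@eq_from_nth _ 0%N); first by rewrite size_lam_of.
move=> i; rewrite size_lam_of => ig.
rewrite -[i]/(nat_of_ord (Ordinal ig)) nth_lam_of ffunE /=.
by rewrite (_ : (g - (g - i.+1).+1) = i)%N; lia.
Qed.

Lemma tau_sum : tau f N m = \sum_(h : {ffun 'I_g -> 'I_L} | admissible h) summand (lam_of h).
Proof.
pose r := [seq lam_of h | h <- enum [pred h | admissible h]].
have ur : uniq r.
  rewrite map_inj_in_uniq ?enum_uniq // => h h'; rewrite !mem_enum !inE => /andP[hi _] /andP[hi' _].
  exact: lam_of_inj.
transitivity (\sum_(lam <- r) summand lam); last first.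
  by rewrite big_map big_enum.
rewrite fsbig_seq //; apply/esym/fsbig_widen => lam /=.
  by case/mapP => h; rewrite mem_enum inE => ah ->; apply: lam_of_partition.
case=> pl nr; apply/eqP; apply: contraT => /(lam_of_surj pl)[h ah E].
by case: nr; rewrite -E; apply: map_f; rewrite mem_enum inE.
Qed.

(** Cauchy-Binet: the minors of [A] and [R] are the two factors of the summand of [lam_of h]. Maps
    with the value 0 contribute nothing since [al c 0 = 0]. *)
Theorem tau_det : tau f N m =
  (\det (\matrix_(c < g, j < g) \sum_(l < L) al c l *: sg l (rev_ord j)))@_m.
Proof.
pose A : 'M[{mpoly K[N]}]_(g, L) := \matrix_(c, l) (al c l)%:MP.
pose R : 'M[{mpoly K[N]}]_(L, g) := \matrix_(l, j) sg l (rev_ord j).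
have -> : \matrix_(c < g, j < g) \sum_(l < L) al c l *: sg l (rev_ord j) = A *m R.
  by apply/matrixP => c j; rewrite !mxE; apply: eq_bigr => l _; rewrite !mxE mul_mpolyC.
rewrite Cauchy_Binet raddf_sum /= tau_sum.
rewrite [RHS](bigID (fun h : {ffun 'I_g -> 'I_L} => [forall i, h i != 0%N :> nat])) /=.
rewrite [X in _ = _ + X]big1 ?addr0 => [|h /andP[_ /forallPn[i]]]; last first.
  rewrite negbK => /eqP hi0; rewrite (@det_col0 _ _ (colsub h A) i) ?mul0r ?mcoeff0 // => c.
  by rewrite !mxE hi0 al0 mpolyC0.
apply: eq_bigr => h /andP[hi _]; rewrite /summand frame_minor_short ?size_lam_of //.
rewrite (schur_det (size_lam_of h)).
(* Partitions list the rows in decreasing order, [h] in increasing order; the reversal occurs in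
   both determinants, so its sign cancels. *)
pose s : 'S_g := perm (@rev_ord_inj g).
have -> : \matrix_(r < g, c < g) al c (nth 0%N (lam_of h) r + rev_ord r) =
    row_perm s (\matrix_(r < g, c < g) al c (h r)).
  by apply/matrixP => r c; rewrite !mxE lam_ofE // permE.
have -> : \matrix_(i < g, j < g) sg (nth 0%N (lam_of h) i + rev_ord i) (rev_ord j) =
    row_perm s (rowsub h R).
  by apply/matrixP => i j; rewrite !mxE lam_ofE // permE.
rewrite !row_permE !det_mulmx !det_perm.
have -> : \det (colsub h A) = (\det (\matrix_(r < g, c < g) al c (h r)))%:MP.
  rewrite -[in RHS]det_tr -det_map_mx; congr (\det _).
  by apply/matrixP => c r; rewrite !mxE.
rewrite mcoeffCM -!mulrA mulrC -!mulrA; congr (_ * _).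
have -> : ((-1) ^+ s * \det (rowsub h R))@_m = (-1) ^+ s * (\det (rowsub h R))@_m.
  by rewrite !mulr_sign; case: (s : bool); rewrite ?mcoeffN.
by rewrite mulrAC -expr2 sqrr_sign mul1r.
Qed.

End Tau.

Section TauFrame.
Variables (K : numFieldType) (g d n : nat) (F : frame K g d n).

(** Up to weight [D], the entries in [tau_det] are the functionals [ell] applied to
    [v^j exp(sum_i x_i v^i)], and [det_expxi] evaluates their determinant. *)
Theorem tau_frame : exists I : {set 'I_d}, forall f : nat -> int -> K,
  (forall (c : 'I_g) (k : nat), frame_coef f (k%:Z - g%:Z) c = moment F c k) ->
  (forall c (i : int), (g <= c)%N -> frame_coef f i c = (i == - c.+1%:Z)%:R) ->
  forall N (m : 'X_{1..N}) D, (n <= D)%N -> (mnmwgt m < D)%N ->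
  tau f N m = (texp (@mpolyC N K) D (\sum_(x in I) xi_at N (F x)) *
    (Theta F \mPo [tuple lin_form F N c | c < g]))@_m.
Proof.
have [I HI] := det_expxi F; exists I => f f_lt f_ge N m D nD mD.
have D0 : (0 < D)%N by apply: leq_ltn_trans mD.
have := HI N D nD D0; rewrite Theta_comp => /(_ m mD).
rewrite (eq_thetaR _ _ (_ : tnth [tuple lin_form F N c | c < g] =1 lin_form F N)); last first.
  by move=> c; rewrite tnth_mktuple.
rewrite mcoeffB => /eqP; rewrite subr_eq0 => /eqP <-.
rewrite (@tau_det _ _ f _ f_lt f_ge (moment0 F) N D m (ltnW mD)).
apply/eqP; rewrite -subr_eq0 -mcoeffB; apply/eqP.
apply: (wge_detB _ mD) => c j; rewrite [X in wge _ (X - _)]mxE [X in wge _ (_ - X)]mxE.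
set P := 'X^(rev_ord j) * expxi K N D.
have sP : (size P <= maxn (size P) (D + g))%N by apply: leq_maxl.
rewrite (ell_poly_moment F c sP) -opprB; apply: wgeN.
rewrite -(big_mkord xpredT (fun l => moment F c l *: P`_l)).
rewrite -(big_mkord xpredT (fun l => moment F c l *: sg K N l (rev_ord j))).
rewrite (big_cat_nat (leq0n _) (leq_maxr (size P) (D + g))) /=.
have wP l : (D <= l - rev_ord j)%N -> wge D (expxi K N D)`_(l - rev_ord j).
  by move=> Dl; apply: weighted_wge Dl; apply: weighted_expxi.
(* For [l < D + g] the two summands differ only if [l - rev_ord j >= D], and for larger [l] this
   inequality always holds; in both cases the weight is at least [D]. *)
rewrite addrAC -sumrB; apply: wgeD.
  apply: wge_sum => l _; rewrite -scalerBr; apply: wgeZ; rewrite /P coefXnM /sg ltnNge.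
  case: leqP => /= [jl|_]; last by rewrite subrr; apply: wge0.
  have [lD|Dl] := ltnP (l - rev_ord j) D.
    by rewrite -sigma_poly_expxi // subrr; apply: wge0.
  apply: wgeD; first exact: wP.
  by apply: wgeN; apply: wgeW (@sigma_poly_wge _ _ _).
rewrite big_nat; apply: wge_sum => l /andP[Dl _]; apply: wgeZ; rewrite /P coefXnM.
by case: ifP => _; [exact: wge0|apply: wP; have := ltn_ord (rev_ord j); lia].
Qed.

End TauFrame.

(** * Laurent expansions of rational functions *)

Lemma subr_quotient (F : fieldType) (r x c q : F) : x != 0 -> q != 0 ->
  ((r * x + c * q) / q - c) / x = r / q.
Proof. by move=> x0 q0; rewrite [(_ + _ * _) / q]mulrDl mulfK // addrK mulrAC mulfK. Qed.

Section Ratfun.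
Variable K : fieldType.
Implicit Types (Q : proj_line K) (f h : ratfun K) (p q : {poly K}) (c : K).

Local Notation fr := (@tofrac {poly K}).

Lemma ratfun_repr f : exists p q, q != 0 /\ f = fr p / fr q.
Proof.
elim/quotW: f => x; exists (\n_x), (\d_x); have d0 := denom_ratioP x; split=> //.
apply: (canRL (mulfK _)); first by rewrite tofrac_eq0.
rewrite -[LHS]/(FracField.mul _ _) /tofrac; unlock FracField.tofrac.
rewrite -[LHS]FracField.pi_mul; apply/eqmodP; rewrite /= FracField.equivfE /FracField.mulf.
by rewrite !numden_Ratio ?mulf_neq0 ?oner_neq0 // !mulr1 mulrC.
Qed.

Lemma cst0 : cst (0 : K) = 0. Proof. by rewrite /cst polyC0 tofrac0. Qed.
Lemma cst1 : cst (1 : K) = 1. Proof. by rewrite /cst polyC1 tofrac1. Qed.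
Lemma cstD c c' : cst (c + c') = cst c + cst c'.
Proof. by rewrite /cst polyCD tofracD. Qed.
Lemma cstN c : cst (- c) = - cst c.
Proof. by rewrite /cst polyCN tofracN. Qed.
Lemma cstM c c' : cst (c * c') = cst c * cst c'.
Proof. by rewrite /cst polyCM tofracM. Qed.

Lemma coord_v_neq0 : coord_v != 0 :> ratfun K.
Proof. by rewrite tofrac_eq0 polyX_eq0. Qed.

Lemma uniformizerE a : uniformizer (Some a) = fr ('X - a%:P).
Proof. by rewrite tofracB. Qed.

Lemma uniformizer_neq0 Q : uniformizer Q != 0.
Proof.
case: Q => [a|] /=; last by rewrite invr_eq0 coord_v_neq0.
by rewrite -[_ - _]/(uniformizer (Some a)) uniformizerE tofrac_eq0 polyXsubC_eq0.
Qed.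

Local Notation reg Q := (regular_at Q).

Lemma regular_cst Q c : reg Q (cst c).
Proof.
exists c%:P, 1; rewrite oner_neq0 tofrac1 divr1; split => //.
by case: Q => [a|]; rewrite ?hornerC ?oner_neq0 // size_poly1 size_polyC_leq1.
Qed.

Lemma regularM Q f h : reg Q f -> reg Q h -> reg Q (f * h).
Proof.
move=> [p [q [q0 -> pq]]] [p' [q' [q0' -> pq']]].
exists (p * p'), (q * q'); split; first by rewrite mulf_neq0.
  by rewrite !tofracM invfM mulrACA.
case: Q pq pq' => [a|]; first by rewrite hornerM => ? ?; rewrite mulf_neq0.
move=> s s'; have [->|p0] := eqVneq p 0; first by rewrite mul0r size_poly0.
have [->|p0'] := eqVneq p' 0; first by rewrite mulr0 size_poly0.
by rewrite !size_mul // -!subn1 leq_sub2r // leq_add.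
Qed.

Lemma regularD Q f h : reg Q f -> reg Q h -> reg Q (f + h).
Proof.
move=> [p [q [q0 -> pq]]] [p' [q' [q0' -> pq']]].
exists (p * q' + p' * q), (q * q'); split; first by rewrite mulf_neq0.
  by rewrite tofracD !tofracM addf_div // tofrac_eq0.
case: Q pq pq' => [a|]; first by rewrite hornerM => ? ?; rewrite mulf_neq0.
move=> s s'; rewrite (leq_trans (size_polyD _ _)) // geq_max; apply/andP; split.
  have [->|p0] := eqVneq p 0; first by rewrite mul0r size_poly0.
  by rewrite !size_mul // -!subn1 leq_sub2r // leq_add.
have [->|p0] := eqVneq p' 0; first by rewrite mul0r size_poly0.
by rewrite !size_mul // -!subn1 leq_sub2r // [leqRHS]addnC leq_add.
Qed.

Lemma regularN Q f : reg Q f -> reg Q (- f).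
Proof. by move=> fr; rewrite -mulN1r -cst1 -cstN; apply: regularM => //; apply: regular_cst. Qed.

Lemma regularB Q f h : reg Q f -> reg Q h -> reg Q (f - h).
Proof. by move=> rf rh; apply: regularD => //; apply: regularN. Qed.

Lemma regular0 Q : reg Q 0.
Proof. by rewrite -cst0; apply: regular_cst. Qed.

Lemma regular_sum Q (J : Type) (r : seq J) (P : pred J) (G : J -> ratfun K) :
  (forall j, P j -> reg Q (G j)) -> reg Q (\sum_(j <- r | P j) G j).
Proof. by move=> h; elim/big_ind: _ => //; [exact: regular0|move=> *; exact: regularD]. Qed.

Lemma regular_poly a p : reg (Some a) (fr p).
Proof. by exists p, 1; rewrite oner_neq0 tofrac1 divr1 hornerC oner_neq0. Qed.

Lemma regular_uniformizer Q : reg Q (uniformizer Q).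
Proof.
case: Q => [a|]; first by rewrite uniformizerE; apply: regular_poly.
exists 1, 'X; rewrite polyX_eq0 tofrac1 div1r; split=> //.
by rewrite size_poly1 size_polyX.
Qed.

Lemma regularX Q f k : reg Q f -> reg Q (f ^+ k).
Proof.
move=> rf; elim: k => [|k IH]; first by rewrite expr0 -cst1; apply: regular_cst.
by rewrite exprS; apply: regularM.
Qed.

Local Notation unif Q := (uniformizer Q).
Lemma ord_geM Q (k l : int) f h : ord_ge Q k f -> ord_ge Q l h -> ord_ge Q (k + l) (f * h).
Proof.
move=> rf rh; rewrite /ord_ge opprD expfzDr ?uniformizer_neq0 // mulrACA.
exact: regularM.
Qed.

Lemma ord_geD Q (k : int) f h : ord_ge Q k f -> ord_ge Q k h -> ord_ge Q k (f + h).
Proof. by move=> rf rh; rewrite /ord_ge mulrDl; apply: regularD. Qed.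

Lemma ord_geN Q (k : int) f : ord_ge Q k f -> ord_ge Q k (- f).
Proof. by move=> rf; rewrite /ord_ge mulNr; apply: regularN. Qed.

Lemma ord_ge0E Q f : ord_ge Q 0 f <-> reg Q f.
Proof. by rewrite /ord_ge oppr0 expr0z mulr1. Qed.

Lemma ord_ge_unif Q (k : int) : ord_ge Q k (unif Q ^ k).
Proof.
rewrite /ord_ge -expfzDr ?uniformizer_neq0 // subrr expr0z -cst1; exact: regular_cst.
Qed.

Lemma ord_ge_cst Q c : ord_ge Q 0 (cst c).
Proof. by apply/ord_ge0E/regular_cst. Qed.

Lemma ord_geW Q (k l : int) f : l <= k -> ord_ge Q k f -> ord_ge Q l f.
Proof.
move=> lk rf; have E : f * unif Q ^ (- l) = f * unif Q ^ (- k) * unif Q ^+ `|k - l|%N.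
  rewrite -mulrA exprnP -expfzDr ?uniformizer_neq0 //; congr (_ * _ ^ _); lia.
by rewrite /ord_ge E; apply: regularM => //; apply: regularX; apply: regular_uniformizer.
Qed.

Lemma ord_ge_sum Q (k : int) (J : Type) (r : seq J) (P : pred J) (G : J -> ratfun K) :
  (forall j, P j -> ord_ge Q k (G j)) -> ord_ge Q k (\sum_(j <- r | P j) G j).
Proof.
move=> h; elim/big_ind: _ => //; last by move=> *; apply: ord_geD.
by rewrite /ord_ge mul0r; apply: regular0.
Qed.

Lemma ord_ge1_cst Q c : ord_ge Q 1 (cst c) -> c = 0.
Proof.
rewrite /ord_ge; case: Q => [a|] [p [q [q0]]].
  rewrite uniformizerE exprN1 => E qa; apply/eqP; apply: contraT => c0.
  have q0' : fr q != 0 by rewrite tofrac_eq0.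
  have x0 : fr ('X - a%:P) != 0 by rewrite tofrac_eq0 polyXsubC_eq0.
  have : fr (c%:P * q) = fr (p * ('X - a%:P)).
    rewrite !tofracM -[fr p](mulfVK q0') -E -[fr c%:P]/(cst c).
    by rewrite mulrAC mulfVK.
  move/eqP; rewrite tofrac_eq => /eqP /(congr1 (horner^~ a)).
  rewrite !hornerM hornerC hornerXsubC subrr mulr0 => /eqP.
  by rewrite mulf_eq0 (negbTE c0) (negbTE qa).
rewrite /= exprN1 invrK => E pq; apply/eqP; apply: contraT => c0.
have q0' : fr q != 0 by rewrite tofrac_eq0.
have : fr (c%:P * 'X * q) = fr p.
  by rewrite !tofracM -[fr p](mulfVK q0') -E.
move/eqP; rewrite tofrac_eq => /eqP E'; move: pq.
rewrite -E' -mulrA mul_polyC size_scale // mulrC size_mulX // ltnn //.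
Qed.

Lemma regular_value Q f : reg Q f -> exists c, ord_ge Q 1 (f - cst c).
Proof.
move=> [p [q [q0 -> pq]]]; have q0' : fr q != 0 by rewrite tofrac_eq0.
case: Q pq => [a|] pq.
  exists (p.[a] / q.[a]); have : root (p - (p.[a] / q.[a])%:P * q) a.
    by rewrite rootE !hornerE mulfVK ?subrr.
  case/factor_theorem => r rE; exists r, q; split => //.
  rewrite exprN1 uniformizerE; have -> : fr p = fr (r * ('X - a%:P)) + cst (p.[a] / q.[a]) * fr q.
    by rewrite -rE tofracB tofracM subrK.
  have x0 : fr ('X - a%:P) != 0 by rewrite tofrac_eq0 polyXsubC_eq0.
  by rewrite tofracM; exact: (subr_quotient _ _ x0 q0').
pose c := p`_(size q).-1 / lead_coef q; exists c.
exists ((p - c *: q) * 'X), q; split => //.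
  rewrite exprN1 invrK tofracM tofracB -mul_polyC tofracM -[fr c%:P]/(cst c).
  by rewrite [RHS]mulrAC [(_ - _ * _) / _]mulrBl (mulfK q0').
have [->|r0] := eqVneq (p - c *: q) 0; first by rewrite mul0r size_poly0.
rewrite size_mulX //; apply: leq_trans (_ : (size q).-1.+1 <= _)%N; last first.
  by rewrite prednK // size_poly_gt0.
rewrite ltnS; apply/leq_sizeP => j; rewrite leq_eqVlt => /predU1P[<-|qj].
  by rewrite coefB coefZ -lead_coefE /c divfK ?subrr // lead_coef_eq0.
have qj' : (size q <= j)%N by move: qj; rewrite -size_poly_gt0 in q0; lia.
by rewrite coefB coefZ !nth_default ?mulr0 ?subrr // (leq_trans pq).
Qed.

Definition psum Q (s : int -> K) (N : int) n := \sum_(i < n) cst (s (N + i%:Z)) * unif Q ^ (N + i%:Z).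

(** The starting index may be lowered, so two series can be given a common start. *)
Lemma is_laurent_lower Q f s (N N' : int) : N' <= N -> (forall i, i < N -> s i = 0) ->
  (forall n : nat, ord_ge Q (N + n%:Z) (f - psum Q s N n)) ->
  forall n : nat, ord_ge Q (N' + n%:Z) (f - psum Q s N' n).
Proof.
move=> NN s0 h n.
have psum_cat k l : psum Q s N' (k + l) = psum Q s N' k + psum Q s (N' + k%:Z) l.
  rewrite /psum big_split_ord /=; congr (_ + _); apply: eq_bigr => i _.
  by rewrite PoszD addrA.
pose k := `|N - N'|%N; have kE : N' + k%:Z = N by rewrite /k; lia.
have p0 l : (l <= k)%N -> psum Q s N' l = 0.
  move=> lk; apply: big1 => i _; rewrite s0 ?cst0 ?mul0r //; have := ltn_ord i; lia.
have [nk|kn] := leqP n k.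
  rewrite p0 // subr0; have := h 0%N; rewrite /psum big_ord0 [f - 0]subr0.
  by apply: ord_geW; lia.
rewrite -(subnKC (ltnW kn)) psum_cat p0 // add0r kE.
by apply: ord_geW (h (n - k)%N); lia.
Qed.

Lemma is_laurent_common Q f g s s' : is_laurent Q f s -> is_laurent Q g s' ->
  exists N : int, [/\ forall i, i < N -> s i = 0, forall i, i < N -> s' i = 0,
    forall n : nat, ord_ge Q (N + n%:Z) (f - psum Q s N n) &
    forall n : nat, ord_ge Q (N + n%:Z) (g - psum Q s' N n)].
Proof.
move=> [N [s0 h]] [N' [s0' h']]; exists (Num.min N N').
have m1 : Num.min N N' <= N by rewrite ge_min lexx.
have m2 : Num.min N N' <= N' by rewrite ge_min lexx orbT.
split.
- by move=> i iN; apply: s0; apply: lt_le_trans m1.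
- by move=> i iN; apply: s0'; apply: lt_le_trans m2.
- exact: is_laurent_lower m1 s0 h.
- exact: is_laurent_lower m2 s0' h'.
Qed.

Lemma is_laurentD Q f g s s' : is_laurent Q f s -> is_laurent Q g s' ->
  is_laurent Q (f + g) (fun i => s i + s' i).
Proof.
move=> hf hg; have [N [s0 s0' h h']] := is_laurent_common hf hg.
exists N; split => [i iN|n]; first by rewrite s0 ?s0' ?addr0.
have -> : f + g - \sum_(i < n) cst (s (N + i%:Z) + s' (N + i%:Z)) * unif Q ^ (N + i%:Z) =
   (f - psum Q s N n) + (g - psum Q s' N n).
  rewrite addrACA -opprD -big_split; congr (_ - _); apply: eq_bigr => i _ /=.
  by rewrite cstD mulrDl.
exact: ord_geD.
Qed.

Lemma is_laurentZ Q f s c : is_laurent Q f s -> is_laurent Q (cst c * f) (fun i => c * s i).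
Proof.
move=> [N [s0 h]]; exists N; split => [i iN|n]; first by rewrite s0 ?mulr0.
have -> : cst c * f - \sum_(i < n) cst (c * s (N + i%:Z)) * unif Q ^ (N + i%:Z) =
   cst c * (f - psum Q s N n).
  rewrite mulrBr mulr_sumr; congr (_ - _); apply: eq_bigr => i _.
  by rewrite cstM mulrA.
by rewrite -[N + n%:Z]add0r; apply: ord_geM => //; apply: ord_ge_cst.
Qed.

Lemma is_laurent_shift Q f s (k : int) : is_laurent Q f s ->
  is_laurent Q (unif Q ^ k * f) (fun i => s (i - k)).
Proof.
move=> [N [s0 h]]; exists (N + k); split => [i iN|n]; first by rewrite s0 //; lia.
have -> : unif Q ^ k * f - \sum_(i < n) cst (s (N + k + i%:Z - k)) * unif Q ^ (N + k + i%:Z) =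
   unif Q ^ k * (f - psum Q s N n).
  rewrite mulrBr mulr_sumr; congr (_ - _); apply: eq_bigr => i _.
  have -> : N + k + i%:Z = k + (N + i%:Z) by lia.
  by rewrite (expfzDr _ _ (uniformizer_neq0 Q)) mulrCA; congr (_ * (cst (s _) * _)); lia.
have -> : N + k + n%:Z = k + (N + n%:Z) by lia.
by apply: ord_geM => //; apply: ord_ge_unif.
Qed.

Lemma is_laurent_unique0 Q s : is_laurent Q 0 s -> forall i, s i = 0.
Proof.
move=> [N [s0 h]]; suff H (k : nat) : s (N + k%:Z) = 0.
  move=> i; have [/s0 //|Ni] := ltP i N.
  by have -> : i = N + `|i - N|%N%:Z by lia.
elim/ltn_ind: k => k IH; have := h k.+1; rewrite sub0r big_ord_recr /= big1 => [|i _]; last first.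
  by rewrite IH ?cst0 ?mul0r.
rewrite add0r => /ord_geN; rewrite opprK => H.
apply: (@ord_ge1_cst Q).
have := ord_geM H (ord_ge_unif Q (- (N + k%:Z))).
rewrite -mulrA -expfzDr ?uniformizer_neq0 // subrr expr0z mulr1.
by apply: ord_geW; lia.
Qed.

Lemma is_laurent_unique Q f s s' : is_laurent Q f s -> is_laurent Q f s' -> s = s'.
Proof.
move=> h /(is_laurentZ (-1)) h'; have := is_laurentD h h'.
rewrite cstN cst1 mulN1r subrr => /is_laurent_unique0 H; apply/funext => i.
by apply/eqP; rewrite -subr_eq0 -mulN1r H.
Qed.

(** The coefficients arise by repeatedly subtracting the value and dividing by the uniformizer. *)
Lemma is_laurent_regular Q f : reg Q f -> exists2 s, is_laurent Q f s & forall i, i < 0 -> s i = 0.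
Proof.
move=> rf; pose val h := xget 0 [set c | ord_ge Q 1 (h - cst c)].
pose nxt h := (h - cst (val h)) * unif Q ^ (-1).
have valP h : reg Q h -> ord_ge Q 1 (h - cst (val h)).
  by move=> /regular_value[c hc]; rewrite /val; case: xgetP => [? _ //|/(_ c)].
have nP n : reg Q (iter n nxt f) by elim: n => // n IH; apply: valP.
have E n : f = \sum_(i < n) cst (val (iter i nxt f)) * unif Q ^ (0 + i%:Z) + iter n nxt f * unif Q ^ n%:Z.
  elim: n => [|n IH]; first by rewrite big_ord0 add0r expr0z mulr1.
  rewrite {1}IH big_ord_recr -addrA; congr (_ + _); rewrite /= /nxt -mulrA -expfzDr ?uniformizer_neq0 //.
  by rewrite (_ : -1 + n.+1%:Z = n) ?add0r ?mulrBl ?subrKC //; lia.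
exists (fun i => if 0 <= i then val (iter `|i|%N nxt f) else 0) => [|i]; last by rewrite ltNge => /negbTE ->.
exists 0; split => [i|n]; first by rewrite ltNge => /negbTE ->.
rewrite {1}(E n) addrAC.
under [X in _ - X + _]eq_bigr => i _ do rewrite add0r /=.
under [X in X - _ + _]eq_bigr => i _ do rewrite add0r /=.
rewrite subrr add0r mulrC; have := ord_geM (ord_ge_unif Q n%:Z) (iffRL (ord_ge0E Q _) (nP n)).
by rewrite addr0 add0r.
Qed.

Lemma ratfun_pole Q f : exists k : nat, reg Q (unif Q ^+ k * f).
Proof.
have [p [q [q0 ->]]] := ratfun_repr f.
case: Q => [a|].
  have [k [r ra qE]] := multiplicity_XsubC q a; rewrite q0 /= in ra.
  exists k; exists p, r; split=> //; first by apply: contraNneq ra => ->; rewrite root0.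
  rewrite mulrCA; congr (fr p * _).
  have -> : fr q = fr r * unif (Some a) ^+ k by rewrite qE tofracM tofracXn uniformizerE.
  by rewrite invfM mulrCA mulfV ?mulr1 // expf_neq0 // uniformizer_neq0.
exists (size p); exists p, ('X^(size p) * q); split.
- by rewrite mulf_neq0 // expf_neq0 // polyX_eq0.
- by rewrite tofracM tofracXn /= exprVn invfM mulrCA.
- by rewrite mulrC size_mulXn // leq_addr.
Qed.

Lemma is_laurent_exists Q f : exists s, is_laurent Q f s.
Proof.
have [k /is_laurent_regular[s hs _]] := ratfun_pole Q f.
have := is_laurent_shift (- k%:Z) hs; rewrite exprnP mulrA -expfzDr ?uniformizer_neq0 //.
by rewrite addNr expr0z mul1r => h; exists (fun i => s (i - - k%:Z)).
Qed.

Lemma laurentP Q f : is_laurent Q f (laurent Q f).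
Proof. by rewrite /laurent; case: xgetP => // /(_ _) H; have [s /H] := is_laurent_exists Q f. Qed.

Lemma laurentE Q f s : is_laurent Q f s -> laurent Q f = s.
Proof. exact: is_laurent_unique (laurentP Q f). Qed.

Lemma laurentD Q f g i : laurent Q (f + g) i = laurent Q f i + laurent Q g i.
Proof. by rewrite (laurentE (is_laurentD (laurentP Q f) (laurentP Q g))). Qed.

Lemma laurentZ Q c f i : laurent Q (cst c * f) i = c * laurent Q f i.
Proof. by rewrite (laurentE (is_laurentZ c (laurentP Q f))). Qed.

Lemma laurentN Q f i : laurent Q (- f) i = - laurent Q f i.
Proof. by rewrite -mulN1r -cst1 -cstN laurentZ mulN1r. Qed.

Lemma laurentB Q f g i : laurent Q (f - g) i = laurent Q f i - laurent Q g i.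
Proof. by rewrite laurentD laurentN. Qed.

Lemma laurent0 Q i : laurent Q 0 i = 0.
Proof. by rewrite -(mul0r 0) -{1}cst0 laurentZ mul0r. Qed.

Lemma laurent_sum Q (J : Type) (r : seq J) (P : pred J) (G : J -> ratfun K) i :
  laurent Q (\sum_(j <- r | P j) G j) i = \sum_(j <- r | P j) laurent Q (G j) i.
Proof. by apply: (big_morph (laurent Q ^~ i)) => [f g|]; rewrite ?laurentD ?laurent0. Qed.

Lemma laurent_shift Q (k : int) f i : laurent Q (unif Q ^ k * f) i = laurent Q f (i - k).
Proof. by rewrite (laurentE (is_laurent_shift k (laurentP Q f))). Qed.

Lemma laurent_ord_ge Q (k : int) f i : ord_ge Q k f -> i < k -> laurent Q f i = 0.
Proof.
move=> /is_laurent_regular[s hs s0] ik.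
have -> : f = unif Q ^ k * (f * unif Q ^ (- k)).
  by rewrite mulrC -mulrA -expfzDr ?uniformizer_neq0 // addNr expr0z mulr1.
by rewrite laurent_shift (laurentE hs) s0 // subr_lt0.
Qed.

Lemma ord_ge_laurent Q (k : int) f : (forall i, i < k -> laurent Q f i = 0) -> ord_ge Q k f.
Proof.
move=> h; have [N [s0 hN]] := laurentP Q f.
have NN : Num.min N k <= N by rewrite ge_min lexx.
have := is_laurent_lower NN s0 hN `|k - Num.min N k|%N.
have mk : Num.min N k <= k by rewrite ge_min lexx orbT.
rewrite /psum big1 => [|i _]; last by rewrite h ?cst0 ?mul0r //; have := ltn_ord i; lia.
by rewrite subr0; apply: ord_geW; lia.
Qed.

Lemma laurent_cst Q c i : laurent Q (cst c) i = if i == 0 then c else 0.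
Proof.
rewrite (@laurentE Q (cst c) (fun i => if i == 0 then c else 0)) //.
exists 0; split => [j|[|k]]; first by case: eqP => // ->; rewrite ltxx.
  by rewrite big_ord0; have := ord_ge_cst Q c; rewrite -{1}[cst c]subr0.
rewrite big_ord_recl [X in _ - (_ + X)]big1 => [|j _]; last first.
  by rewrite add0r (_ : (_ == 0) = false) // cst0 mul0r.
rewrite [X in _ - X]addr0 (_ : 0 + Posz ord0 = 0) // eqxx expr0z mulr1 subrr /ord_ge mul0r.
exact: regular0.
Qed.

Lemma laurent_value Q f c : ord_ge Q 1 (f - cst c) -> laurent Q f 0 = c.
Proof.
move=> h; rewrite -[f](subrK (cst c)) laurentD (laurent_ord_ge h) // add0r laurent_cst //.
Qed.

Lemma value_frac a p q : q.[a] != 0 -> laurent (Some a) (fr p / fr q) 0 = p.[a] / q.[a].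
Proof.
move=> qa; have q0 : q != 0 by apply: contraNneq qa => ->; rewrite horner0.
have q0' : fr q != 0 by rewrite tofrac_eq0.
apply: laurent_value.
have : root (p - (p.[a] / q.[a])%:P * q) a by rewrite rootE !hornerE mulfVK ?subrr.
case/factor_theorem => r rE; exists r, q; split => //.
rewrite exprN1 uniformizerE; have -> : fr p = fr (r * ('X - a%:P)) + cst (p.[a] / q.[a]) * fr q.
  by rewrite -rE tofracB tofracM subrK.
have x0 : fr ('X - a%:P) != 0 by rewrite tofrac_eq0 polyXsubC_eq0.
by rewrite tofracM; exact: (subr_quotient _ _ x0 q0').
Qed.

Lemma laurent_unif Q (k i : int) : laurent Q (unif Q ^ k) i = if i == k then 1 else 0.
Proof.
by rewrite -[_ ^ _]mulr1 -cst1 laurent_shift laurent_cst subr_eq0.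
Qed.

End Ratfun.

(** * Polar parts *)

Section PolarParts.
Variable K : numFieldType.
Implicit Types (a : K) (p q : {poly K}).

Local Notation fr := (@tofrac {poly K}).
Local Notation unif Q := (uniformizer Q).

Lemma unif_exprE a (k : nat) : unif (Some a) ^+ k = fr (('X - a%:P) ^+ k).
Proof. by rewrite uniformizerE tofracXn. Qed.

Lemma ord_ge_tay a N p : (forall k, (k < N)%N -> tay a k p = 0) -> ord_ge (Some a) N%:Z (fr p).
Proof.
move=> /tay_dvdp/dvdpP[q ->]; rewrite tofracM -unif_exprE mulrC -[N%:Z]addr0.
by apply: ord_geM; [exact: ord_ge_unif|apply/ord_ge0E/regular_poly].
Qed.

Lemma tay_Xsub a k j : tay a k (('X - a%:P) ^+ j) = (k == j)%:R.
Proof.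
rewrite -[_ ^+ _]mulr1 tay_mul_exp -[1]/(1%:P) tayC; case: ltngtP => // [jk|->].
  by rewrite subn_eq0 leqNgt jk.
by rewrite subnn.
Qed.

Lemma laurent_tay a p (i : nat) : laurent (Some a) (fr p) i%:Z = tay a i p.
Proof.
pose q := \sum_(j < i.+1) tay a j p *: ('X - a%:P) ^+ j.
have tq k : (k < i.+1)%N -> tay a k q = tay a k p.
  move=> ki; rewrite tay_sum (bigD1 (Ordinal ki)) //= big1 ?addr0 => [|j jk].
    by rewrite tayZ tay_Xsub eqxx mulr1.
  rewrite tayZ tay_Xsub (_ : (k == j) = false) ?mulr0 //.
  by apply: contraNF jk => /eqP kj; apply/eqP/val_inj.
have -> : fr p = fr (p - q) + fr q by rewrite tofracB subrK.
rewrite laurentD (@laurent_ord_ge _ _ i.+1) ?ltz_nat //; last first.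
  by apply: ord_ge_tay => k /tq; rewrite tayB => ->; rewrite subrr.
rewrite add0r /q raddf_sum laurent_sum (bigD1 (@ord_max i)) //= big1 => [|j ji].
  rewrite -mul_polyC tofracM -unif_exprE laurentZ exprnP laurent_unif eqxx mulr1 addr0 //.
rewrite -mul_polyC tofracM -unif_exprE laurentZ exprnP laurent_unif ifF ?mulr0 //.
by apply: contraNF ji => /eqP [ij]; apply/eqP/val_inj.
Qed.

Lemma regular_unifV a b (k : nat) : a != b -> regular_at (Some a) (unif (Some b) ^ (- k%:Z)).
Proof.
move=> ab; exists 1, (('X - b%:P) ^+ k); split.
- by rewrite expf_neq0 // polyXsubC_eq0.
- by rewrite -exprnN unif_exprE tofrac1 div1r.
- by rewrite horner_exp hornerXsubC expf_neq0 // subr_eq0.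
Qed.

Variables (d n : nat) (S : sites K d n).
Implicit Types b : 'I_d -> K.

(* The form [polar b dv] is the one against which the functional
   [p |-> \sum_x b x * nu p x] is minus the sum of the residues. *)
Definition polar b : ratfun K :=
  - \sum_x cst (b x) * unif (Some (S x)) ^ (- (lev S x).+1%:Z).

Lemma polar_sum g (c : 'I_g -> K) (L : 'I_g -> 'I_d -> K) :
  polar (fun x => \sum_j c j * L j x) = \sum_j cst (c j) * polar (L j).
Proof.
rewrite /polar -sumrN; under [RHS]eq_bigr => j _ do rewrite -sumrN mulr_sumr.
rewrite [RHS]exchange_big; apply: eq_bigr => x _ /=.
have -> : cst (\sum_j c j * L j x) = \sum_j cst (c j) * cst (L j x).
  by rewrite (big_morph (@cst K) (@cstD K) (@cst0 K)); apply: eq_bigr => j _; rewrite cstM.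
by rewrite mulr_suml -sumrN; apply: eq_bigr => j _; rewrite mulrN mulrA.
Qed.

Lemma regular_polar b a : (forall x, a != S x) -> regular_at (Some a) (polar b).
Proof.
move=> h; apply: regularN; apply: regular_sum => x _; apply: regularM.
  exact: regular_cst.
exact: regular_unifV.
Qed.

Lemma ord_ge_polar b a : ord_ge (Some a) (- n%:Z) (polar b).
Proof.
apply: ord_geN; apply: ord_ge_sum => x _; rewrite -[- n%:Z]add0r.
apply: ord_geM; first exact: ord_ge_cst.
have [->|aS] := eqVneq a (S x).
  by apply: ord_geW (ord_ge_unif _ _); have := lev_lt S x; lia.
by apply: (@ord_geW _ _ 0); [lia|apply/ord_ge0E/regular_unifV].
Qed.

Lemma residue_polar b a p :
  laurent (Some a) (fr p * polar b) (-1) = - \sum_(x | S x == a) b x * nu S idfun p x 0.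
Proof.
rewrite mulrN laurentN mulr_sumr laurent_sum (bigID (fun x => S x == a)) /=.
rewrite [X in _ + X]big1 ?addr0 => [|x xa]; last first.
  apply: (@laurent_ord_ge _ _ 0) => //; apply/ord_ge0E; apply: regularM.
    exact: regular_poly.
  by apply: regularM; [exact: regular_cst|apply: regular_unifV; rewrite eq_sym].
congr (- _); apply: eq_bigr => x /eqP <-.
rewrite mulrCA laurentZ [fr p * _]mulrC laurent_shift mxE /=; congr (_ * _).
have -> : -1 - (- (lev S x).+1%:Z) = (lev S x)%:Z by lia.
exact: laurent_tay.
Qed.

Lemma laurent_polar b x :
  laurent (Some (S x)) (polar b) (- (lev S x).+1%:Z) = - b x.
Proof.
have -> : - (lev S x).+1%:Z = -1 - (lev S x)%:Z by lia.
rewrite -laurent_shift -exprnP unif_exprE residue_polar (bigD1 x) //= big1 ?addr0 => [|y].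
  by rewrite mxE /= tay_Xsub eqxx mulr1.
case/andP => /eqP Syx yx; rewrite mxE /= Syx tay_Xsub (_ : (_ == _) = false) ?mulr0 //.
by apply: contraNF yx => /eqP l; apply/eqP; apply: (site_inj (s := S)).
Qed.

Lemma polar_inj b b' : polar b = polar b' -> b =1 b'.
Proof. by move=> E x; apply: oppr_inj; rewrite -!laurent_polar E. Qed.

(** As [dv = - v^2 du], the form [(v - a)^(-k-1) dv] is regular at infinity as soon as [k >= 1]. *)
Lemma regular_du_polar b : (forall x, lev S x = 0%N -> b x = 0) ->
  regular_at None (du_part (polar b)).
Proof.
move=> b0; rewrite /du_part mulrN mulNr opprK mulr_sumr; apply: regular_sum => x _.
have [l0|l0] := eqVneq (lev S x) 0%N; first by rewrite b0 // cst0 mul0r mulr0; exact: regular0.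
rewrite mulrCA; apply: regularM; first exact: regular_cst.
exists 'X^2, (('X - (S x)%:P) ^+ (lev S x).+1); split.
- by rewrite expf_neq0 // polyXsubC_eq0.
- by rewrite -exprnN unif_exprE /coord_v -[fr _ ^+ 2]tofracXn.
- by rewrite size_polyXn size_exp_XsubC !ltnS lt0n.
Qed.

End PolarParts.

(** * Forms determined by their polar parts *)

Section GlobalForms.
Variable K : numClosedFieldType.

Local Notation fr := (@tofrac {poly K}).

(** A root of the denominator is also a root of the numerator, as the function is regular there;
    cancel and repeat. *)
Lemma regular_everywhere_poly (f : ratfun K) :
  (forall a, regular_at (Some a) f) -> exists p, f = fr p.
Proof.
move=> fP; have [p [q [q0 fE]]] := ratfun_repr f.
elim: {q}(size q) {-2}q (leqnn (size q)) p q0 fE => [|m IH] q sq p q0 fE.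
  by rewrite leqn0 size_poly_eq0 (negbTE q0) in sq.
have [/eqP s1|s1] := eqVneq (size q) 1%N.
  have [c c0 qE] := size_poly1P _ s1; exists (c^-1 *: p).
  rewrite fE qE -mul_polyC tofracM mulrC; congr (_ * _).
  apply: (mulfI (x := fr c%:P)); first by rewrite tofrac_eq0 polyC_eq0.
  rewrite mulfV ?tofrac_eq0 ?polyC_eq0 // -tofracM -polyCM mulfV ?tofrac1 //.
have [a qa] := closed_rootP q s1; have [p' [q' [q0' fE' qa']]] := fP a.
have E : p * q' = p' * q.
  apply/eqP; rewrite -tofrac_eq !tofracM -(eqr_div _ _ (_ : fr q != 0) (_ : fr q' != 0)) ?tofrac_eq0 //.
  by rewrite -fE -fE'.
have pa : root p a.
  have := congr1 (horner^~ a) E; rewrite !hornerM (rootP qa) mulr0 => /eqP.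
  by rewrite mulf_eq0 (negbTE qa') orbF.
have [p1 pE] := factor_theorem _ _ pa; have [q1 qE] := factor_theorem _ _ qa.
have q10 : q1 != 0 by apply: contraNneq q0 => z; rewrite qE z mul0r.
have x0 : fr ('X - a%:P) != 0 by rewrite tofrac_eq0 polyXsubC_eq0.
apply: (IH q1 _ p1 q10); last by rewrite fE pE qE !tofracM -mulf_div divff // mulr1.
by move: sq; rewrite qE size_mul ?polyXsubC_eq0 // size_XsubC addn2 /= ltnS.
Qed.

Lemma regular_poly_oo (q : {poly K}) : regular_at None (fr q) -> (size q <= 1)%N.
Proof.
move=> [p1 [q1 [q0 E s]]]; have [->|qn] := eqVneq q 0; first by rewrite size_poly0.
have q0' : fr q1 != 0 by rewrite tofrac_eq0.
have : q * q1 = p1 by apply/eqP; rewrite -tofrac_eq tofracM E divfK.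
move=> pE; move: s q0; rewrite -pE size_mul //; last by rewrite -tofrac_eq0.
by rewrite -size_poly_gt0; move: (size q) (size q1) => a b; lia.
Qed.

Variables (d n : nat) (S : sites K d n).

(** Subtracting the polar parts leaves a polynomial [p]; regularity at infinity makes [v^2 p]
    regular there, so [p = 0]. *)
Lemma polar_form (h : ratfun K) :
  (forall a, (forall x, a != S x) -> regular_at (Some a) h) ->
  (forall x, ord_ge (Some (S x)) (- n%:Z) h) ->
  (forall x, lev S x = 0%N -> laurent (Some (S x)) h (-1) = 0) ->
  regular_at None (du_part h) ->
  h = polar S (fun x => - laurent (Some (S x)) h (- (lev S x).+1%:Z)).
Proof.
move=> hreg hord h0 hoo; set b := fun x => _.
have rP a : regular_at (Some a) (h - polar S b).
  have [/existsP[x /eqP <-]|/existsPn ax] := boolP [exists x, S x == a]; last first.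
    by apply: regularB; [apply: hreg|apply: regular_polar] => x; rewrite eq_sym ax.
  apply/ord_ge0E/ord_ge_laurent => i i0; rewrite laurentB.
  have [ni|ni] := ltP i (- n%:Z).
    by rewrite (laurent_ord_ge (hord x) ni) (laurent_ord_ge (ord_ge_polar _ _ _) ni) subrr.
  have kn : (`|i|.-1 < n)%N by lia.
  have [y [Sy ly]] := site_lev S x kn.
  have -> : i = - (lev S y).+1%:Z by rewrite ly; lia.
  by rewrite -Sy laurent_polar /b opprK subrr.
have [p pE] := regular_everywhere_poly rP.
suff p0 : p = 0 by apply/eqP; rewrite -subr_eq0 pE p0 tofrac0.
have : regular_at None (fr ('X^2 * p)).
  have -> : fr ('X^2 * p) = du_part (polar S b) - du_part h.
    by rewrite /du_part -mulrBr mulNr -mulrN opprB pE tofracM tofracXn.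
  apply: regularB => //; apply: regular_du_polar => x lx.
  by rewrite /b lx h0 ?oppr0.
move/regular_poly_oo; have [-> //|p0] := eqVneq p 0.
by rewrite mulrC size_mulXn.
Qed.

End GlobalForms.

(** A family in [V] of maximal rank spans [V]; some column of its cokernel does not kill [y] and is
    the functional sought. *)
Lemma subspace_separation (K : fieldType) d (V : 'cV[K]_d -> Prop) (y : 'cV_d) :
  V 0 -> (forall c v w, V v -> V w -> V (c *: v + w)) -> ~ V y ->
  exists2 b : 'rV_d, (forall v, V v -> b *m v = 0) & b *m y != 0.
Proof.
move=> V0 VL Vy.
pose R (r : nat) := `[< exists k (A : 'M[K]_(k, d)), (forall i, V (row i A)^T) /\ \rank A = r >].
have exR : exists r, R r.
  by exists 0%N; apply/asboolP; exists 0%N, 0; split; [case|rewrite mxrank0].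
have bR r : R r -> (r <= d)%N by move/asboolP => [k [A [_ <-]]]; apply: rank_leq_col.
case: (ex_maxnP exR bR) => r /asboolP[k [A [AV Ar]]] rmax.
have VA (v : 'rV_k) : V (v *m A)^T.
  rewrite mulmx_sum_row; elim/big_ind: _ => [|v1 v2 h1 h2|i _]; first by rewrite trmx0.
    by rewrite linearD -[X in X + _]scale1r; apply: VL.
  by rewrite linearZ /= -[_ *: _]addr0; apply: VL.
have sub v : V v -> (v^T <= A)%MS.
  move=> Vv; have := rmax (\rank (col_mx A v^T)).
  have -> : R (\rank (col_mx A v^T)).
    apply/asboolP; exists (k + 1)%N, (col_mx A v^T); split=> // i.
    case: (split_ordP i) => j ->; first by rewrite rowKu.
    by rewrite rowKd ord1 [row 0 _]row_id trmxK.
  move/(_ isT); rewrite -addsmxE -Ar => le.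
  have : (A == A + v^T)%MS by rewrite -(geq_leqif (mxrank_leqif_eq (addsmxSl A v^T))).
  by case/andP => _ /(submx_trans (addsmxSr A v^T)).
have yA : y^T *m cokermx A != 0.
  rewrite -submxE; apply/negP => /submxP[v yE]; apply: Vy.
  by rewrite -[y]trmxK yE; apply: VA.
have [j yj] : exists j, (y^T *m cokermx A) 0 j != 0.
  apply/existsP; apply: contraNT yA => /existsPn h; apply/eqP/rowP => j.
  by have := h j; rewrite negbK [RHS]mxE => /eqP.
have E v : (col j (cokermx A))^T *m v = (v^T *m col j (cokermx A))^T.
  by rewrite trmx_mul trmxK.
exists (col j (cokermx A))^T => [v /sub|].
  by rewrite submxE E -col_mulmx => /eqP ->; apply/matrixP => ? ?; rewrite !mxE.
rewrite E -col_mulmx; apply: contraNneq yj => /matrixP/(_ 0 0).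
by rewrite [LHS]mxE [LHS]mxE [RHS]mxE => ->.
Qed.

(** * The frame of a unibranch curve *)

Section GridSites.
Variables (K : fieldType) (m n : nat) (a : 'I_m -> K).
Hypothesis a_inj : injective a.

Lemma grid_index_lt (x : 'I_(m * n.+1)) : (x %/ n.+1 < m)%N.
Proof. by rewrite ltn_divLR. Qed.

Definition grid_index x := Ordinal (grid_index_lt x).

Fact grid_lev_lt (x : 'I_(m * n.+1)) : (x %% n.+1 < n.+1)%N.
Proof. exact: ltn_pmod. Qed.

Fact grid_inj (x y : 'I_(m * n.+1)) :
  a (grid_index x) = a (grid_index y) -> (x %% n.+1)%N = (y %% n.+1)%N -> x = y.
Proof.
move=> /a_inj[xy] l; apply/val_inj; rewrite /= (divn_eq x n.+1) xy l.
exact/esym/divn_eq.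
Qed.

Lemma grid_cell (i : 'I_m) k : (k < n.+1)%N ->
  exists y : 'I_(m * n.+1), grid_index y = i /\ (y %% n.+1)%N = k.
Proof.
move=> kn; have lt : (i * n.+1 + k < m * n.+1)%N.
  apply: leq_trans (_ : i.+1 * n.+1 <= _)%N; last by rewrite leq_mul2r ltn_ord.
  by rewrite mulSn addnC ltn_add2r.
exists (Ordinal lt); split; last by rewrite /= modnMDl modn_small.
by apply/val_inj; rewrite /= divnMDl // divn_small ?addn0.
Qed.

Fact grid_lev (x : 'I_(m * n.+1)) k : (k < n.+1)%N ->
  exists y : 'I_(m * n.+1), a (grid_index y) = a (grid_index x) /\ (y %% n.+1)%N = k.
Proof. by move/(grid_cell (grid_index x)) => [y [E l]]; exists y; rewrite E. Qed.

Fact grid_leq (x y : 'I_(m * n.+1)) : a (grid_index x) = a (grid_index y) ->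
  (x %% n.+1 <= y %% n.+1)%N -> (x <= y)%N.
Proof.
by move=> /a_inj[xy] l; rewrite [leqLHS](divn_eq x n.+1) [leqRHS](divn_eq y n.+1) xy leq_add2l.
Qed.

(** The index [i * n.+1 + k] stands for the order [k] at the point [a i]. *)
Definition grid_sites : sites K (m * n.+1) n.+1 :=
  Sites grid_lev_lt grid_inj grid_lev grid_leq.

End GridSites.

Section UnibranchCurve.
Variables (K : numClosedFieldType) (C : rational_curve K).
Variables (m : nat) (a : 'I_m -> K).
Hypothesis a_inj : injective a.
Hypothesis unibr : unibranch C.
Hypothesis singE : forall Q, singular C Q <-> exists i, Q = Some (a i).

Local Notation fr := (@tofrac {poly K}).
Local Notation unif Q := (uniformizer Q).
Local Notation lring := (local_ring C).

(** [v - b] and [1/v] have a single zero on the projective line. *)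
Lemma unif_separates (Q Q' : proj_line K) : ord_ge Q' 1 (unif Q) -> Q' = Q.
Proof.
case: Q Q' => [b|] [b'|] //= h.
- have := laurent_ord_ge h (ltr01 : 0 < 1 :> int); rewrite -[_ - _]/(unif (Some b)) uniformizerE.
  by rewrite -[0 : int]/(0%N%:Z) laurent_tay tay_at0 hornerXsubC => /eqP; rewrite subr_eq0 => /eqP ->.
- have : ord_ge None 0 (coord_v : ratfun K).
    rewrite -[coord_v](subrK (cst b)); apply: ord_geD (ord_ge_cst _ _).
    exact: ord_geW h.
  move/(laurent_ord_ge)/(_ (ltrN10 _ : -1 < 0 :> int)).
  have -> : (coord_v : ratfun K) = unif None ^ (-1) by rewrite /= exprN1 invrK.
  by rewrite laurent_unif eqxx => /eqP; rewrite oner_eq0.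
- have [b0|b0] := eqVneq b' 0.
    have := @laurent_ord_ge _ _ _ _ (-1) h (lt_trans (ltrN10 _) ltr01).
    have -> : (coord_u : ratfun K) = unif (Some b') ^ (-1).
      by rewrite /= b0 cst0 subr0 exprN1.
    by rewrite laurent_unif eqxx => /eqP; rewrite oner_eq0.
  have := laurent_ord_ge h (ltr01 : 0 < 1 :> int).
  rewrite /coord_u /coord_v -div1r -tofrac1 value_frac ?hornerX //.
  by rewrite hornerC div1r => /eqP; rewrite invr_eq0 (negbTE b0).
Qed.

Lemma local_ring_regular Q f : lring Q f -> regular_at Q f.
Proof.
case/local_ring_value => c /(_ Q (same_image_refl C Q)) h.
by rewrite -[f](subrK (cst c)); apply: regularD (regular_cst _ _); apply/ord_ge0E/ord_geW/h.
Qed.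

(** Over a singular point this is the unibranch hypothesis. At a smooth one the local ring contains
    the uniformizer, which takes a single value on the fibre; this value is 0, and the uniformizer
    has no other zero. *)
Lemma fibreE Q : [set Q' | same_image C Q Q']%classic = [set Q]%classic.
Proof.
apply/seteqP; split => Q' /=; last by move=> ->; apply: same_image_refl.
move=> QQ'; have [sm|sg] := pselect (smooth C Q); last exact: unibr sg _ QQ'.
apply: unif_separates.
have : lring Q (unif Q) by rewrite sm; exact: regular_uniformizer.
case/local_ring_value => c h; have c0 : c = 0.
  apply: (@ord_ge1_cst _ Q); rewrite -[cst c]opprK -[- cst c](addKr (unif Q)) addrC.
  apply: ord_geN; apply: ord_geD; first exact: h (same_image_refl _ _).
  by apply: ord_geN; rewrite -[unif Q]expr1z; apply: ord_ge_unif.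
by have := h _ QQ'; rewrite c0 cst0 subr0.
Qed.

Lemma stalkE Q h : dualizing_stalk C Q h <-> forall f, lring Q f -> residue Q (f * h) = 0.
Proof. by split => H f /H; rewrite fibreE fsbig_set1. Qed.

Lemma smooth_infinity : smooth C None.
Proof. by apply: contrapT => /singE[i]. Qed.

Lemma smooth_finite b : (forall i, b != a i) -> smooth C (Some b).
Proof. by move=> h; apply: contrapT => /singE[i [/eqP]]; rewrite (negbTE (h i)). Qed.

Lemma common_conductor : exists n : nat, forall i f,
  ord_ge (Some (a i)) n.+1%:Z f -> lring (Some (a i)) f.
Proof.
have /choice[e eP] : forall i, exists k : nat, forall f,
    ord_ge (Some (a i)) k%:Z f -> lring (Some (a i)) f.
  move=> i; have [k kP] := local_ring_conductor C (Some (a i)); exists k => f fk.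
  apply: kP => Q' QQ'; have : [set Q' | same_image C (Some (a i)) Q']%classic Q' by [].
  by rewrite fibreE => ->.
exists (\max_i e i) => i f h; apply: eP; apply: ord_geW h.
by rewrite lez_nat (leq_trans (leq_bigmax i)).
Qed.

Variable n : nat.
Hypothesis conductor : forall i f, ord_ge (Some (a i)) n.+1%:Z f -> lring (Some (a i)) f.

Local Notation S := (grid_sites n a_inj).
Local Notation nu p := (nu S (idfun : {rmorphism K -> K}) p).

(** The coordinate ring of the affine curve [C] minus [P_0]. *)
Definition subring_poly (p : {poly K}) := forall i, lring (Some (a i)) (fr p).

Lemma ord_ge_nu p i : (forall x, grid_index x = i -> nu p x 0 = 0) ->
  ord_ge (Some (a i)) n.+1%:Z (fr p).
Proof.
move=> h; apply: ord_ge_tay => k /(grid_cell i)[y [yi yk]].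
by have := h y yi; rewrite mxE /= yi yk.
Qed.

(** Hermite interpolation copies the jet of [f] at [a i] and puts 0 at the other points; the errors
    lie in the conductors. *)
Lemma subring_poly_approx i f : lring (Some (a i)) f ->
  exists p, [/\ subring_poly p, ord_ge (Some (a i)) n.+1%:Z (f - fr p) &
    forall x, grid_index x != i -> nu p x 0 = 0].
Proof.
move=> lf; pose c : 'cV_(m * n.+1) := \col_x if grid_index x == i
   then laurent (Some (a i)) f (lev S x)%:Z else 0.
pose p := hermite S c; have pE x : nu p x 0 = c x 0 by rewrite nu_hermite.
have fp : ord_ge (Some (a i)) n.+1%:Z (f - fr p).
  apply: ord_ge_laurent => j jn; rewrite laurentB.
  have [j0|j0] := ltP j 0.
    rewrite !(laurent_ord_ge (k := 0)) ?subrr //; first exact/ord_ge0E/regular_poly.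
    exact/ord_ge0E/local_ring_regular.
  have jE : j = `|j|%N%:Z by lia.
  have /(grid_cell i)[y [yi yj]] : (`|j|%N < n.+1)%N by lia.
  rewrite jE laurent_tay; have := pE y; rewrite !mxE /= yi yj eqxx => ->.
  by rewrite subrr.
exists p; split => [j|//|x /negbTE xi]; last by rewrite pE mxE xi.
have [->|ji] := eqVneq j i.
  have -> : fr p = f - (f - fr p) by rewrite subKr.
  by apply: local_ringB => //; apply: conductor.
apply/conductor/ord_ge_nu => x xj.
by rewrite pE mxE xj (negbTE ji).
Qed.

Lemma subring_poly_nu0 p : nu p = 0 -> subring_poly p.
Proof. by move=> p0 i; apply/conductor/ord_ge_nu => x _; rewrite p0 mxE. Qed.

Lemma subring_polyB p q : subring_poly p -> subring_poly q -> subring_poly (p - q).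
Proof. by move=> hp hq i; rewrite tofracB; apply: local_ringB. Qed.

Lemma subring_polyZ c p : subring_poly p -> subring_poly (c *: p).
Proof.
by move=> hp i; rewrite -mul_polyC tofracM; apply: local_ringM (hp i); apply: local_ring_cst.
Qed.

Lemma subring_polyM p q : subring_poly p -> subring_poly q -> subring_poly (p * q).
Proof. by move=> hp hq i; rewrite tofracM; apply: local_ringM. Qed.

Lemma sum_sites (G : 'I_(m * n.+1) -> K) :
  \sum_x G x = \sum_i \sum_(x | S x == a i) G x.
Proof.
rewrite (partition_big (@grid_index m n) xpredT) //; apply: eq_bigr => i _.
by apply: eq_bigl => x /=; rewrite (inj_eq a_inj).
Qed.

(** The hypothesis is one sum over all points. It yields each local residue condition, because a
    local [f] may be replaced by a [p] with zero jets at the other points. *)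
Lemma dualizing_polar b : (forall x, lev S x = 0%N -> b x = 0) ->
  (forall p, subring_poly p -> \sum_x b x * nu p x 0 = 0) ->
  dualizing_sections C (polar S b).
Proof.
move=> b0 bO Q; apply/stalkE => f lf.
have [/singE[i QE]|/contrapT sm] := pselect (singular C Q).
  rewrite {Q}QE in lf *; have [p [pO fp pi]] := subring_poly_approx lf.
  rewrite /residue -[f](subrK (fr p)) mulrDl laurentD (laurent_ord_ge (k := 0)) //; last first.
    by rewrite -[0](subrr n.+1%:Z); apply: ord_geM fp (ord_ge_polar _ _ _).
  rewrite add0r residue_polar; have := bO p pO.
  rewrite (bigID (fun x => S x == a i)) /= [X in _ + X]big1 => [|x xi].
    by rewrite addr0 => ->; rewrite oppr0.
  by rewrite pi ?mulr0 //; apply: contraNneq xi => ->.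
have rf : regular_at Q f by rewrite -sm.
case: Q sm lf rf => [q|] sm lf rf.
  apply: (@laurent_ord_ge _ _ 0) => //; apply/ord_ge0E/regularM => //.
  apply: regular_polar => x; apply/negP => /eqP qx.
  by have /singE : exists i, Some q = Some (a i) by exists (grid_index x); rewrite qx.
rewrite /residue /du_part mulrCA; apply: (@laurent_ord_ge _ _ 0) => //.
by apply/ord_ge0E/regularM => //; apply: regular_du_polar.
Qed.

Definition polar_coef (h : ratfun K) (x : 'I_(m * n.+1)) : K :=
  - laurent (Some (S x)) h (- (lev S x).+1%:Z).

(** Testing against powers of the uniformizer reads off single Laurent coefficients. *)
Lemma dualizing_residue h Q : dualizing_sections C h -> forall j : nat,
  lring Q (unif Q ^+ j) -> laurent Q (if Q is Some _ then h else du_part h) (-1 - j%:Z) = 0.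
Proof.
move=> hd j lj; have /stalkE/(_ _ lj) := hd Q; rewrite -laurent_shift -exprnP /residue.
by case: Q lj => [q|] lj //; rewrite /du_part mulrCA.
Qed.

Lemma dualizing_lev0 h : dualizing_sections C h ->
  forall x, lev S x = 0%N -> polar_coef h x = 0.
Proof.
move=> hd x lx; rewrite /polar_coef lx.
have := @dualizing_residue _ (Some (S x)) hd 0%N; rewrite expr0 -cst1.
by move=> -> //; [rewrite oppr0|exact: local_ring_cst].
Qed.

(** Tested with all powers of the uniformizer at smooth points, and with those in the conductor at
    singular ones, the form is regular outside the [a i] and has poles of order at most [n.+1]
    there; [polar_form] applies. *)
Lemma dualizing_form h : dualizing_sections C h -> h = polar S (polar_coef h).
Proof.
move=> hd; apply: polar_form => [b bS|x|x lx|].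
- apply/ord_ge0E/ord_ge_laurent => i i0.
  have -> : i = -1 - `|i|.-1%:Z by lia.
  apply: (@dualizing_residue _ (Some b)) => //.
  rewrite smooth_finite; first exact/regularX/regular_uniformizer.
  move=> j; have [y [yj _]] := grid_cell j (isT : (0 < n.+1)%N).
  by have := bS y; rewrite /= yj.
- apply: ord_ge_laurent => i i0.
  have -> : i = -1 - `|i|.-1%:Z by lia.
  apply: (@dualizing_residue _ (Some (S x))) => //.
  by apply: conductor; apply: ord_geW (ord_ge_unif _ `|i|.-1); lia.
- by have /eqP := dualizing_lev0 hd lx; rewrite /polar_coef lx oppr_eq0 => /eqP.
- apply/ord_ge0E/ord_ge_laurent => i i0.
  have -> : i = -1 - `|i|.-1%:Z by lia.
  apply: (@dualizing_residue _ None) => //.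
  by rewrite smooth_infinity; apply/regularX/regular_uniformizer.
Qed.

Lemma dualizing_orthogonal h p : dualizing_sections C h -> subring_poly p ->
  \sum_x polar_coef h x * nu p x 0 = 0.
Proof.
move=> hd pO; rewrite sum_sites big1 // => i _; apply: oppr_inj.
rewrite -residue_polar -dualizing_form // oppr0.
by have /stalkE/(_ _ (pO i)) := hd (Some (a i)).
Qed.

Variables (g : nat) (omega : 'I_g -> ratfun K).
Hypothesis basis : is_basis (dualizing_sections C) omega.

Definition form_mx : 'M[K]_(g, m * n.+1) := \matrix_(c, x) polar_coef (omega c) x.

Lemma form_mx_nuE c p : (form_mx *m nu p) c 0 = \sum_x polar_coef (omega c) x * nu p x 0.
Proof. by rewrite [LHS]mxE; apply: eq_bigr => x _; rewrite [form_mx _ _]mxE. Qed.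

Lemma form_mx_free : row_free form_mx.
Proof.
rewrite -kermx_eq0; apply/rowV0P => v /sub_kermxP vL.
have d0 : dualizing_sections C 0.
  move=> Q; apply/stalkE => f _; rewrite mulr0 /residue.
  by case: Q => [q|]; rewrite /du_part ?mulr0 laurent0.
have [c [_ cU]] := basis.2 0 d0.
have E0 (w : 'rV_g) : w *m form_mx = 0 -> c = w.
  move=> wL; apply: cU; transitivity (\sum_j cst (w 0 j) * polar S (polar_coef (omega j))).
    rewrite -polar_sum /polar big1 ?oppr0 // => x _.
    have := congr1 (fun M : 'rV_ _ => M 0 x) wL; rewrite [LHS]mxE [RHS]mxE => E.
    rewrite [X in cst X](_ : _ = 0) ?cst0 ?mul0r // -[RHS]E.
    by apply: eq_bigr => j _; rewrite [form_mx _ _]mxE.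
  by apply: eq_bigr => j _; rewrite -dualizing_form //; apply: basis.1.
by rewrite -(E0 v vL) (E0 0) // mul0mx.
Qed.

Lemma form_mx_lev0 c x : lev S x = 0%N -> form_mx c x = 0.
Proof. by move=> lx; rewrite mxE dualizing_lev0 //; apply: basis.1. Qed.

(** For the converse, if the jet of [p] were not that of an element of the ring, some [b] would
    annihilate the ring but not [p]. Then [polar S b] is a section of the dualizing sheaf, so [b] is
    a combination of the rows of [form_mx], and these annihilate [p]. *)
Lemma subring_polyP p : subring_poly p <-> form_mx *m nu p = 0.
Proof.
split => [pO|Lp].
  by apply/colP => c; rewrite form_mx_nuE dualizing_orthogonal ?mxE //; apply: basis.1.
pose V (v : 'cV_(m * n.+1)) := exists2 q, subring_poly q & nu q = v.
suff [q qO qp] : V (nu p).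
  have -> : p = q - (q - p) by rewrite subKr.
  by apply: subring_polyB => //; apply: subring_poly_nu0; rewrite nuB qp subrr.
apply: contrapT => Vp; have [||b bV bp] := subspace_separation _ _ Vp.
- by exists 0; [apply: subring_poly_nu0|]; rewrite nu0.
- move=> c _ _ [v vO <-] [w wO <-]; exists (c *: v + w); last by rewrite nuD nuZ.
  have -> : c *: v + w = c *: v - (-1) *: w by rewrite scaleN1r opprK.
  apply: subring_polyB; first exact: subring_polyZ.
  exact: subring_polyZ.
have bE q : (b *m nu q) 0 0 = \sum_x b 0 x * nu q x 0 by rewrite [LHS]mxE.
have bO q : subring_poly q -> \sum_x b 0 x * nu q x 0 = 0.
  by move=> qO; rewrite -bE bV ?mxE //; exists q.
(* Test [b] against an element of the ring whose jet is that of 1 at one point and 0 at the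
   others. *)
have b0 x : lev S x = 0%N -> b 0 x = 0.
  move=> lx; have [q [qO q1 qi]] :=
    subring_poly_approx (local_ring_cst C (Some (a (grid_index x))) 1).
  rewrite -(bO q qO) (bigD1 x) //= big1 ?addr0 => [|y yx].
    have := @laurent_ord_ge _ _ _ _ (lev S x)%:Z q1; rewrite ltz_nat lev_lt => /(_ isT).
    rewrite laurentB laurent_cst laurent_tay lx eqxx => /eqP.
    by rewrite subr_eq0 mxE lx => /eqP <-; rewrite mulr1.
  have [yi|/qi ->] := eqVneq (grid_index y) (grid_index x); last by rewrite mulr0.
  have ly : lev S y != 0%N.
    apply: contraNneq yx => ly; apply/eqP; apply: (site_inj (s := S)); rewrite /= ?yi //.
    by have := lx; rewrite /= => ->.
  have := @laurent_ord_ge _ _ _ _ (lev S y)%:Z q1; rewrite ltz_nat lev_lt => /(_ isT).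
  rewrite laurentB laurent_cst laurent_tay -[(_ == 0)]/(lev S y == 0%N) (negbTE ly) sub0r -yi.
  by move/eqP; rewrite oppr_eq0 mxE => /eqP ->; rewrite mulr0.
have [c [cE _]] := basis.2 _ (dualizing_polar b0 bO).
have /polar_inj bc : polar S (b 0) = polar S (fun x => \sum_j c 0 j * polar_coef (omega j) x).
  rewrite cE polar_sum; apply: eq_bigr => j _; rewrite -dualizing_form //; exact: basis.1.
case/eqP: bp; apply/matrixP => i j; rewrite !ord1 bE [RHS]mxE.
transitivity (\sum_j c 0 j * (form_mx *m nu p) j 0).
  under [RHS]eq_bigr => k _ do rewrite form_mx_nuE mulr_sumr.
  rewrite [RHS]exchange_big; apply: eq_bigr => x _ /=; rewrite bc mulr_suml.
  by apply: eq_bigr => k _; rewrite mulrA.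
by rewrite Lp big1 // => k _; rewrite mxE mulr0.
Qed.

Lemma form_mx_mul (p q : {poly K}) : form_mx *m nu p = 0 -> form_mx *m nu q = 0 ->
  form_mx *m nu (p * q) = 0.
Proof. by move=> /subring_polyP hp /subring_polyP hq; apply/subring_polyP/subring_polyM. Qed.

Definition curve_frame : frame K g (m * n.+1) n.+1 :=
  Frame form_mx_free form_mx_lev0 form_mx_mul.

Lemma curve_frame_form c : omega c = polar curve_frame (fmx curve_frame c).
Proof.
rewrite {1}(dualizing_form (basis.1 c)) /polar; congr (- _); apply: eq_bigr => x _.
by rewrite [fmx _ _ _]mxE.
Qed.

End UnibranchCurve.

(** * Expansions at infinity *)

Lemma simple_fraction_step (F : fieldType) (v w c : F) k : v != 0 -> w != 0 -> w = v - c ->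
  v / w ^+ k.+1 - c * (v^-1 * (v / w ^+ k.+1)) = (w ^+ k)^-1.
Proof.
move=> v0 w0 wE; rewrite [v^-1 * _]mulrA mulVf // mul1r -mulrBl -wE.
by rewrite exprS invfM mulrA mulfV // mul1r.
Qed.

Section Expansions.
Variable K : numFieldType.
Local Notation fr := (@tofrac {poly K}).
Local Notation unif Q := (uniformizer Q).

(** It equals [u^k / (1 - a u)^(k+1)], the generating series of the [C(j, k) a^(j-k)]. *)
Definition simple_form (a : K) (k : nat) : ratfun K := coord_v / unif (Some a) ^+ k.+1.

Lemma simple_formE a k :
  simple_form a k - cst a * (unif None ^ 1 * simple_form a k) = (unif (Some a) ^+ k)^-1.
Proof.
rewrite expr1z; apply: (simple_fraction_step _ (coord_v_neq0 K) (uniformizer_neq0 (Some a))).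
by [].
Qed.

Lemma simple_form_regular a k : regular_at None (simple_form a k).
Proof.
exists 'X, (('X - a%:P) ^+ k.+1); split.
- by rewrite expf_neq0 // polyXsubC_eq0.
- by rewrite /simple_form unif_exprE.
- by rewrite size_polyX size_exp_XsubC.
Qed.

Lemma tay_XnS a k j : tay a k.+1 ('X^(j.+1)) = tay a k 'X^j + a * tay a k.+1 ('X^j : {poly K}).
Proof.
have -> : 'X^(j.+1) = ('X - a%:P) ^+ 1 * 'X^j + a *: 'X^j :> {poly K}.
  by rewrite expr1 exprS -mul_polyC -mulrDl subrK.
by rewrite tayD tay_mul_exp subSS subn0 tayZ.
Qed.

(** [simple_formE] gives these coefficients a recursion of Pascal type, which [tay_XnS] gives for
    the Taylor coefficients of [v^j]. *)
Lemma laurent_simple_form a (j k : nat) :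
  laurent None (simple_form a k) j%:Z = tay a k 'X^j.
Proof.
have E i l : laurent None (simple_form a l) i =
    a * laurent None (simple_form a l) (i - 1) + laurent None ((unif (Some a) ^+ l)^-1) i.
  by rewrite -simple_formE laurentB laurentZ laurent_shift addrC subrK.
have neg i l : i < 0 -> laurent None (simple_form a l) i = 0.
  by apply/laurent_ord_ge/ord_ge0E/simple_form_regular.
have sh l : (unif (Some a) ^+ l.+1)^-1 = unif None ^ 1 * simple_form a l.
  by rewrite expr1z /simple_form -[unif None]/(coord_v^-1) [coord_v^-1 * _]mulrA (mulVf (coord_v_neq0 K)) mul1r.
elim: j k => [|j IH] [|k]; rewrite E.
- by rewrite neg // mulr0 add0r expr0 invr1 -cst1 laurent_cst tay_at0 hornerXn.
- by rewrite neg // mulr0 add0r sh laurent_shift neg // tayC.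
- rewrite (_ : j.+1%:Z - 1 = j) ?IH; last by lia.
  rewrite expr0 invr1 -cst1 laurent_cst addr0 !tay_at0 !hornerXn exprS //.
- rewrite sh laurent_shift (_ : j.+1%:Z - 1 = j) ?IH; last by lia.
  by rewrite tay_XnS addrC.
Qed.

Variables (d n : nat) (S : sites K d n).

Lemma du_polarE b : du_part (polar S b) =
  \sum_x cst (b x) * (unif None ^ (-1) * simple_form (S x) (lev S x)).
Proof.
rewrite /du_part /polar mulrN mulNr opprK mulr_sumr; apply: eq_bigr => x _.
rewrite mulrCA; congr (_ * _); rewrite -exprnN exprN1 -[unif None]/(coord_v^-1) invrK.
by rewrite /simple_form [in RHS]mulrA -expr2.
Qed.

Lemma laurent_du_polar b (j : nat) :
  laurent None (du_part (polar S b)) (j%:Z - 1) = \sum_x b x * tay (S x) (lev S x) 'X^j.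
Proof.
rewrite du_polarE laurent_sum; apply: eq_bigr => x _.
by rewrite laurentZ laurent_shift opprK subrK laurent_simple_form.
Qed.

(** The case [w = 0] is the point at infinity. The predecessor of [lev S x] is harmless at order 0,
    where [b] vanishes. *)
Lemma value_du_polar b w : (forall x, lev S x = 0%N -> b x = 0) ->
  (forall x, 1 - S x * w != 0) ->
  laurent (if w == 0 then None else Some w^-1) (du_part (polar S b)) 0 =
  \sum_x b x * (w ^+ (lev S x).-1 / (1 - S x * w) ^+ (lev S x).+1).
Proof.
move=> b0 gw; case: eqVneq => [->|w0].
  rewrite -[0 in LHS](subrr (1%N%:Z)) laurent_du_polar; apply: eq_bigr => x _.
  rewrite mulr0 subr0 expr1n divr1.
  have := b0 x; rewrite tayXn; case: (lev S x) => [/(_ erefl) ->|[|l] _]; rewrite ?mul0r //.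
  by rewrite bin_small // mulr0n /= expr0n.
rewrite /polar /du_part mulrN mulNr opprK mulr_sumr laurent_sum; apply: eq_bigr => x _.
rewrite mulrCA laurentZ.
have w1 : w^-1 - S x != 0.
  apply: contraNneq (gw x) => E; have := congr1 ( *%R^~ w) E.
  by rewrite /= mul0r mulrBl mulVf // => /eqP.
rewrite -exprnN unif_exprE /coord_v -tofracXn value_frac ?horner_exp ?hornerXsubC ?expf_neq0 //.
rewrite hornerX; case l0: (lev S x) => [|l]; first by rewrite b0 // !mul0r.
congr (_ * _); have -> : w^-1 - S x = (1 - S x * w) / w by rewrite mulrBl mulfK // mul1r.
rewrite expr_div_n invf_div exprVn [w ^+ l.+2](exprD w 2 l) mulrA [w ^- 2 * _]mulrA.
by rewrite mulVf ?expf_neq0 // mul1r.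
Qed.

End Expansions.

Section FrameExpansions.
Variables (K : numFieldType) (g d n : nat) (F : frame K g d n) (omega : 'I_g -> ratfun K).
Hypothesis omegaE : forall c, omega c = polar F (fmx F c).

Lemma laurent_omega c (j : nat) :
  laurent None (du_part (omega c)) (j%:Z - 1) = moment F c j.
Proof.
rewrite omegaE laurent_du_polar /moment ell_idE [RHS]mxE; apply: eq_bigr => x _.
by rewrite [nu _ _ _ _ _]mxE.
Qed.

Lemma expansion_matrixE c i : expansion_matrix omega c i = moment F c i.+1.
Proof. by rewrite /expansion_matrix -laurent_omega; congr (laurent _ _ _); lia. Qed.

(** The frame coefficient [i] is that of [u^(i+1)], and [iota] multiplies by [u^(2-g)], whence the
    index [i + g - 1]. *)
Lemma frame_coefE i c : frame_coef (differential_frame omega) i c =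
  laurent None (du_part (extended_basis omega c)) (i + g%:Z - 1).
Proof.
rewrite /frame_coef /differential_frame /iota_diff -[coord_u]/(uniformizer None).
by rewrite laurent_shift; congr (laurent _ _ _); lia.
Qed.

Lemma frame_coef_moment (c : 'I_g) (k : nat) :
  frame_coef (differential_frame omega) (k%:Z - g%:Z) c = moment F c k.
Proof. by rewrite frame_coefE /extended_basis valK subrK laurent_omega. Qed.

Lemma frame_coef_ext c i : (g <= c)%N ->
  frame_coef (differential_frame omega) i c = (i == - c.+1%:Z)%:R.
Proof.
move=> gc; rewrite frame_coefE /extended_basis insubN -?leqNgt //.
have -> : du_part (- coord_v ^+ (c - g)) = uniformizer None ^ (- (c - g).+2%:Z) :> ratfun K.
  rewrite /du_part mulrN mulNr opprK -exprD -exprnN -[uniformizer None]/(coord_v^-1).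
  by rewrite exprVn invrK.
rewrite laurent_unif; have -> : (i + g%:Z - 1 == - (c - g).+2%:Z) = (i == - c.+1%:Z).
  by apply/eqP/eqP; lia.
by case: eqP.
Qed.

End FrameExpansions.

(** * Path integrals *)

From mathcomp Require Import functions reals complex.
From mathcomp Require Import topology normedtype sequences derive realfun exp trigo.
From mathcomp Require Import measure lebesgue_measure lebesgue_integral ftc.

Import numFieldNormedType.Exports.
Local Open Scope complex_scope.

Section ComplexDerivative.
Variable R : realType.
Implicit Types (f g : R -> R[i]) (t : R) (l : R[i]).
Local Notation Re := complex.Re.
Local Notation Im := complex.Im.

Definition has_cderiv f t l :=
  is_derive t 1 (fun s => Re (f s)) (Re l) /\ is_derive t 1 (fun s => Im (f s)) (Im l).

Lemma has_cderiv_eq f t l l' : l = l' -> has_cderiv f t l -> has_cderiv f t l'.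
Proof. by move=> ->. Qed.

Lemma has_cderiv_cst c t : has_cderiv (fun=> c) t 0.
Proof. by split; exact: is_derive_cst. Qed.

Lemma has_cderivD f g t l l' : has_cderiv f t l -> has_cderiv g t l' ->
  has_cderiv (fun s => f s + g s) t (l + l').
Proof.
move=> [fr fi] [gr gi]; split.
  have -> : (fun s => Re (f s + g s)) = (fun s => Re (f s)) + (fun s => Re (g s)).
    by apply/funext => s; rewrite !fctE; case: (f s) (g s) => ? ? [].
  by apply: is_derive_eq; case: l l' {fr fi gr gi} => ? ? [].
have -> : (fun s => Im (f s + g s)) = (fun s => Im (f s)) + (fun s => Im (g s)).
  by apply/funext => s; rewrite !fctE; case: (f s) (g s) => ? ? [].
by apply: is_derive_eq; case: l l' {fr fi gr gi} => ? ? [].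
Qed.

Lemma has_cderivM f g t l l' : has_cderiv f t l -> has_cderiv g t l' ->
  has_cderiv (fun s => f s * g s) t (l * g t + f t * l').
Proof.
move=> [fr fi] [gr gi]; split.
  have -> : (fun s => Re (f s * g s)) = (fun s => Re (f s)) * (fun s => Re (g s)) -
      (fun s => Im (f s)) * (fun s => Im (g s)).
    by apply/funext => s; rewrite !fctE; case: (f s) (g s) => ? ? [].
  apply: (is_derive_eq (is_deriveB (is_deriveM fr gr) (is_deriveM fi gi))).
  case: (f t) (g t) l l' {fr fi gr gi} => ? ? [? ?] [? ?] [? ?] /=.
  by rewrite /GRing.scale /=; ring.
have -> : (fun s => Im (f s * g s)) = (fun s => Re (f s)) * (fun s => Im (g s)) +
    (fun s => Im (f s)) * (fun s => Re (g s)).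
  by apply/funext => s; rewrite !fctE; case: (f s) (g s) => ? ? [].
apply: (is_derive_eq (is_deriveD (is_deriveM fr gi) (is_deriveM fi gr))).
case: (f t) (g t) l l' {fr fi gr gi} => ? ? [? ?] [? ?] [? ?] /=.
by rewrite /GRing.scale /=; ring.
Qed.

Lemma has_cderivV f t l : f t != 0 -> has_cderiv f t l ->
  has_cderiv (fun s => (f s)^-1) t (- l / f t ^+ 2).
Proof.
move=> ft0 [fr fi].
(* The squared modulus: the inverse is the conjugate divided by [N]. *)
pose N s := Re (f s) ^+ 2 + Im (f s) ^+ 2.
have N0 : N t != 0.
  apply: contraNneq ft0 => /eqP; rewrite /N paddr_eq0 ?sqr_ge0 // !sqrf_eq0.
  by case: (f t) => a b /= /andP[/eqP -> /eqP ->].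
have NE : N = (fun s => Re (f s)) * (fun s => Re (f s)) + (fun s => Im (f s)) * (fun s => Im (f s)).
  by apply/funext => s; rewrite !fctE /N !expr2.
have dN : is_derive t 1 N (2 * (Re (f t) * Re l + Im (f t) * Im l)).
  by rewrite NE; apply: (is_derive_eq (is_deriveD (is_deriveM fr fr) (is_deriveM fi fi))); rewrite /GRing.scale /=; ring.
have dV : is_derive t 1 (fun s => (N s)^-1) (- (N t) ^- 2 * (2 * (Re (f t) * Re l + Im (f t) * Im l))).
  apply: DeriveDef; first exact: derivableV.
  by rewrite deriveV // derive_val.
split.
  have -> : (fun s => Re (f s)^-1) = (fun s => Re (f s)) * (fun s => (N s)^-1).
    by apply/funext => s; rewrite !fctE /N; case: (f s).
  apply: (is_derive_eq (is_deriveM fr dV)); move: N0; rewrite /N.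
  case: (f t) l {ft0 fr fi dN dV} => a b [c e] /=.
  rewrite /GRing.scale /= => N0.
  have -> : (a * a - b * b) ^+ 2 + (a * b + b * a) ^+ 2 = (a ^+ 2 + b ^+ 2) ^+ 2 by ring.
  by field.
have -> : (fun s => Im (f s)^-1) = - ((fun s => Im (f s)) * (fun s => (N s)^-1)).
  by apply/funext => s; rewrite !fctE /N; case: (f s).
apply: (is_derive_eq (is_deriveN (is_deriveM fi dV))); move: N0; rewrite /N.
case: (f t) l {ft0 fr fi dN dV} => a b [c e] /=.
rewrite /GRing.scale /= => N0.
have -> : (a * a - b * b) ^+ 2 + (a * b + b * a) ^+ 2 = (a ^+ 2 + b ^+ 2) ^+ 2 by ring.
by field.
Qed.
End ComplexDerivative.

Section PathCalculus.
Variable R : realType.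
Implicit Types (f g : R -> R[i]) (t : R) (l : R[i]).
Local Notation Re := complex.Re.
Local Notation Im := complex.Im.

Lemma has_cderivX f t l k : has_cderiv f t l ->
  has_cderiv (fun s => f s ^+ k) t (k%:R * f t ^+ k.-1 * l).
Proof.
move=> fl; elim: k => [|k IH].
  by rewrite !mul0r; apply: has_cderiv_cst.
have -> : (fun s => f s ^+ k.+1) = (fun s => f s * f s ^+ k).
  by apply/funext => s; rewrite exprS.
apply: has_cderiv_eq (has_cderivM fl IH).
case: k {IH} => [|k]; first by rewrite !mul0r mulr0 !mul1r mulr1 addr0.
by rewrite /= -[k.+2%:R]natr1 exprS; ring.
Qed.

Lemma has_cderiv_sum (J : finType) (G : J -> R -> R[i]) (dG : J -> R[i]) t :
  (forall x, has_cderiv (G x) t (dG x)) ->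
  has_cderiv (fun s => \sum_x G x s) t (\sum_x dG x).
Proof.
move=> h; elim: (index_enum J) => [|x r IH].
  have -> : (fun s => \sum_(x <- [::]) G x s) = fun=> 0 by apply/funext => s; rewrite big_nil.
  by rewrite big_nil; apply: has_cderiv_cst.
have -> : (fun s => \sum_(y <- x :: r) G y s) = (fun s => G x s + \sum_(y <- r) G y s).
  by apply/funext => s; rewrite big_cons.
by rewrite big_cons; apply: has_cderivD.
Qed.

Lemma is_derive_continuous (h : R -> R) t (dh : R) : is_derive t 1 h dh -> {for t, continuous h}.
Proof. by move=> [d _]; apply/differentiable_continuous/derivable1_diffP. Qed.

Definition ccontinuous_at t f := {for t, continuous (fun s => Re (f s))} /\
  {for t, continuous (fun s => Im (f s))}.

Lemma has_cderiv_continuous f t l : has_cderiv f t l -> ccontinuous_at t f.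
Proof. by move=> [/is_derive_continuous ? /is_derive_continuous ?]. Qed.

Lemma ccontinuousM f g t : ccontinuous_at t f -> ccontinuous_at t g ->
  ccontinuous_at t (fun s => f s * g s).
Proof.
move=> [fr fi] [gr gi]; split.
  have -> : (fun s => Re (f s * g s)) = (fun s => Re (f s) * Re (g s) - Im (f s) * Im (g s)).
    by apply/funext => s; case: (f s) (g s) => ? ? [].
  by apply: continuousB; apply: continuousM.
have -> : (fun s => Im (f s * g s)) = (fun s => Re (f s) * Im (g s) + Im (f s) * Re (g s)).
  by apply/funext => s; case: (f s) (g s) => ? ? [].
by apply: continuousD; apply: continuousM.
Qed.

Lemma Rintegral_FTC (h H : R -> R) :
  (forall t, 0 <= t <= 1 -> is_derive t 1 H (h t)) ->
  (forall t, 0 <= t <= 1 -> {for t, continuous h}) ->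
  \int[@lebesgue_measure R]_(t in `[0%R, 1%R]) h t = H 1 - H 0.
Proof.
move=> dH ch; rewrite /Rintegral (@continuous_FTC2 _ h H 0 1) //.
- apply: continuous_in_subspaceT => t; rewrite inE /= in_itv /=; exact: ch.
- split.
  + by move=> t; rewrite in_itv /= => /andP[/ltW t0 /ltW t1]; have [] := dH t; rewrite ?t0.
  + by apply/cvg_at_right_filter/(is_derive_continuous (dH 0 _)); rewrite lexx ler01.
  + by apply/cvg_at_left_filter/(is_derive_continuous (dH 1 _)); rewrite lexx ler01.
- move=> t; rewrite in_itv /= => /andP[/ltW t0 /ltW t1]; rewrite derive1E.
  by have [|_ ->] := dH t; rewrite ?t0.
Qed.

Lemma complex_FTC f f' : (forall t, 0 <= t <= 1 -> has_cderiv f t (f' t)) ->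
  (forall t, 0 <= t <= 1 -> ccontinuous_at t f') ->
  (\int[@lebesgue_measure R]_(t in `[0%R, 1%R]) Re (f' t))
  +i* (\int[@lebesgue_measure R]_(t in `[0%R, 1%R]) Im (f' t)) = f 1 - f 0.
Proof.
move=> df cf.
have -> := @Rintegral_FTC (fun t => Re (f' t)) (fun s => Re (f s))
  (fun t ht => (df t ht).1) (fun t ht => (cf t ht).1).
have -> := @Rintegral_FTC (fun t => Im (f' t)) (fun s => Im (f s))
  (fun t ht => (df t ht).2) (fun t ht => (cf t ht).2).
by case: (f 1) (f 0) => ? ? [].
Qed.

Lemma velocity_continuous (gam : R -> R[i]) t : C1_path gam -> ccontinuous_at t (velocity gam).
Proof. by move=> [_ _ cx cy]; split => /=; [apply: cx|apply: cy]. Qed.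

Lemma velocity_cderiv (gam : R -> R[i]) t : C1_path gam -> has_cderiv gam t (velocity gam t).
Proof.
by move=> [dx dy _ _]; split; rewrite /velocity /= derive1E; apply: DeriveDef.
Qed.

Variables (g d n : nat) (F : frame R[i] g d n).

Lemma abel_sumE u c : abel F u c =
  \sum_x fmx F c x * ((u / (1 - F x * u)) ^+ lev F x / (lev F x)%:R).
Proof.
rewrite /abel ell_idE nu_hermite [X in - X]mxE -sumrN; apply: eq_bigr => x _.
by rewrite mxE mulrN opprK.
Qed.

(** The derivative of [(u / (1 - a u))^k / k] is [u^(k-1) / (1 - a u)^(k+1)]; the terms with [k = 0]
    have coefficient 0. *)
Definition abel_deriv u c := \sum_x fmx F c x *
  (u ^+ (lev F x).-1 / (1 - F x * u) ^+ (lev F x).+1).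

Lemma abel_cderiv (gam : R -> R[i]) t l c : has_cderiv gam t l -> good F (gam t) ->
  has_cderiv (fun s => abel F (gam s) c) t (abel_deriv (gam t) c * l).
Proof.
move=> dg gt; have -> : (fun s => abel F (gam s) c) = fun s => \sum_x fmx F c x *
    ((gam s / (1 - F x * gam s)) ^+ lev F x / (lev F x)%:R).
  by apply/funext => s; rewrite abel_sumE.
rewrite /abel_deriv mulr_suml; apply: has_cderiv_sum => x.
have dden : has_cderiv (fun s => 1 - F x * gam s) t (- F x * l).
  have -> : (fun s => 1 - F x * gam s) = fun s => 1 + (- F x) * gam s.
    by apply/funext => s; rewrite mulNr.
  apply: has_cderiv_eq (has_cderivD (has_cderiv_cst _ _) (has_cderivM (has_cderiv_cst _ _) dg)).
  by rewrite mul0r !add0r.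
have dq : has_cderiv (fun s => gam s / (1 - F x * gam s)) t (l / (1 - F x * gam t) ^+ 2).
  apply: has_cderiv_eq (has_cderivM dg (has_cderivV (gt x) dden)).
  by field; exact: gt.
have := has_cderivM (has_cderiv_cst (fmx F c x) t)
  (has_cderivM (has_cderivX (lev F x) dq) (has_cderiv_cst ((lev F x)%:R^-1) t)).
apply: has_cderiv_eq; rewrite mul0r add0r mulr0 addr0 -[RHS]mulrA.
case E: (lev F x) => [|k]; first by rewrite fmx_lev0 // !mul0r.
congr (_ * _); have := pnatr_eq0 R[i] k.+1; move: k.+1%:R => r /negbT r0.
rewrite /= expr_div_n -[k.+2]addn2 exprD.
have e0 : (1 - F x * gam t) ^+ k != 0 by rewrite expf_neq0.
have e1 : 1 - F x * gam t != 0 := gt x.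
by move: (1 - F x * gam t) e0 e1 => z; move: (z ^+ k) (gam t ^+ k) => y w y0 z0; field; rewrite z0 y0 r0.
Qed.

Lemma abel_deriv_continuous (gam : R -> R[i]) t l c : has_cderiv gam t l -> good F (gam t) ->
  ccontinuous_at t (fun s => abel_deriv (gam s) c).
Proof.
move=> dg gt; have h x : exists l', has_cderiv (fun s => fmx F c x *
  (gam s ^+ (lev F x).-1 / (1 - F x * gam s) ^+ (lev F x).+1)) t l'.
  have dden : has_cderiv (fun s => 1 - F x * gam s) t (0 + (0 * gam t + (- F x) * l)).
    have -> : (fun s => 1 - F x * gam s) = fun s => 1 + (- F x) * gam s.
      by apply/funext => s; rewrite mulNr.
    exact: has_cderivD (has_cderiv_cst _ _) (has_cderivM (has_cderiv_cst _ _) dg).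
  have p0 : (1 - F x * gam t) ^+ (lev F x).+1 != 0 by rewrite expf_neq0.
  have := has_cderivM (has_cderiv_cst (fmx F c x) t)
    (has_cderivM (has_cderivX (lev F x).-1 dg) (has_cderivV p0 (has_cderivX (lev F x).+1 dden))).
  by eexists; eassumption.
have [l' hl'] := choice h.
exact: has_cderiv_continuous (has_cderiv_sum hl').
Qed.

Variable omega : 'I_g -> ratfun R[i].
Hypothesis omegaE : forall c, omega c = polar F (fmx F c).

(** Having no residues, the forms have the rational primitive [abel], so only the end point of the
    path matters. *)
Lemma path_integral_abel (gam : R -> R[i]) c : C1_path gam -> gam 0 = 0 ->
  (forall t, 0 <= t <= 1 -> good F (gam t)) ->
  path_integral gam (omega c) = abel F (gam 1) c.
Proof.
move=> C1 g0 gg; pose G t := abel_deriv (gam t) c * velocity gam t.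
have a0 : abel F (gam 0) c = 0.
  rewrite g0 abel_sumE big1 // => x _.
  case E: (lev F x) => [|k]; first by rewrite fmx_lev0 // mul0r.
  by rewrite mul0r expr0n mul0r mulr0.
transitivity ((\int[@lebesgue_measure R]_(t in `[0%R, 1%R]) Re (G t))
  +i* (\int[@lebesgue_measure R]_(t in `[0%R, 1%R]) Im (G t))).
  rewrite /path_integral; congr (_ +i* _); apply: eq_Rintegral => t;
    rewrite inE /= in_itv /= => t01; congr (_ (_ * _));
    rewrite /value_at /point_of_u omegaE value_du_polar //; try exact: gg;
    by move=> x lx; rewrite fmx_lev0.
rewrite (complex_FTC (f := fun s => abel F (gam s) c)) ?a0 ?subr0 // => t t01.
  exact: abel_cderiv (velocity_cderiv _ C1) (gg t t01).
apply: ccontinuousM (velocity_continuous _ C1).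
exact: abel_deriv_continuous (velocity_cderiv t C1) (gg t t01).
Qed.

End PathCalculus.

(** * The image of the Abel map *)

Section SmallPoints.
Variables (K : numFieldType) (g d n : nat) (F : frame K g d n).

(** For such [u] the segment from 0 to [u] meets no singular point. *)
Definition small (u : K) := forall x, `|F x * u| < 1.

Lemma small_good u : small u -> good F u.
Proof.
move=> su x; rewrite subr_eq0; apply: contraTneq (su x) => <-.
by rewrite normr1 ltxx.
Qed.

Lemma poly_eq0_small (p : {poly K}) : (forall u, small u -> p.[u] = 0) -> p = 0.
Proof.
move=> h; pose e : K := (1 + \sum_x `|F x|)^-1.
have e0 : 0 < 1 + \sum_x `|F x| by apply: ltr_pwDl; rewrite ?ltr01 // sumr_ge0.
have se (k : nat) : small (e / k.+1%:R).
  move=> x; rewrite normrM normf_div normfV (ger0_norm (ltW e0)) normr_nat.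
  rewrite mulrA ltr_pdivrMr ?ltr0n // mul1r; apply: lt_le_trans (_ : 1 <= _); last by rewrite ler1n.
  rewrite ltr_pdivrMr // mul1r (bigD1 x) //= addrCA -[X in X < _]addr0 ltrD2l.
  by apply: ltr_pwDl; rewrite ?ltr01 // sumr_ge0.
apply/eqP; apply: contraT => p0.
have := @max_poly_roots _ p [seq e / k.+1%:R | k <- iota 0 (size p)] p0.
rewrite size_map size_iota ltnn => -> //.
  by apply/allP => _ /mapP[k _ ->]; apply/rootP/h/se.
rewrite map_inj_uniq ?iota_uniq // => j k /(mulfI (invr_neq0 (lt0r_neq0 e0))) /invr_inj /eqP.
by rewrite eqr_nat eqSS => /eqP.
Qed.

Lemma abel_line_poly (p : {mpoly K[g]}) (y : 'I_g -> K) :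
  exists P : {poly K}, forall u, good F u ->
    P.[u] = (apole F).[u] ^+ (msize p) * p.@[fun c => y c + abel F u c].
Proof.
exists (mhom (@polyC K) (msize p) p (fun c => y c *: apole F + anum F c) (apole F)) => u gu.
rewrite -[LHS]/(horner_eval u _) (@rmorph_mhom _ _ _ _ idfun) => [|c]; last first.
  by rewrite /= /horner_eval hornerC.
rewrite -mhom_meval //; last exact/apole_neq0.
by apply: eq_mhom => c; rewrite /= /horner_eval hornerD hornerZ anumE // mulrDr mulrC.
Qed.

(** The points are treated one at a time: in each of them the function is rational with denominator
    a power of [apole], and it vanishes at infinitely many small values. In the induction [vs]
    collects the points already small. *)
Lemma abel_sum_small_dense (p : {mpoly K[g]}) M :
  (forall us, size us = M -> (forall u, u \in us -> small u) ->
     p.@[fun c => \sum_(u <- us) abel F u c] = 0) ->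
  forall us, size us = M -> (forall u, u \in us -> good F u) ->
     p.@[fun c => \sum_(u <- us) abel F u c] = 0.
Proof.
move=> h us sM gus; rewrite -[us]cats0.
have: forall u, u \in [::] -> small u by [].
have: (size us + size ([::] : seq K))%N = M by rewrite addn0.
elim: us [::] gus {sM} => [|u us IH] vs gus sM svs; first exact: h.
have [P PE] := abel_line_poly p (fun c => \sum_(v <- us ++ vs) abel F v c).
have E v : good F v -> P.[v] = (apole F).[v] ^+ msize p *
    p.@[fun c => \sum_(w <- us ++ v :: vs) abel F w c].
  move=> gv; rewrite PE //; congr (_ * _); apply: meval_eq => c.
  by rewrite !big_cat big_cons /= -addrA; congr (_ + _); apply: addrC.
have P0 : P = 0.
  apply: poly_eq0_small => v sv; rewrite E ?IH ?mulr0 //; first 1 last.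
  - by rewrite /= addnS -addSn.
  - by move=> w; rewrite in_cons => /predU1P[->|/svs].
  - exact: small_good.
  - by move=> w wus; apply: gus; rewrite in_cons wus orbT.
have gu : good F u by apply: gus; rewrite mem_head.
have /eqP := E u gu; rewrite P0 horner0 eq_sym mulf_eq0 expf_eq0.
have /negbTE -> : (apole F).[u] != 0 by apply/apole_neq0.
rewrite andbF /= => /eqP E0; rewrite -[RHS]E0; apply: meval_eq => c.
by rewrite big_cons !big_cat big_cons /= addrCA.
Qed.

End SmallPoints.

Section AbelImage.
Variables (R : realType) (C : rational_curve R[i]) (g d n : nat).
Variables (F : frame R[i] g d n) (omega : 'I_g -> ratfun R[i]).
Hypothesis omegaE : forall c, omega c = polar F (fmx F c).
Hypothesis singE : forall Q, singular C Q <-> exists x, Q = Some (F x).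

Lemma smooth_point_of_u w : smooth C (point_of_u w) <-> good F w.
Proof.
rewrite /point_of_u; split => [sm x|gw].
  apply/negP => /eqP E; have Fw : F x * w = 1 by apply/eqP; rewrite eq_sym -subr_eq0 E.
  have w0 : w != 0 by apply: contraTneq (oner_neq0 R[i]) => w0; rewrite -Fw w0 mulr0 eqxx.
  have : singular C (Some w^-1).
    by apply/singE; exists x; congr Some; rewrite -[LHS]mul1r -Fw mulfK.
  by rewrite (negbTE w0) in sm; apply.
apply: contrapT => /singE[x]; case: eqVneq => // w0 [wE].
by have := gw x; rewrite -wE mulVf // subrr eqxx.
Qed.

Lemma abel_imageP z : abel_image C omega z -> exists us, [/\ size us = g.-1,
  (forall u, u \in us -> good F u) & z = fun c => \sum_(u <- us) abel F u c].
Proof.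
move=> [P [gam [gP zE]]]; exists [seq gam k 1 | k <- enum 'I_g.-1]; split.
- by rewrite size_map size_enum_ord.
- move=> _ /mapP[k _ ->]; have [_ _ _ h] := gP k.
  by apply/smooth_point_of_u/h; rewrite ler01 lexx.
apply/funext => c; rewrite zE big_map big_enum /=; apply: eq_bigr => k _.
have [C1 g0 _ h] := gP k; apply: path_integral_abel => // t t01.
by apply/smooth_point_of_u/h.
Qed.

Lemma segment_smooth u : small F u -> smooth_path C (fun t => t%:C * u) (point_of_u u).
Proof.
move=> su; split.
- have E1 : (fun t : R => complex.Re (t%:C * u)) = (complex.Re u) \*: (id : R -> R).
    by apply/funext => t; case: (u) => a b /=; rewrite mul0r subr0 /GRing.scale /= mulrC.
  have E2 : (fun t : R => complex.Im (t%:C * u)) = (complex.Im u) \*: (id : R -> R).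
    by apply/funext => t; case: (u) => a b /=; rewrite mul0r addr0 /GRing.scale /= mulrC.
  have D (a : R) : derive1 (a \*: (id : R -> R)) = fun=> a.
    apply/funext => t; rewrite derive1E; have [_ ->] := is_deriveZ a (is_derive_id t (1 : R)).
    by rewrite /GRing.scale /= mulr1.
  rewrite /C1_path /= E1 E2 !D; split; try by move=> t; apply: derivableZ; apply: derivable_id.
  + by move=> t; apply: cvg_cst.
  + by move=> t; apply: cvg_cst.
- by rewrite mul0r.
- by rewrite mul1r.
- move=> t /andP[t0 t1]; apply/smooth_point_of_u/small_good => x.
  rewrite mulrCA normrM; apply: le_lt_trans (su x); rewrite -[leRHS]mul1r.
  apply: ler_wpM2r => //; rewrite -[t%:C]ger0_norm; last by rewrite lecR.
  by rewrite normr_id ger0_norm ?lecR.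
Qed.

Lemma abel_image_small us : size us = g.-1 -> (forall u, u \in us -> small F u) ->
  abel_image C omega (fun c => \sum_(u <- us) abel F u c).
Proof.
move=> sus su; pose w (k : 'I_g.-1) := us`_k.
have sw k : small F (w k) by apply: su; rewrite mem_nth // sus.
exists (fun k => point_of_u (w k)), (fun k t => t%:C * w k); split.
  by move=> k; apply: segment_smooth.
move=> j; rewrite (big_nth 0) sus big_mkord; apply: eq_bigr => k _.
have [C1 g0 _ h] := segment_smooth (sw k).
rewrite (path_integral_abel omegaE) ?mul1r // => t t01.
by apply/smooth_point_of_u/h.
Qed.

End AbelImage.

(** * The main theorem *)

(** Polar form: [acos] gives the argument up to the sign, which is that of the imaginary part. *)
Lemma cexp_surjective (R : realType) (c : R[i]) : c != 0 -> exists z, cexp z = c.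
Proof.
case: c => a b ab0; pose r := Num.sqrt (a ^+ 2 + b ^+ 2).
have s0 : 0 < a ^+ 2 + b ^+ 2.
  rewrite lt_neqAle eq_sym addr_ge0 ?sqr_ge0 // andbT paddr_eq0 ?sqr_ge0 // !sqrf_eq0.
  by apply: contra ab0 => /andP[/eqP -> /eqP ->].
have r0 : 0 < r by rewrite sqrtr_gt0.
have r2 : r ^+ 2 = a ^+ 2 + b ^+ 2 by rewrite sqr_sqrtr // ltW.
have ar2 : (a / r) ^+ 2 <= 1.
  by rewrite expr_div_n ler_pdivrMr ?exprn_gt0 // mul1r r2 lerDl sqr_ge0.
have ar : -1 <= a / r <= 1.
  by rewrite -ler_norml -(ler_pXn2r (n := 2)) ?nnegrE // expr1n real_normK ?num_real.
have cosE : cos (acos (a / r)) = a / r by apply: acosK; rewrite in_itv.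
have sinE : sin (acos (a / r)) = `|b| / r.
  rewrite sin_acos // -[RHS]ger0_norm ?divr_ge0 // ?ltW // -sqrtr_sqr; congr Num.sqrt.
  rewrite !expr_div_n real_normK ?num_real // r2.
  by field; exact: lt0r_neq0.
have eE : expR (ln r) = r by rewrite lnK.
exists (ln r +i* (if 0 <= b then acos (a / r) else - acos (a / r))).
rewrite /cexp /= eE; congr (_ +i* _).
  by case: ifP; rewrite ?cosN cosE mulrC divfK // lt0r_neq0.
case: ifP => [b0|/negbT]; first by rewrite sinE ger0_norm // mulrC divfK // lt0r_neq0.
rewrite -ltNge => b0; rewrite sinN sinE ltr0_norm // mulrN mulNr mulrN opprK mulrC divfK //.
exact: lt0r_neq0.
Qed.

(** * Coefficients of formal exponentials *)

Section FormalExponential.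
Variable R : realType.

Lemma fps_mulE (a b : fps R[i]) N m (p q : {mpoly R[i][N]}) :
  (forall m', (mdeg m' <= mdeg m)%N -> a N m' = p@_m') ->
  (forall m', (mdeg m' <= mdeg m)%N -> b N m' = q@_m') ->
  fps_mul a b N m = (p * q)@_m.
Proof.
move=> ap bq; rewrite mcoeffM; apply: eq_bigr => k /eqP mE.
by rewrite ap ?bq // -ltnS bmdeg.
Qed.

Lemma fps_exprnE (a : fps R[i]) N m (p : {mpoly R[i][N]}) k :
  (forall m', a N m' = p@_m') -> fps_exprn a k N m = (p ^+ k)@_m.
Proof.
move=> ap; elim: k m => [|k IH] m; first by rewrite expr0 mcoeff1.
by rewrite exprS -[LHS]/(fps_mul a (fps_exprn a k) N m) (@fps_mulE _ _ N m p (p ^+ k)).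
Qed.

(** The linear form [q] is homogeneous of degree 1, so its powers beyond [mdeg m] do not reach the
    monomial [m]. *)
Lemma fps_exp_affineE c (b : nat -> R[i]) N m D : (mdeg m < D)%N ->
  fps_exp (fps_affine c b) N m =
    (cexp c *: texp (@mpolyC N R[i]) D (\sum_(i < N) b i.+1 *: 'X_i))@_m.
Proof.
move=> mD; set q := \sum_(i < N) _.
have qh : q \is 1.-homog.
  by apply: rpred_sum => i _; apply: dhomogZ; rewrite dhomogX /= mdeg1.
have q0 : q@_(0%MM) = 0 by rewrite (dhomog_nemf_coeff qh) //= mdeg0.
have a0 : fps_affine c b N 0%MM = c.
  by rewrite /fps_affine -/q mcoeffD mcoeffC eqxx mulr1 q0 addr0.
rewrite mcoeffZ /fps_exp a0; congr (_ * _); rewrite /texp big_mkord raddf_sum /=.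
rewrite (big_ord_widen_cond _ xpredT
  (fun k => (k`!%:R)^-1 * fps_exprn (fun N m => if m == 0%MM then 0 else fps_affine c b N m) k N m) mD).
rewrite big_mkcond /=; apply: eq_bigr => k _.
rewrite (@fps_exprnE _ N m q) => [|m']; last first.
  case: eqVneq => [->|m0]; first by rewrite q0.
  by rewrite /fps_affine -/q mcoeffD mcoeffC (negbTE m0) mulr0 add0r.
rewrite /texp_term mcoeffCM; case: ltnP => // km.
have := dhomogMn k qh; rewrite mul1n => /dhomog_nemf_coeff -> //; first by rewrite mulr0.
by rewrite /= ltn_eqF.
Qed.

End FormalExponential.

Lemma exists_curve_frame (K : numClosedFieldType) (C : rational_curve K) m (a : 'I_m -> K)
    g (omega : 'I_g -> ratfun K) : injective a -> unibranch C ->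
  (forall Q, singular C Q <-> exists i, Q = Some (a i)) ->
  is_basis (dualizing_sections C) omega ->
  exists d n (F : frame K g d n), [/\ forall i, exists x, F x = a i,
    forall x, exists i, F x = a i & forall c, omega c = polar F (fmx F c)].
Proof.
move=> ai ub sE ba; have [n cond] := common_conductor a ub.
exists (m * n.+1)%N, n.+1, (curve_frame ai ub sE cond ba); split=> [i|x|c].
- by have [y [yi _]] := grid_cell i (ltn0Sn n); exists y; rewrite /= yi.
- by exists (grid_index x).
- exact: curve_frame_form.
Qed.

Section MainTheorem.
Variables (R : realType) (C : rational_curve R[i]) (g d n : nat).
Variables (F : frame R[i] g d n) (omega : 'I_g -> ratfun R[i]) (theta : {mpoly R[i][g]}).
Hypothesis omegaE : forall c, omega c = polar F (fmx F c).
Hypothesis singE : forall Q, singular C Q <-> exists x, Q = Some (F x).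
Hypothesis site0 : exists x, F x = 0.
Hypothesis g_gt0 : (0 < g)%N.
Hypothesis theta_theta : theta_function C omega theta.

Lemma theta_function_Theta : exists2 c, c != 0 & Theta F = c *: theta.
Proof.
have [[th0 thR] thE] := theta_theta.
apply: theta_unique => //.
(* [theta] vanishes on the Abel image, which contains the sums of small points; density extends this
   to all good points. *)
- apply: abel_sum_small_dense => us sus su.
  have : theta_divisor C omega (fun c => \sum_(u <- us) abel F u c).
    by move=> p; apply; apply: abel_image_small.
  by rewrite -thE.
(* [Theta] vanishes on the Abel image, hence on its Zariski closure, which is the zero set of
   [theta]. *)
- move=> z thz; rewrite -Theta_meval.
  have : theta_divisor C omega z by rewrite -thE.
  apply=> w /(abel_imageP omegaE singE)[us [sus gus ->]].
  by rewrite Theta_meval theta_abel_sum // sus prednK.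
Qed.

(** [b] is prescribed at positive indices only, as [fps_affine] reads no other. At index 0 the
    convention [0^0 = 1] would make the site 0 count. *)
Lemma tau_theta : exists (I : {set 'I_d}) (c0 : R[i]), forall b : nat -> R[i],
  (forall i, b i.+1 = \sum_(x in I) F x ^+ i.+1) ->
  tau (differential_frame omega) =
  fps_mul (fps_exp (fps_affine c0 b))
    (fps_subst_linear theta (expansion_matrix omega)).
Proof.
have [c c0 TE] := theta_function_Theta; have [z zc] := cexp_surjective c0.
have [I HI] := tau_frame F; exists I, z => b bE.
apply: functional_extensionality_dep => N; apply/funext => m.
(* Any [D] that is at least [n] and exceeds the weight of [m] will do. *)
have := HI _ (frame_coef_moment omegaE) (@frame_coef_ext _ _ omega) N m (n + mnmwgt m).+1.
move=> -> //; [|by rewrite leqW // leq_addr|by rewrite ltnS leq_addl].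
have md : (mdeg m < (n + mnmwgt m).+1)%N.
  by rewrite ltnS (leq_trans (leq_mdeg_mnmwgt m)) // leq_addl.
have qE : \sum_(x in I) xi_at N (F x) = \sum_(i < N) b i.+1 *: 'X_i.
  by rewrite exchange_big /=; apply: eq_bigr => i _; rewrite bE scaler_suml.
have linE : [tuple lin_form F N j | j < g] =
    [tuple \sum_(i < N) expansion_matrix omega j i *: 'X_i | j < g].
  apply: eq_mktuple => j; apply: eq_bigr => i _.
  by rewrite (expansion_matrixE omegaE).
rewrite TE comp_mpolyZ linE -scalerAr scalerAl -zc qE.
symmetry; apply: fps_mulE => m' mm' //.
by apply: fps_exp_affineE; apply: leq_ltn_trans md.
Qed.

End MainTheorem.

Theorem theorem4p11 (R : realType) (C : rational_curve R[i]) (g s : nat)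
    (t : 'I_s -> R[i]) (omega : 'I_g -> ratfun R[i]) (theta : {mpoly R[i][g]})
    (g_ge1 : (1 <= g)%N)
    (C_genus : arithmetic_genus C g)
    (C_gorenstein : gorenstein C)
    (C_unibranch : unibranch C)
    (t_neq0 : forall i, t i != 0)
    (t_inj : injective t)
    (C_singular : forall Q : proj_line R[i],
       singular C Q <-> (Q = Some 0 \/ exists i, Q = Some (t i)))
    (omega_basis : is_basis (dualizing_sections C) omega)
    (theta_theta : theta_function C omega theta) :
  exists (c0 : R[i]) (c : 'I_s -> int),
    tau (differential_frame omega) =
    fps_mul
      (fps_exp (fps_affine c0
         (fun i : nat => \sum_(k < s) (c k)%:~R * t k ^+ i)))
      (fps_subst_linear theta (expansion_matrix omega)).
Proof.
(* The points 0, t_1, ..., t_s as a single injective family. *)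
pose a (i : 'I_s.+1) := if unlift ord0 i is Some j then t j else 0.
have a0 : a ord0 = 0 by rewrite /a unlift_none.
have aS j : a (lift ord0 j) = t j by rewrite /a liftK.
have ai : injective a.
  move=> i j; case: (unliftP ord0 i) => [i'|] ->; case: (unliftP ord0 j) => [j'|] ->;
    rewrite ?aS ?a0 //.
  - by move/t_inj ->.
  - by move/eqP; rewrite (negbTE (t_neq0 _)).
  - by move/esym/eqP; rewrite (negbTE (t_neq0 _)).
have sE Q : singular C Q <-> exists i, Q = Some (a i).
  rewrite C_singular; split => [[->|[j ->]]|[i ->]].
  - by exists ord0; rewrite a0.
  - by exists (lift ord0 j); rewrite aS.
  - by case: (unliftP ord0 i) => [j|] ->; [right; exists j; rewrite aS|left; rewrite a0].
have [d [n [F [Fa aF omegaE]]]] := exists_curve_frame ai C_unibranch sE omega_basis.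
have sF Q : singular C Q <-> exists x, Q = Some (F x).
  rewrite sE; split => [[i ->]|[x ->]].
    by have [x <-] := Fa i; exists x.
  by have [i ->] := aF x; exists i.
have site0 : exists x, F x = 0 by have [x xE] := Fa ord0; exists x; rewrite xE.
have [I [c0 tauE]] := tau_theta omegaE sF site0 g_ge1 theta_theta.
(* [c k] counts the indices of [I] at the site [t k]; those at the site 0 contribute
   [0^(i+1) = 0]. *)
exists c0, (fun k => #|[set x in I | F x == t k]|%:Z); apply: tauE => i; apply: esym.
rewrite (bigID (fun x => F x == 0)) /= [X in X + _]big1 ?add0r; last first.
  by move=> x /andP[_ /eqP ->]; rewrite expr0n.
transitivity (\sum_(x in I | F x != 0) \sum_(k < s | F x == t k) t k ^+ i.+1).
  apply: eq_bigr => x /andP[_ Fx]; have [j xj] := aF x.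
  move: Fx; rewrite xj; case: (unliftP ord0 j) => [k|] ->; last by rewrite a0 eqxx.
  rewrite aS => _; rewrite (big_pred1 k) // => l /=.
  by rewrite (inj_eq t_inj) eq_sym.
rewrite (exchange_big_dep xpredT) //=; apply: eq_bigr => k _.
rewrite sumr_const -mulr_natl; congr (_%:R * _).
apply: eq_card => x; rewrite inE [LHS]unfold_in /= -andbA; congr (_ && _).
by case: (eqVneq (F x) (t k)) => [->|_]; rewrite ?t_neq0 // andbF.
Qed.
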